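(* Let $\Omega\subset\mathbb{R}^2$ be a bounded domain with smooth boundary $\gamma=\partial\Omega$, and let $\beta>0$ with Larmor radius $r=1/\beta$ satisfy the curvature assumption $r<r_0/2$, where $r_0$ is the maximal radius of a tubular neighbourhood of $\gamma$. Suppose that the magnetic billiard flow $g^t$ in $\Omega$ admits a non-constant polynomial in momenta integral $\Phi$. Then each of the parallel curves $\gamma_{+r}$ and $\gamma_{-r}$ is a real oval of an affine algebraic curve which is non-singular in $\mathbb{C}^2$.
   Context: $\gamma$ is a simple closed $C^\infty$ curve, parametrized counterclockwise by arc length $s$; $J$ is the counterclockwise rotation by $\pi/2$ and $n(s)=J\dot\gamma(s)$ is the unit normal; $k$ denotes the curvature of $\gamma$. For real $t$ the parallel curve is $\gamma_t(s)=\gamma(s)+t\,n(s)$. The number $r_0$ is the largest radius for which the tubular neighbourhood of $\gamma$ is diffeomorphic to its normal bundle (so $\gamma_t$ is a smooth embedded curve for $|t|<r_0$, and $r_0\le 1/\max|k|$). Magnetic billiard with constant field of magnitude $\beta$: a particle moves inside $\Omega$ with unit speed along arcs of circles of radius $r=1/\beta$ traversed counterclockwise (Larmor arcs); on hitting $\gamma$ the velocity is reflected, $v\mapsto v-2\langle n,v\rangle n$. $g^t$ denotes the resulting flow on unit tangent vectors. Let $\Omega_+$ be the closed annulus bounded by $\gamma$ and $\gamma_{+2r}$ (the region swept by all Larmor arcs lying in $\Omega$ that intersect $\partial\Omega$). A polynomial in momenta integral is a function $\Phi(x,v)=\sum_{0\le k+l\le N}a_{kl}(x)v_1^kv_2^l$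 on unit tangent vectors $(x,v)$ with $x\in\Omega_+$, with coefficients $a_{kl}\in C^\infty(\overline{\Omega_+})$, such that: (1) $\Phi$ is constant along the magnetic flow between collisions, i.e. for every $x\in\gamma$ and every inward unit vector $v$ at $x$, $\Phi(g^t(x,v))=\Phi(x,v)$ (for $t$ before the next collision); (2) $\Phi(x,v)=\Phi(x,v-2\langle n,v\rangle n)$ for every $x\in\partial\Omega$ and unit $v$ at $x$. *)

(* Defs.v *)
From Stdlib Require Import Reals.
From Coquelicot Require Import Coquelicot.
Open Scope R_scope.

Definition pt := (R * R)%type.

Definition smooth1 (f : R -> R) : Prop := forall (n : nat) (x : R), ex_derive_n f n x.

Fixpoint partial_iter (l : list bool) (f : R -> R -> R) : R -> R -> R :=
  match l with
  | nil => f
  | cons b l' =>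
      let g := partial_iter l' f in
      if b then fun x y => Derive (fun t => g t y) x
      else fun x y => Derive (fun t => g x t) y
  end.

Definition smooth2 (f : R -> R -> R) : Prop :=
  forall (l : list bool) (x y : R),
    ex_derive (fun t => partial_iter l f t y) x /\
    ex_derive (fun t => partial_iter l f x t) y /\
    continuity_2d_pt (partial_iter l f) x y.

Definition simple_closed_arclength_ccw (gx gy : R -> R) (L : R) : Prop :=
  0 < L /\ smooth1 gx /\ smooth1 gy /\
  (forall s, gx (s + L) = gx s /\ gy (s + L) = gy s) /\
  (forall s1 s2, 0 <= s1 < L -> 0 <= s2 < L ->
     gx s1 = gx s2 -> gy s1 = gy s2 -> s1 = s2) /\
  (forall s, (Derive gx s) ^ 2 + (Derive gy s) ^ 2 = 1) /\
  0 < RInt (fun s => gx s * Derive gy s - gy s * Derive gx s) 0 L.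

Definition gam (gx gy : R -> R) (s : R) : pt := (gx s, gy s).

Definition nrm (gx gy : R -> R) (s : R) : pt := (- Derive gy s, Derive gx s).

Definition curv (gx gy : R -> R) (s : R) : R :=
  Derive gx s * Derive (Derive gy) s - Derive gy s * Derive (Derive gx) s.

Definition par (gx gy : R -> R) (t s : R) : pt :=
  (gx s + t * fst (nrm gx gy s), gy s + t * snd (nrm gx gy s)).

Definition on_curve (gx gy : R -> R) (p : pt) : Prop := exists s, p = gam gx gy s.

(* The map (s,t) |-> gamma(s) + t n(s) on (R/LZ) x (-rho,rho) is a diffeomorphism
   onto its image: injective, with nonvanishing Jacobian 1 - t k(s). *)
Definition tubular_ok (gx gy : R -> R) (L rho : R) : Prop :=
  0 < rho /\
  (forall s1 s2 t1 t2, 0 <= s1 < L -> 0 <= s2 < L -> Rabs t1 < rho -> Rabs t2 < rho ->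
     par gx gy t1 s1 = par gx gy t2 s2 -> s1 = s2 /\ t1 = t2) /\
  (forall s t, Rabs t < rho -> 1 - t * curv gx gy s <> 0).

Definition is_r0 (gx gy : R -> R) (L r0 : R) : Prop :=
  (forall rho, tubular_ok gx gy L rho -> rho <= r0) /\
  (forall b, (forall rho, tubular_ok gx gy L rho -> rho <= b) -> r0 <= b).

Definition dot (u v : pt) : R := fst u * fst v + snd u * snd v.
Definition unit_vec (v : pt) : Prop := dot v v = 1.
Definition Jrot (v : pt) : pt := (- snd v, fst v).
Definition rot (th : R) (v : pt) : pt :=
  (fst v * cos th - snd v * sin th, fst v * sin th + snd v * cos th).

Definition larmor_pos (beta : R) (x v : pt) (t : R) : pt :=
  let r := / beta in
  let w := rot (beta * t) (Jrot v) in
  (fst x + r * fst (Jrot v) - r * fst w, snd x + r * snd (Jrot v) - r * snd w).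
Definition larmor_vel (beta : R) (v : pt) (t : R) : pt := rot (beta * t) v.

Definition reflect (n v : pt) : pt :=
  (fst v - 2 * dot n v * fst n, snd v - 2 * dot n v * snd n).

Definition Omega_plus (gx gy : R -> R) (beta : R) (p : pt) : Prop :=
  exists s t, 0 <= t <= 2 * / beta /\ p = par gx gy t s.

Definition Phi (N : nat) (a : nat -> nat -> R -> R -> R) (x v : pt) : R :=
  sum_f_R0 (fun k => sum_f_R0 (fun l =>
     a k l (fst x) (snd x) * (fst v) ^ k * (snd v) ^ l) (N - k)%nat) N.

Definition polynomial_integral (gx gy : R -> R) (beta : R) (N : nat)
    (a : nat -> nat -> R -> R -> R) : Prop :=
  (forall k l, smooth2 (a k l)) /\
  (forall s v t, unit_vec v -> 0 < dot (nrm gx gy s) v -> 0 < t ->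
     (forall tau, 0 < tau <= t -> ~ on_curve gx gy (larmor_pos beta (gam gx gy s) v tau)) ->
     Phi N a (larmor_pos beta (gam gx gy s) v t) (larmor_vel beta v t)
     = Phi N a (gam gx gy s) v) /\
  (forall s v, unit_vec v ->
     Phi N a (gam gx gy s) v = Phi N a (gam gx gy s) (reflect (nrm gx gy s) v)).

Definition nonconstant_on_Omega_plus (gx gy : R -> R) (beta : R) (N : nat)
    (a : nat -> nat -> R -> R -> R) : Prop :=
  exists x1 v1 x2 v2,
    Omega_plus gx gy beta x1 /\ unit_vec v1 /\
    Omega_plus gx gy beta x2 /\ unit_vec v2 /\
    Phi N a x1 v1 <> Phi N a x2 v2.

Fixpoint sumC (n : nat) (f : nat -> C) : C :=
  match n with
  | O => f O
  | S m => Cplus (sumC m f) (f n)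
  end.
Fixpoint Cpow (z : C) (n : nat) : C :=
  match n with O => RtoC 1 | S m => Cmult z (Cpow z m) end.

Definition polyR (d : nat) (c : nat -> nat -> R) (p : pt) : R :=
  sum_f_R0 (fun k => sum_f_R0 (fun l => c k l * (fst p) ^ k * (snd p) ^ l) d) d.
Definition polyCC (d : nat) (c : nat -> nat -> R) (z w : C) : C :=
  sumC d (fun k => sumC d (fun l =>
    Cmult (Cmult (RtoC (c k l)) (Cpow z k)) (Cpow w l))).
Definition polyCC_dx (d : nat) (c : nat -> nat -> R) (z w : C) : C :=
  sumC d (fun k => sumC d (fun l =>
    Cmult (Cmult (RtoC (INR k * c k l)) (Cpow z (pred k))) (Cpow w l))).
Definition polyCC_dy (d : nat) (c : nat -> nat -> R) (z w : C) : C :=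
  sumC d (fun k => sumC d (fun l =>
    Cmult (Cmult (RtoC (INR l * c k l)) (Cpow z k)) (Cpow w (pred l)))).

Definition nonsingular_in_C2 (d : nat) (c : nat -> nat -> R) : Prop :=
  forall z w : C,
    ~ (polyCC d c z w = RtoC 0 /\ polyCC_dx d c z w = RtoC 0 /\ polyCC_dy d c z w = RtoC 0).

Definition open2 (U : pt -> Prop) : Prop :=
  forall p, U p -> exists e, 0 < e /\
    forall q, Rabs (fst q - fst p) < e -> Rabs (snd q - snd p) < e -> U q.
Definition connected2 (S : pt -> Prop) : Prop :=
  ~ exists U V, open2 U /\ open2 V /\
     (forall p, S p -> U p \/ V p) /\
     (exists p, S p /\ U p) /\ (exists p, S p /\ V p) /\
     (forall p, S p -> U p -> V p -> False).
Definition connected_component_of (Z S : pt -> Prop) : Prop :=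
  (exists p, S p) /\ (forall p, S p -> Z p) /\ connected2 S /\
  (forall Cc, connected2 Cc -> (forall p, Cc p -> Z p) ->
     (exists p, Cc p /\ S p) -> forall p, Cc p -> S p).

Definition real_oval_of_nonsingular_affine_curve (S : pt -> Prop) : Prop :=
  exists (d : nat) (c : nat -> nat -> R),
    (exists k l, (k <= d)%nat /\ (l <= d)%nat /\ c k l <> 0) /\
    nonsingular_in_C2 d c /\
    connected_component_of (fun p => polyR d c p = 0) S.

Definition parallel_image (gx gy : R -> R) (t : R) (p : pt) : Prop :=
  exists s, p = par gx gy t s.

(* Main.v *)
(* Between collisions the particle turns around its Larmor center, so the integral is a function F
   of that center.  On the annulus swept by the arcs, write Phi as a trigonometric polynomial in the
   direction of v; invariance along arcs is a two-step recursion between the d/dz and d/dzbar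
   derivatives of its Fourier coefficients, which forces all derivatives of high order to vanish.
   Hence the coefficients are polynomials, and so is F.  Reflection invariance says that F,
   restricted to the circle of radius r around a boundary point gamma(s), is even with respect to
   the normal; in particular F is constant on the parallel curves.

   Let f be a polynomial of minimal degree vanishing on an arc of a parallel curve, and let
   F - const = f^k g with g not divisible by f.  The first odd coefficient of F on the circle around
   gamma(s) is a transport equation along the arc, whose integral is
     g^3 (u^3 / r - H)^k = const <> 0,
   where u is the normal derivative of f and H = fxx fy^2 - 2 fxy fx fy + fyy fx^2.  Eliminating u by
   u^2 = fx^2 + fy^2 gives a polynomial that vanishes on the arc, hence is divisible by f, but is a
   nonzero constant where f = fx = fy = 0; so f = 0 is non-singular in C^2.  The same identity keeps
   g away from 0 at the end of an arc, so f vanishes on the whole parallel curve, which is then a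
   connected component of the real zero set. *)

(* The invariance hypothesis speaks only of arcs that start on the boundary and end at the next
   collision, so at a point of the annulus it constrains only some directions of [v]. An open
   interval of directions is enough: a trigonometric polynomial that vanishes on an interval of
   angles is zero, which yields the recursion at every point.

   The exponent 3 comes from the contact of the circle with the parallel curve. They are tangent, so
   on the circle [f = a phi^2 + b phi^3 + ...], and with [psi = 1 - rho K] the first odd coefficient
   becomes [3 g'/g + k (log (u^3 / psi))' = 0]. The factor [psi] contains the curvature [K] of the
   boundary, which is not algebraic in the position; but the curvature [K / psi] of the parallel
   curve is also [- H / u^3], and this turns [u^3 / psi] into [u^3 - rho H].

   Both parallel curves are treated at once by a signed radius [rho], since evenness about the
   normal is the same as evenness about its opposite. *)
Require Import Defs.
From Stdlib Require Import Reals Lra Psatz Classical ClassicalEpsilon FunctionalExtensionality.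
From Coquelicot Require Import Coquelicot.
From mathcomp Require Import all_boot all_algebra.
From mathcomp Require Import Rstruct complex.
From mathcomp Require ring.
Set Implicit Arguments.
Unset Strict Implicit.
Delimit Scope R_scope with Re.
Delimit Scope ring_scope with Ring.
Open Scope R_scope.
Import GRing.Theory.

(** * Evaluation of bivariate polynomials *)

Section Bivariate.
Local Open Scope ring_scope.


(* The outer variable of [{poly {poly K}}] is the second coordinate. *)
Definition ev2 (K : comNzRingType) (p : {poly {poly K}}) (x y : K) : K :=
  p.[y%:P].[x].

Lemma ev2D (K : comNzRingType) (p q : {poly {poly K}}) x y :
  ev2 (p + q) x y = ev2 p x y + ev2 q x y.
Proof. by rewrite /ev2 !hornerD. Qed.

Lemma ev2M (K : comNzRingType) (p q : {poly {poly K}}) x y :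
  ev2 (p * q) x y = ev2 p x y * ev2 q x y.
Proof. by rewrite /ev2 !hornerM. Qed.

Lemma ev2N (K : comNzRingType) (p : {poly {poly K}}) x y :
  ev2 (- p) x y = - ev2 p x y.
Proof. by rewrite /ev2 !hornerN. Qed.

Lemma ev2C (K : comNzRingType) (c : {poly K}) x y : ev2 c%:P x y = c.[x].
Proof. by rewrite /ev2 !hornerC. Qed.

Lemma ev2X (K : comNzRingType) (x y : K) : ev2 'X x y = y.
Proof. by rewrite /ev2 hornerX hornerC. Qed.

(** The bounds [m] and [n] need not be the exact sizes, so that the double sum can be matched with
    the fixed square of exponents in [polyR] and [polyCC]. *)
Lemma ev2_wide (K : comNzRingType) (p : {poly {poly K}}) (m n : nat) (x y : K) :
  (size p <= m)%N -> (forall l, (size (p`_l)%Ring <= n)%N) ->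
  ev2 p x y = \sum_(k < n) \sum_(l < m) p`_l`_k * x ^+ k * y ^+ l.
Proof.
move=> pm pn; rewrite /ev2 (horner_coef_wide _ pm) horner_sum exchange_big /=.
apply: eq_bigr => l _.
rewrite hornerM -rmorphXn /= hornerC (horner_coef_wide _ (pn l)) big_distrl /=.
by apply: eq_bigr.
Qed.

Definition dX (K : comNzRingType) (p : {poly {poly K}}) : {poly {poly K}} :=
  map_poly (@deriv K) p.

Definition dY (K : comNzRingType) (p : {poly {poly K}}) : {poly {poly K}} := p^`().

Lemma deriv_wide (K : comNzRingType) (p : {poly K}) (n : nat) (x : K) :
  (size p <= n)%N -> p^`().[x] = \sum_(k < n) p`_k *+ k * x ^+ k.-1.
Proof.
case: n => [|n] pn.
  by move: pn; rewrite leqn0 size_poly_eq0 => /eqP ->; rewrite deriv0 horner0 big_ord0.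
rewrite big_ord_recl mulr0n mul0r add0r (@horner_coef_wide _ n).
  by apply: eq_bigr => i _; rewrite coef_deriv.
by apply: leq_trans (size_poly _ _) _; case: (size p) pn.
Qed.

Lemma ev2_dX_wide (K : comNzRingType) (p : {poly {poly K}}) (m n : nat) (x y : K) :
  (size p <= m)%N -> (forall l, (size (p`_l)%Ring <= n)%N) ->
  ev2 (dX p) x y = \sum_(k < n) \sum_(l < m) p`_l`_k *+ k * x ^+ k.-1 * y ^+ l.
Proof.
move=> pm pn; rewrite /ev2 (@horner_coef_wide _ m (dX p)); last first.
  by apply/leq_sizeP => j mj; rewrite /dX coef_map /= nth_default ?raddf0 // (leq_trans pm mj).
rewrite horner_sum exchange_big /=; apply: eq_bigr => l _.
rewrite hornerM -rmorphXn /= hornerC /dX coef_map /= (deriv_wide _ (pn l)) big_distrl /=.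
by apply: eq_bigr.
Qed.

Lemma ev2_dY_wide (K : comNzRingType) (p : {poly {poly K}}) (m n : nat) (x y : K) :
  (size p <= m)%N -> (forall l, (size (p`_l)%Ring <= n)%N) ->
  ev2 (dY p) x y = \sum_(k < n) \sum_(l < m) p`_l`_k *+ l * x ^+ k * y ^+ l.-1.
Proof.
move=> pm pn; rewrite /ev2 (deriv_wide _ pm) horner_sum exchange_big /=.
apply: eq_bigr => l _.
rewrite hornerM -rmorphXn /= hornerC hornerMn (horner_coef_wide _ (pn l)) -sumrMnl.
by rewrite big_distrl /=; apply: eq_bigr => i _; rewrite !mulrnAl.
Qed.

Lemma dXD (K : comNzRingType) (p q : {poly {poly K}}) : dX (p + q) = dX p + dX q.
Proof. by rewrite /dX raddfD. Qed.

Lemma dXMX (K : comNzRingType) (p : {poly {poly K}}) : dX (p * 'X) = dX p * 'X.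
Proof.
by apply/polyP => i; rewrite /dX !(coef_map, coefMX) /=; case: eqP => _; rewrite ?coef_map // raddf0.
Qed.

Lemma dXC (K : comNzRingType) (c : {poly K}) : dX c%:P = (c^`())%:P.
Proof. by rewrite /dX map_polyC. Qed.

End Bivariate.

Definition ev (p : {poly {poly R}}) (x y : R) : R := ev2 p x y.

Definition cst (a : R) : {poly {poly R}} := (a%:P%:P)%Ring.

Lemma evD p q x y : ev (p + q)%Ring x y = ev p x y + ev q x y.
Proof. exact: ev2D. Qed.

Lemma evM p q x y : ev (p * q)%Ring x y = ev p x y * ev q x y.
Proof. exact: ev2M. Qed.

Lemma evB p q x y : ev (p - q)%Ring x y = ev p x y - ev q x y.
Proof. by rewrite /ev ev2D ev2N. Qed.

Lemma ev_cst a x y : ev (cst a) x y = a.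
Proof. by rewrite /ev /cst ev2C hornerC. Qed.

Lemma ev_Y x y : ev 'X%Ring x y = y.
Proof. exact: ev2X. Qed.

Lemma ev_X x y : ev ('X%:P)%Ring x y = x.
Proof. by rewrite /ev ev2C hornerX. Qed.

Lemma evX p n x y : ev (p ^+ n)%Ring x y = ev p x y ^ n.
Proof. by elim: n => [|n IH]; [exact: (ev_cst 1)|rewrite exprS evM IH]. Qed.

Lemma ev0 x y : ev 0%Ring x y = 0.
Proof. by rewrite /ev /ev2 !horner0. Qed.

Lemma ev_C (c : {poly R}) x y : ev (c%:P)%Ring x y = c.[x]%Ring.
Proof. exact: ev2C. Qed.

Lemma evN p x y : ev (- p)%Ring x y = - ev p x y.
Proof. exact: ev2N. Qed.

Definition evE := (evD, evN, evM, evX, ev_cst, ev_X, ev_Y).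

Lemma is_derive_horner (p : {poly R}) (X : R -> R) (t x' : R) :
  is_derive X t x' ->
  is_derive (fun s => (p.[X s])%Ring) t ((p^`()%Ring).[X t]%Ring * x').
Proof.
move=> dX; elim/poly_ind: p => [|p c IH].
  apply: (is_derive_ext (fun _ => 0)); first by move=> s; rewrite horner0.
  rewrite deriv0 horner0 Rmult_0_l; exact: is_derive_const.
apply: (is_derive_ext (fun s => (p.[X s])%Ring * X s + c)).
  by move=> s; rewrite hornerMXaddC.
have -> : ((p * 'X + c%:P)^`()).[X t]%Ring * x' =
   ((p^`()%Ring).[X t]%Ring * x') * X t + (p.[X t])%Ring * x' + 0.
  rewrite derivMXaddC hornerD hornerM hornerX -!RplusE -!RmultE.
  have aux (a b d e : R) : (a + b * d) * e = b * e * d + a * e + 0 by ring.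
  exact: aux.
apply: is_derive_plus; last exact: is_derive_const.
have h := is_derive_mult _ _ _ _ _ IH dX Rmult_comm.
exact: h.
Qed.

Lemma is_derive_ev p (X Y : R -> R) (t x' y' : R) :
  is_derive X t x' -> is_derive Y t y' ->
  is_derive (fun s => ev p (X s) (Y s)) t
    (ev (dX p) (X t) (Y t) * x' + ev (dY p) (X t) (Y t) * y').
Proof.
move=> hX hY; elim/poly_ind: p => [|p c IH].
  apply: (is_derive_ext (fun _ => 0)); first by move=> s; rewrite ev0.
  rewrite /dX /dY raddf0 deriv0 !ev0 !Rmult_0_l Rplus_0_l.
  exact: is_derive_const.
apply: (is_derive_ext (fun s => ev p (X s) (Y s) * Y s + c.[X s]%Ring)).
  by move=> s; rewrite evD evM ev_Y ev_C.
have -> : ev (dX (p * 'X + c%:P)%Ring) (X t) (Y t) * x' +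
          ev (dY (p * 'X + c%:P)%Ring) (X t) (Y t) * y' =
  ((ev (dX p) (X t) (Y t) * x' + ev (dY p) (X t) (Y t) * y') * Y t
   + ev p (X t) (Y t) * y') + (c^`()).[X t]%Ring * x'.
  rewrite dXD dXMX dXC /dY derivMXaddC !evD !evM !ev_Y ev_C.
  have aux (a b e h i j l : R) : (a * h + i) * j + (e + b * h) * l =
    ((a * j + b * l) * h + e * l) + i * j by ring.
  exact: aux.
apply: is_derive_plus; last exact: is_derive_horner.
have h := is_derive_mult _ _ _ _ _ IH hY Rmult_comm.
exact: h.
Qed.

(** * Complex evaluation and the coefficient format of the statement *)

Definition toRi (z : C) : R[i] := (fst z +i* snd z)%C.

Definition ofRi (z : R[i]) : C := (complex.Re z, complex.Im z).

Definition evC (p : {poly {poly R}}) (z w : C) : C :=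
  ofRi (ev2 (map_poly (map_poly (real_complex R)) p) (toRi z) (toRi w)).

Lemma ofRiD z w : ofRi (z + w)%Ring = Cplus (ofRi z) (ofRi w).
Proof. by case: z; case: w. Qed.

Lemma ofRiM z w : ofRi (z * w)%Ring = Cmult (ofRi z) (ofRi w).
Proof. by case: z; case: w. Qed.

Lemma ofRiN z : ofRi (- z)%Ring = Copp (ofRi z).
Proof. by case: z. Qed.

Lemma toRiK z : ofRi (toRi z) = z.
Proof. by case: z. Qed.

Lemma ofRiC (a : R) : ofRi (real_complex R a) = RtoC a.
Proof. by []. Qed.

Lemma ofRiX z n : ofRi (z ^+ n)%Ring = Cpow (ofRi z) n.
Proof. by elim: n => //= n IH; rewrite GRing.exprS ofRiM IH. Qed.

Lemma ofRi_sum n (f : nat -> R[i]) :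
  ofRi (\sum_(i < n.+1) f i)%Ring = sumC n (fun i => ofRi (f i)).
Proof.
elim: n => [|n IH]; first by rewrite big_ord_recl big_ord0 GRing.addr0.
by rewrite big_ord_recr /= ofRiD IH.
Qed.

Lemma evCD p q z w : evC (p + q)%Ring z w = Cplus (evC p z w) (evC q z w).
Proof. by rewrite /evC raddfD /= ev2D ofRiD. Qed.

Lemma evCM p q z w : evC (p * q)%Ring z w = Cmult (evC p z w) (evC q z w).
Proof. by rewrite /evC rmorphM /= ev2M ofRiM. Qed.

Lemma evCN p z w : evC (- p)%Ring z w = Copp (evC p z w).
Proof. by rewrite /evC raddfN /= ev2N ofRiN. Qed.

Lemma evCC c z w : evC (c%:P%:P)%Ring z w = RtoC c.
Proof. by rewrite /evC map_polyC /= ev2C map_polyC hornerC ofRiC. Qed.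

Lemma sumC_ext n f g : (forall i, f i = g i) -> sumC n f = sumC n g.
Proof. by move=> h; elim: n => [|n IH] /=; rewrite ?IH h. Qed.

Lemma sum_f_R0_big (f : nat -> R) n : sum_f_R0 f n = (\sum_(i < n.+1) f i)%Ring.
Proof.
elim: n => [|n IH]; first by rewrite big_ord_recl big_ord0 GRing.addr0.
by rewrite big_ord_recr /= IH.
Qed.

Lemma INR_mulrn k (c : R) : INR k * c = (c *+ k)%Ring.
Proof. by rewrite INRE -[RHS]mulr_natl. Qed.

Lemma poly_bound (p : {poly {poly R}}) :
  exists d, (size p <= d.+1)%N /\ forall l, (size (p`_l)%Ring <= d.+1)%N.
Proof.
exists (size p + \max_(i < size p) size (p`_i)%Ring)%N; split.
  by rewrite -addSn; apply: leq_trans (leqnSn _) _; rewrite leq_addr.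
move=> l; case: (ltnP l (size p)) => h; last by rewrite nth_default // size_poly0.
have := @leq_bigmax _ (fun i : 'I_(size p) => size (p`_i)%Ring) (Ordinal h) => /= h2.
by apply: leq_trans h2 _; rewrite -addSn leq_addl.
Qed.

Lemma ev_polyR (p : {poly {poly R}}) : exists d c,
  [/\ forall x y, polyR d c (x, y) = ev p x y,
      forall z w, polyCC d c z w = evC p z w,
      forall z w, polyCC_dx d c z w = evC (dX p) z w,
      forall z w, polyCC_dy d c z w = evC (dY p) z w &
      p <> 0%Ring -> exists k l, (k <= d)%coq_nat /\ (l <= d)%coq_nat /\ c k l <> 0].
Proof.
have [d [pd pd2]] := poly_bound p.
pose q := map_poly (map_poly (real_complex R)) p.
have qd : (size q <= d.+1)%N.
  by apply/leq_sizeP => j dj; rewrite coef_map /= nth_default ?raddf0 // (leq_trans pd dj).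
have qd2 l : (size (q`_l)%Ring <= d.+1)%N by rewrite coef_map /= size_map_poly.
have qc k l : ((q`_l)`_k)%Ring = real_complex R ((p`_l)`_k)%Ring.
  by rewrite coef_map /= coef_map.
have qdX : dX q = map_poly (map_poly (real_complex R)) (dX p).
  apply/polyP => i; rewrite /dX !coef_map /=; exact: deriv_map.
have qdY : dY q = map_poly (map_poly (real_complex R)) (dY p) by apply: deriv_map.
exists d, (fun k l => ((p`_l)`_k)%Ring); split.
- move=> x y; rewrite /ev (ev2_wide _ _ pd pd2) /polyR sum_f_R0_big.
  apply: eq_bigr => k _; rewrite sum_f_R0_big; apply: eq_bigr => l _.
  by rewrite !RpowE.
- move=> z w; rewrite /evC (ev2_wide _ _ qd qd2).
  rewrite (ofRi_sum _ (fun k => \sum_(l < d.+1) q`_l`_k * toRi z ^+ k * toRi w ^+ l)%Ring).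
  apply: sumC_ext => k.
  rewrite (ofRi_sum _ (fun l => q`_l`_k * toRi z ^+ k * toRi w ^+ l)%Ring).
  by apply: sumC_ext => l; rewrite !ofRiM !ofRiX !toRiK qc.
- move=> z w; rewrite /evC -qdX (ev2_dX_wide _ _ qd qd2).
  rewrite (ofRi_sum _ (fun k => \sum_(l < d.+1) q`_l`_k *+ k * toRi z ^+ k.-1 * toRi w ^+ l)%Ring).
  apply: sumC_ext => k.
  rewrite (ofRi_sum _ (fun l => q`_l`_k *+ k * toRi z ^+ k.-1 * toRi w ^+ l)%Ring).
  apply: sumC_ext => l; rewrite !ofRiM !ofRiX !toRiK qc -raddfMn ofRiC.
  by rewrite INR_mulrn.
- move=> z w; rewrite /evC -qdY (ev2_dY_wide _ _ qd qd2).
  rewrite (ofRi_sum _ (fun k => \sum_(l < d.+1) q`_l`_k *+ l * toRi z ^+ k * toRi w ^+ l.-1)%Ring).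
  apply: sumC_ext => k.
  rewrite (ofRi_sum _ (fun l => q`_l`_k *+ l * toRi z ^+ k * toRi w ^+ l.-1)%Ring).
  apply: sumC_ext => l; rewrite !ofRiM !ofRiX !toRiK qc -raddfMn ofRiC.
  by rewrite INR_mulrn.
- move=> p0.
  have p1 : p != 0%Ring by apply/eqP.
  have l1 : lead_coef p != 0%Ring by rewrite lead_coef_eq0.
  exists (size (lead_coef p)).-1, (size p).-1; split; [|split].
  + apply/leP; rewrite -ltnS prednK ?size_poly_gt0 //; exact: pd2.
  + by apply/leP; rewrite -ltnS prednK ?size_poly_gt0.
  + by apply/eqP; rewrite -[(p`_(size p).-1)%Ring]/(lead_coef p) -/(lead_coef _) lead_coef_eq0.
Qed.

(** * Gauss' lemma and polynomials vanishing on an arc *)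

Lemma ex_min_nat (P : nat -> Prop) :
  (exists n, P n) -> exists n, P n /\ forall m, P m -> (n <= m)%N.
Proof.
move=> [n Pn]; elim/ltn_ind: n Pn => n IH Pn.
case: (classic (exists m, (m < n)%N /\ P m)) => [[m [mn Pm]]|h]; first exact: IH Pm.
exists n; split=> // m Pm; rewrite leqNgt; apply/negP => mn; apply: h; by exists m.
Qed.

Section Gauss.
Local Open Scope ring_scope.

Definition primitive (K : fieldType) (f : {poly {poly K}}) : Prop :=
  forall d : {poly K}, (1 < size d)%N -> ~ (forall i, d %| f`_i).

Lemma irreducible_factor (K : fieldType) (c : {poly K}) :
  (1 < size c)%N -> exists d, irreducible_poly d /\ d %| c.
Proof.
move=> c1.
have [n [[d [dn d1 dc]] nmin]] := @ex_min_nat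
  (fun n => exists d : {poly K}, [/\ size d = n, (1 < size d)%N & d %| c])
  (ex_intro _ _ (ex_intro _ c (And3 erefl c1 (dvdpp c)))).
exists d; split=> //; split=> // q q1 qd.
have d0 : d != 0 by rewrite -size_poly_gt0 (ltn_trans _ d1).
have q0 : q != 0 by apply: contraTneq qd => ->; rewrite dvd0p.
rewrite -dvdp_size_eqp // eqn_leq dvdp_leq //= dn; apply: nmin.
exists q; split=> //; last exact: dvdp_trans dc.
by rewrite ltn_neqAle eq_sym q1 size_poly_gt0.
Qed.

(** Gauss' argument: at the least [i] and [j] with [d] dividing neither [q_i] nor [f_j], all other
    summands of the coefficient [i + j] of the product are divisible by [d], so [d] would divide
    [q_i * f_j]. *)
Lemma gauss_dvd_coef (K : fieldType) (d : {poly K}) (q f : {poly {poly K}}) :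
  irreducible_poly d -> (forall i, d %| (q * f)`_i) -> primitive f ->
  forall i, d %| q`_i.
Proof.
move=> [d1 dirr] dqf prim i0; apply: NNPP => hi0.
have [i [hi imin]] := @ex_min_nat (fun i => ~ (d %| q`_i)) (ex_intro _ i0 hi0).
have [j0 hj0] := not_all_ex_not _ _ (prim d d1).
have [j [hj jmin]] := @ex_min_nat (fun i => ~ (d %| f`_i)) (ex_intro _ j0 hj0).
have lti k : (k < i)%N -> d %| q`_k.
  by move=> ki; apply: NNPP => h; move: (imin _ h); rewrite leqNgt ki.
have ltj k : (k < j)%N -> d %| f`_k.
  by move=> ki; apply: NNPP => h; move: (jmin _ h); rewrite leqNgt ki.
have ij : (i < (i + j).+1)%N by rewrite ltnS leq_addr.
have := dqf (i + j)%N; rewrite coefM (bigD1 (Ordinal ij)) //= addKn dvdp_addl; last first.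
  apply: (big_ind (fun x => d %| x)) => [|x y|k kn]; [exact: dvdp0|exact: dvdp_add|].
  have kn' : (k : nat) != i by apply: contraNneq kn => ki; apply/eqP/val_inj.
  case: (ltngtP k i) kn' => // ki _.
    by apply: dvdp_mulr; apply: lti.
  apply: dvdp_mull; apply: ltj; rewrite ltn_subLR ?ltn_add2r //.
  by have := ltn_ord k; rewrite ltnS.
have cop : coprimep d q`_i.
  apply/negPn/negP => /negP ncop; apply: hi.
  have : gcdp d q`_i %= d by apply: dirr; [apply/negP|exact: dvdp_gcdl].
  by move=> /eqp_dvdl <-; exact: dvdp_gcdr.
by rewrite Gauss_dvdpr.
Qed.

(** Irreducible factors of [c] are removed one at a time: each divides the coefficients of [q * f],
    hence those of [q], and cancels on both sides. What remains of [c] is an invertible constant. *)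
Lemma gauss_cancel (K : fieldType) (c : {poly K}) (P q f : {poly {poly K}}) :
  c != 0 -> primitive f -> c%:P * P = q * f -> exists q', P = q' * f.
Proof.
move=> c0 prim; have [n] := ubnP (size c); elim: n c c0 q => // n IH c c0 q cn e.
have [c1|c1] := leqP (size c) 1.
  have ca := size1_polyC c1; set a := c`_0 in ca.
  have a0 : a != 0 by apply: contraNneq c0 => a0; rewrite ca a0.
  exists ((a^-1)%:P%:P * q); rewrite -mulrA -e ca mulrA -!polyCM mulVf ?mul1r //.
have [d [dirr dc]] := irreducible_factor c1.
have d0 : d != 0 by rewrite -size_poly_gt0 (ltn_trans _ dirr.1).
have dq : forall i, d %| q`_i.
  by apply: (gauss_dvd_coef dirr) prim => i; rewrite -e coefCM dvdp_mulr.
pose q1 := \poly_(i < size q) (q`_i %/ d).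
have qq1 : q = d%:P * q1.
  apply/polyP => i; rewrite coefCM coef_poly; case: ltnP => h; first by rewrite mulrC divpK.
  by rewrite nth_default // mulr0.
have ce : c = d * (c %/ d) by rewrite mulrC divpK.
have c1n : c %/ d != 0 by apply: contraNneq c0 => h; rewrite ce h mulr0.
apply: (IH (c %/ d) c1n q1).
  rewrite ltnS in cn; apply: leq_trans cn; rewrite [in X in (_ < X)%N]ce size_mul //.
  by case: (size d) dirr.1 => [|[|m]] // _; rewrite !addSn /= ltnS leq_addl.
have dd0 : d%:P != 0 :> {poly {poly K}} by rewrite polyC_eq0.
by apply: (mulfI dd0); rewrite mulrA -polyCM -ce e qq1 mulrA.
Qed.

Lemma pseudo_div (K : fieldType) (P f : {poly {poly K}}) : f != 0 ->
  exists c q r, [/\ c != 0, c%:P * P = q * f + r & (size r < size f)%N].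
Proof.
move=> f0; exists (lead_coef f ^+ scalp P f), (P %/ f), (P %% f); split.
- by rewrite expf_neq0 // lead_coef_eq0.
- by rewrite mul_polyC Pdiv.Idomain.divp_eq.
- by rewrite Pdiv.Idomain.ltn_modp.
Qed.

End Gauss.

Lemma ball_R (x y e : R) : ball x e y -> Rabs (y - x) < e.
Proof. by []. Qed.

Lemma nonzero_near (h : R -> R) (s : R) :
  continuous h s -> h s <> 0 -> exists e, 0 < e /\ forall t, Rabs (t - s) < e -> h t <> 0.
Proof.
move=> ch hs.
have pos : 0 < Rabs (h s) by apply: Rabs_pos_lt.
have [d hd] := proj1 (filterlim_locally _ _) ch (mkposreal _ pos).
exists d; split; first exact: cond_pos.
move=> t ht h0; have /ball_R /= := hd t ht; rewrite h0.
by rewrite /Rminus Rplus_0_l Rabs_Ropp; lra.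
Qed.

Lemma nonzero_subinterval (h : R -> R) (s a b : R) :
  continuous h s -> h s <> 0 -> a < s < b ->
  exists a' b', [/\ a <= a', a' < b', b' <= b & forall t, a' < t < b' -> h t <> 0].
Proof.
move=> ch hs sab; have [e [e0 he]] := nonzero_near ch hs.
exists (Rmax a (s - e)), (Rmin b (s + e)); split.
- exact: Rmax_l.
- by apply: Rmax_lub_lt; apply: Rmin_glb_lt; lra.
- exact: Rmin_l.
- move=> t [h1 h2]; apply: he; apply: Rabs_def1.
    by have := Rmin_r b (s + e); lra.
  by have := Rmax_r a (s - e); lra.
Qed.

Lemma zero_derive_on (h : R -> R) (a b s l : R) :
  (forall t, a < t < b -> h t = 0) -> a < s < b -> is_derive h s l -> l = 0.
Proof.
move=> h0 sab hl.
have e0 : 0 < Rmin (s - a) (b - s) by apply: Rmin_glb_lt; lra.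
have hz : is_derive h s 0.
  apply: (is_derive_ext_loc (fun _ => 0)); last exact: is_derive_const.
  exists (mkposreal _ e0) => t /ball_R /= ht.
  have [h1 h2] := Rabs_def2 _ _ ht.
  have := Rmin_l (s - a) (b - s); have := Rmin_r (s - a) (b - s) => h3 h4.
  by rewrite h0 //; lra.
by rewrite -(is_derive_unique _ _ _ hl) (is_derive_unique _ _ _ hz).
Qed.

Section Arc.
Variables (X Y X1 Y1 : R -> R) (a0 b0 : R).
Hypothesis ab0 : a0 < b0.
Hypothesis hX : forall s, a0 < s < b0 -> is_derive X s (X1 s).
Hypothesis hY : forall s, a0 < s < b0 -> is_derive Y s (Y1 s).
Hypothesis hX1 : forall s, a0 < s < b0 -> X1 s <> 0.

Definition van (p : {poly {poly R}}) (a b : R) : Prop :=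
  [/\ a0 <= a, a < b, b <= b0 & forall s, a < s < b -> ev p (X s) (Y s) = 0].

Lemma van_sub p a b a' b' : van p a b -> a <= a' -> a' < b' -> b' <= b -> van p a' b'.
Proof. by move=> [h1 h2 h3 h4] h5 h6 h7; split; try lra; move=> s hs; apply: h4; lra. Qed.

(** Since [X1] has no zero, differentiating along the arc passes from [c] to its derivative;
    induction on the size replaces a count of roots. *)
Lemma van_x (c : {poly R}) a b :
  a0 <= a -> a < b -> b <= b0 -> (forall s, a < s < b -> c.[X s]%Ring = 0) -> c = 0%Ring.
Proof.
move=> a0a ab bb0; have [n] := ubnP (size c); elim: n c => // n IH c cn hc.
have [c1|c1] := leqP (size c) 1.
  have := hc ((a + b) / 2); rewrite (size1_polyC c1) hornerC => ->; [by rewrite polyC0|lra].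
have c' : (c^`() = 0)%Ring.
  apply: IH; first by rewrite polyorder.size_deriv; case: (size c) c1 cn.
  move=> s hs; have hs0 : a0 < s < b0 by lra.
  have := zero_derive_on hc hs (is_derive_horner c (hX hs0)) => /Rmult_integral [//|h].
  by case: (hX1 hs0).
by have := polyorder.size_deriv c; rewrite c' size_poly0; case: (size c) c1 => [|[|m]].
Qed.

Lemma ev_continuous p s : a0 < s < b0 -> continuous (fun s => ev p (X s) (Y s)) s.
Proof.
by move=> hs; apply: ex_derive_continuous; eexists; apply: is_derive_ev (hX hs) (hY hs).
Qed.

(** A smooth arc can leave the zero set of one factor and enter that of the other, so [p] is only
    known to vanish on a smaller subarc, where [q] is nonzero by continuity. *)
Lemma van_mul p q a b : van (p * q)%Ring a b -> q <> 0%Ring ->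
  ~ van q a b -> exists a' b', [/\ a <= a', b' <= b & van p a' b'].
Proof.
move=> [h1 h2 h3 h4] q0 nv.
have [s [hs qs]] : exists s, a < s < b /\ ev q (X s) (Y s) <> 0.
  apply: NNPP => h; apply: nv; split=> // s hs; apply: NNPP => h'; apply: h; by exists s.
have hs0 : a0 < s < b0 by lra.
have [a' [b' [h5 h6 h7 h8]]] := nonzero_subinterval (ev_continuous (p := q) hs0) qs hs.
exists a', b'; split=> //; split; try lra.
move=> t ht; have ht' : a < t < b by lra.
by have := h4 t ht'; rewrite evM => /Rmult_integral [//|h]; case: (h8 t ht).
Qed.

(** The subarc is part of the existential, so that minimality in this class survives the shrinking
    of arcs. *)
Definition vanishing (p : {poly {poly R}}) : Prop :=
  p <> 0%Ring /\ exists a b, van p a b.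

(* Minimal degree in [y], then minimal degree of the leading coefficient: the first choice makes
   pseudo-remainders vanish, the second makes [f] primitive, so that Gauss' lemma applies. *)
Lemma minimal_vanishing P : P <> 0%Ring -> van P a0 b0 ->
  exists f a b, [/\ van f a b, (1 < size f)%N,
    (forall q, vanishing q -> (size f <= size q)%N) &
    forall P' a' b', van P' a' b' -> a <= a' -> b' <= b -> exists q, P' = (q * f)%Ring].
Proof.
move=> P0 vP.
have [n [[f0 [vf0 fn]] nmin]] := @ex_min_nat (fun n => exists f, vanishing f /\ size f = n)
  (ex_intro _ (size P) (ex_intro _ P (conj (conj P0 (ex_intro _ a0 (ex_intro _ b0 vP))) erefl))).
have [m [[f [vf fsz fm]] mmin]] := @ex_min_nat
  (fun m => exists f, [/\ vanishing f, size f = n & size (lead_coef f) = m])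
  (ex_intro _ _ (ex_intro _ f0 (And3 vf0 fn erefl))).
have {}nmin q : vanishing q -> (size f <= size q)%N.
  by move=> vq; rewrite fsz; apply: nmin; exists q.
case: vf => fnz [a [b vf]].
have [a0a ab bb0 fz] := vf.
have fnz' : f != 0%Ring by apply/eqP.
have f1 : (1 < size f)%N.
  rewrite ltnNge; apply/negP => /size1_polyC fC.
  apply: fnz; rewrite fC (@van_x (f`_0)%Ring a b) ?polyC0 // => s hs.
  by have := fz s hs; rewrite fC ev_C coefC eqxx.
(* A non-constant common factor [d] of the coefficients depends on the first coordinate only and
   cannot vanish on the arc. The quotient would then vanish on a subarc, with the same degree in [y]
   and a shorter leading coefficient. *)
have prim : primitive f.
  move=> d d1 df.
  pose g := (\poly_(i < size f) (f`_i %/ d))%Ring.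
  have fg : f = (g * d%:P)%Ring.
    apply/polyP => i; rewrite coefMC coef_poly; case: ltnP => h; first by rewrite divpK.
    by rewrite nth_default // mul0r.
  have d0 : d != 0%Ring by rewrite -size_poly_gt0 (ltn_trans _ d1).
  have g0 : g <> 0%Ring by move=> g0; apply: fnz; rewrite fg g0 mul0r.
  have g0' : g != 0%Ring by apply/eqP.
  have dP0 : (d%:P)%Ring <> 0%Ring :> {poly {poly R}} by apply/eqP; rewrite polyC_eq0.
  have nvd : ~ van (d%:P)%Ring a b.
    move=> [_ _ _ h]; move/eqP: d0; apply; apply: (@van_x d a b) => // s hs.
    by have := h s hs; rewrite ev_C.
  have vgd : van (g * d%:P)%Ring a b by rewrite -fg.
  have [a' [b' [h1 h2 vg]]] := van_mul vgd dP0 nvd.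
  have sg : size g = size f.
    by rewrite fg size_mul ?polyC_eq0 // size_polyC d0 addn1.
  have := mmin (size (lead_coef g)); rewrite -fm.
  have lg : lead_coef f = (lead_coef g * d)%Ring by rewrite fg lead_coefM lead_coefC.
  rewrite lg size_mul // ?lead_coef_eq0 // => /(_ (ex_intro _ g _)).
  have key : [/\ vanishing g, size g = n & size (lead_coef g) = size (lead_coef g)].
    split=> //; last by rewrite sg.
    by split=> //; exists a', b'.
  move=> /(_ key).
  have : (0 < size (lead_coef g))%N by rewrite size_poly_gt0 lead_coef_eq0.
  by case: (size (lead_coef g)) => // k _; case: (size d) d1 => [|[|j]] // _; rewrite addSn /= !addnS ltnS ltnNge leq_addr.
exists f, a, b; split=> // P' a' b' vP' aa bb.
have [c [q [r [c0 e sr]]]] := pseudo_div P' fnz'.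
have [h1 h2 h3 h4] := vP'.
(* The remainder vanishes wherever [P'] and [f] both do and is shorter than [f], so minimality
   applies. *)
have r0 : r = 0%Ring.
  apply: NNPP => r0; move: (sr); rewrite ltnNge nmin //; split=> //; exists a', b'; split=> // s hs.
  have -> : r = (c%:P * P' - q * f)%Ring by rewrite e addrAC subrr add0r.
  rewrite evB !evM h4 // fz; [ring|lra].
by apply: gauss_cancel c0 prim _; rewrite e r0 addr0.
Qed.

End Arc.

(** * The certificate of non-singularity *)

Lemma dXdY (K : comNzRingType) (p : {poly {poly K}}) : dX (dY p) = dY (dX p).
Proof.
by apply/polyP => i; rewrite /dX /dY !(coef_map, coef_deriv) /= raddfMn.
Qed.

Lemma power_factor (f P : {poly {poly R}}) : (1 < size f)%N -> P <> 0%Ring ->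
  exists k g, [/\ P = (f ^+ k * g)%Ring, g <> 0%Ring & ~ exists q, g = (q * f)%Ring].
Proof.
move=> f1; have [n] := ubnP (size P); elim: n P => // n IH P Pn P0.
case: (classic (exists q, P = (q * f)%Ring)) => [[q Pq]|h]; last first.
  by exists 0%N, P; rewrite expr0 mul1r.
have q0 : q <> 0%Ring by move=> q0; apply: P0; rewrite Pq q0 mul0r.
have q0' : q != 0%Ring by apply/eqP.
have f0 : f != 0%Ring by rewrite -size_poly_gt0 (ltn_trans _ f1).
have qn : (size q < n)%N.
  rewrite ltnS in Pn; apply: leq_trans Pn; rewrite Pq size_mul //.
  case: (size f) f1 => [|[|j]] // _; by rewrite !addnS /= ltnS leq_addr.
have [k [g [e g0 ng]]] := IH q qn q0.
by exists k.+1, g; split=> //; rewrite Pq e exprSr -!mulrA (mulrC g).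
Qed.

Section Certificate.
Variables (f g : {poly {poly R}}) (beta c : R).

Definition gradsq : {poly {poly R}} := (dX f * dX f + dY f * dY f)%Ring.

(** On a level curve of [f], [hess] divided by the cube of the normal derivative is the curvature up
    to sign. *)
Definition hess : {poly {poly R}} :=
  (dX (dX f) * (dY f * dY f) - cst 2 * (dX (dY f) * (dX f * dY f))
   + dY (dY f) * (dX f * dX f))%Ring.

(* [(beta u^3 - hess)^k = A + u B] when [u^2 = gradsq]. *)
Fixpoint cubic_pow (k : nat) : {poly {poly R}} * {poly {poly R}} :=
  match k with
  | O => (cst 1, cst 0)
  | S k' => let AB := cubic_pow k' in
     ((cst beta * (gradsq * (gradsq * AB.2)) - hess * AB.1)%Ring,
      (cst beta * (gradsq * AB.1) - hess * AB.2)%Ring)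
  end.

(** With [u^2 = gradsq] the relation [g^3 (A + u B) = c] reads [D + u E = 0]; multiplication by the
    conjugate [D - u E] removes [u]. *)
Definition certificate (k : nat) : {poly {poly R}} :=
  let D := (g * (g * g) * (cubic_pow k).1 - cst c)%Ring in
  let E := (g * (g * g) * (cubic_pow k).2)%Ring in
  (D * D - gradsq * (E * E))%Ring.

Lemma ev_cubic_pow k x y u : u ^ 2 = ev gradsq x y ->
  ev (cubic_pow k).1 x y + u * ev (cubic_pow k).2 x y = (beta * u ^ 3 - ev hess x y) ^ k.
Proof.
move=> uW; elim: k => [|k IH]; first by rewrite /= !evE; ring.
have -> : (beta * u ^ 3 - ev hess x y) ^ k.+1
   = (beta * u ^ 3 - ev hess x y) * (beta * u ^ 3 - ev hess x y) ^ k by [].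
rewrite -IH /=; move: (cubic_pow k).1 (cubic_pow k).2 => A B.
move: uW; move: (gradsq) (hess) => W Hs uW; rewrite !evE -uW; ring.
Qed.

Lemma ev_certificate k x y u : u ^ 2 = ev gradsq x y ->
  ev g x y ^ 3 * (beta * u ^ 3 - ev hess x y) ^ k = c -> ev (certificate k) x y = 0.
Proof.
move=> uW; rewrite -(ev_cubic_pow k uW) /certificate; move: (cubic_pow k).1 (cubic_pow k).2 => A B.
move: uW; move: (gradsq) => W uW e; rewrite !evE -uW -e; ring.
Qed.

(** At a common zero of [f] and its partial derivatives [gradsq] and [hess] vanish, hence so does
    the first component of [cubic_pow], while the second one is multiplied by [gradsq]. Only [c^2]
    survives. At exponent 0 the first component would be 1, whence [k.+1]. *)
Lemma nonsingular_of_certificate k z w q : c <> 0 -> certificate k.+1 = (q * f)%Ring ->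
  ~ [/\ evC f z w = RtoC 0, evC (dX f) z w = RtoC 0 & evC (dY f) z w = RtoC 0].
Proof.
move=> c0 e [fz fx fy].
have W0 : evC gradsq z w = RtoC 0 by rewrite /gradsq evCD !evCM fx fy; ring.
have H0 : evC hess z w = RtoC 0.
  by rewrite /hess !(evCD, evCN, evCM) fx fy; ring.
have A0 : evC (cubic_pow k.+1).1 z w = RtoC 0.
  rewrite /=; move: (cubic_pow k).1 (cubic_pow k).2 W0 H0 => A B.
  by move: (gradsq) (hess) => W Hs W0 H0; rewrite !(evCD, evCN, evCM) W0 H0; ring.
have : evC (certificate k.+1) z w = RtoC 0 by rewrite e evCM fz; ring.
rewrite /certificate; move: (cubic_pow k.+1).1 (cubic_pow k.+1).2 A0 => A B A0.
move: W0; move: (gradsq) => W W0; rewrite !(evCD, evCN, evCM) W0 A0 /cst evCC => h.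
have : RtoC (c * c) = RtoC 0.
  by rewrite RtoC_mult -h; ring.
by move=> /RtoC_inj /Rmult_integral; case.
Qed.

End Certificate.

(** * The transport equation along a parallel curve *)

(** The mean value theorem plays the part of integration. It keeps [eps] where an integral would
    divide by [n + 1], which is enough for a little-o estimate. *)
Lemma o_integrate (e e1 : R -> R) (n : nat) (eps d : R) : 0 < d -> 0 <= eps ->
  e 0 = 0 -> (forall t, is_derive e t (e1 t)) ->
  (forall t, Rabs t < d -> Rabs (e1 t) <= eps * Rabs t ^ n) ->
  forall t, Rabs t < d -> Rabs (e t) <= eps * Rabs t ^ n.+1.
Proof.
move=> d0 eps0 e0 he h1 t td.
have [x [hx ex]] := MVT_gen e 0 t e1 (fun x _ => he x)
  (fun x _ => proj2 (continuity_pt_filterlim _ _) (ex_derive_continuous _ _ (ex_intro _ _ (he x)))).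
have xt : Rabs x <= Rabs t.
  have [h2|h2] := Rle_dec 0 t.
    rewrite Rmin_left // Rmax_right // in hx; rewrite !Rabs_pos_eq; lra.
  rewrite Rmin_right ?Rmax_left in hx; try lra.
  by rewrite !Rabs_left1; lra.
have -> : e t = e1 x * t by move: ex; rewrite e0 !Rminus_0_r.
rewrite Rabs_mult /= [Rabs t * _]Rmult_comm -Rmult_assoc.
apply: Rmult_le_compat_r; first exact: Rabs_pos.
apply: Rle_trans (h1 x _) _; first lra.
apply: Rmult_le_compat_l => //; apply: pow_incr; split=> //; exact: Rabs_pos.
Qed.

(** [A2] is differentiable at 0, so the expansion [A t = a t^2 + b t^3 + o(t^3)] follows by
    integrating its little-o remainder twice. *)
Lemma derive_quotient_sq (A A1 A2 : R -> R) (a b : R) :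
  A 0 = 0 -> A1 0 = 0 -> A2 0 = 2 * a ->
  (forall t, is_derive A t (A1 t)) -> (forall t, is_derive A1 t (A2 t)) ->
  is_derive A2 0 (6 * b) ->
  is_derive (fun t => if Req_EM_T t 0 then a else A t / t ^ 2) 0 b.
Proof.
move=> A0 A10 A20 hA hA1 hA2.
apply/is_derive_Reals => eps eps0.
(* Half of [eps], because the integrated estimates are weak and the final one is strict. *)
have [d hd] := (proj1 (is_derive_Reals A2 0 (6 * b)) hA2) (eps / 2) ltac:(lra).
have d0 := cond_pos d.
pose E2 t := A2 t - 2 * a - 6 * b * t.
pose E1 t := A1 t - 2 * a * t - 3 * b * t ^ 2.
pose E0 t := A t - a * t ^ 2 - b * t ^ 3.
have h2 : forall t, Rabs t < d -> Rabs (E2 t) <= eps / 2 * Rabs t ^ 1.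
  move=> t td; have [->|t0] := Req_dec t 0.
    rewrite /E2 A20 Rabs_R0; have -> : 2 * a - 2 * a - 6 * b * 0 = 0 by ring.
    by rewrite Rabs_R0 /=; lra.
  have := hd t t0 td; rewrite Rplus_0_l A20 => h.
  have -> : E2 t = ((A2 t - 2 * a) / t - 6 * b) * t by rewrite /E2; field.
  by rewrite Rabs_mult /= Rmult_1_r; apply: Rmult_le_compat_r; [exact: Rabs_pos|lra].
have h1 : forall t, Rabs t < d -> Rabs (E1 t) <= eps / 2 * Rabs t ^ 2.
  apply: (o_integrate (e1 := E2)) => //; try lra; first by rewrite /E1 A10; ring.
  move=> t; rewrite /E1 /E2.
  have h := hA1 t; auto_derive; first by exists (A2 t).
  by rewrite (is_derive_unique _ _ _ h); ring.
have h0 : forall t, Rabs t < d -> Rabs (E0 t) <= eps / 2 * Rabs t ^ 3.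
  apply: (o_integrate (e1 := E1)) => //; try lra; first by rewrite /E0 A0; ring.
  move=> t; rewrite /E0 /E1.
  have h := hA t; auto_derive; first by exists (A1 t).
  by rewrite (is_derive_unique _ _ _ h); ring.
exists d => t t0 td; rewrite Rplus_0_l.
case: (Req_EM_T t 0) => [//|t1]; case: (Req_EM_T 0 0) => [t2|//] /=.
have -> : (A t / t ^ 2 - a) / t - b = E0 t / t ^ 3 by rewrite /E0; field.
rewrite Rabs_div; last exact: pow_nonzero.
have tp : 0 < Rabs t ^ 3 by apply: pow_lt; apply: Rabs_pos_lt.
rewrite -RPow_abs; apply: Rle_lt_trans (_ : eps / 2 < eps); last lra.
apply/Rle_div_l => //; exact: h0.
Qed.

Lemma even_derive0 (M : R -> R) (l : R) :
  (forall t, M (- t) = M t) -> is_derive M 0 l -> l = 0.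
Proof.
move=> ev hM.
have h : is_derive (fun t => M (- t)) 0 (- l).
  have hM' : is_derive M (- 0) l by rewrite Ropp_0.
  have := is_derive_comp M Ropp 0 l (- 1) hM'.
  rewrite /scal /= /mult /= => h; have -> : - l = - 1 * l by ring.
  by apply: h; auto_derive; [|ring].
have h' := is_derive_ext _ _ _ _ ev h.
have := is_derive_unique _ _ _ hM; rewrite (is_derive_unique _ _ _ h'); lra.
Qed.

(** [A] vanishes to second order, so dividing the even function [A^k G] by [t^(2k)] leaves an even
    function that is differentiable at 0 and has derivative zero there. The common power of [a] then
    cancels. *)
Lemma even_coefficient (A A1 A2 G : R -> R) (k : nat) (a b g1 : R) :
  A 0 = 0 -> A1 0 = 0 -> A2 0 = 2 * a ->
  (forall t, is_derive A t (A1 t)) -> (forall t, is_derive A1 t (A2 t)) ->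
  is_derive A2 0 (6 * b) -> is_derive G 0 g1 ->
  (forall t, A (- t) ^ k * G (- t) = A t ^ k * G t) -> a <> 0 ->
  INR k * b * G 0 + a * g1 = 0.
Proof.
move=> A0 A10 A20 hA hA1 hA2 hG ev a0.
pose B := fun t => if Req_EM_T t 0 then a else A t / t ^ 2.
have hB : is_derive B 0 b by exact: (derive_quotient_sq A0 A10 A20 hA hA1 hA2).
have B0 : B 0 = a by rewrite /B; case: (Req_EM_T 0 0) => [?|] //=.
have hM : is_derive (fun t => B t ^ k * G t) 0 (INR k * b * a ^ k.-1 * G 0 + a ^ k * g1).
  have := is_derive_mult _ _ _ _ _ (is_derive_pow _ k _ _ hB) hG Rmult_comm.
  by rewrite B0.
have := even_derive0 _ hM => h.
have {}h : INR k * b * a ^ k.-1 * G 0 + a ^ k * g1 = 0.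
  apply: h => t; have [->|t0] := Req_dec t 0; first by rewrite Ropp_0.
  rewrite /B; case: (Req_EM_T t 0) => [//|t2] /=.
  case: (Req_EM_T (- t) 0) => [t1|t1] /=; first by exfalso; lra.
  have e1 : A (- t) / (- t) ^ 2 = A (- t) * / t ^ 2 by field.
  rewrite e1 /Rdiv !Rpow_mult_distr.
  have := ev t; set P := / t ^ 2; move=> e.
  have -> : A (- t) ^ k * P ^ k * G (- t) = (A (- t) ^ k * G (- t)) * P ^ k by ring.
  by rewrite e; ring.
case: k ev hM h => [|k] _ _ h.
  by move: h; rewrite /= !Rmult_0_l !Rplus_0_l Rmult_1_l => ->; ring.
have ak : a ^ k <> 0 by apply: pow_nonzero.
apply: (Rmult_eq_reg_l (a ^ k)) => //.
have aux (n p x : R) : n * b * p * x + a * p * g1 = p * (n * b * x + a * g1) by ring.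
by rewrite Rmult_0_r -aux; exact: h.
Qed.

Ltac exd := repeat apply conj; first [exact I | assumption | eexists; eassumption].

Section Frame.
Variables (gx gy t1 t2 K K1 : R -> R) (rho : R).
Hypothesis hgx : forall s, is_derive gx s (t1 s).
Hypothesis hgy : forall s, is_derive gy s (t2 s).
Hypothesis ht1 : forall s, is_derive t1 s (- K s * t2 s).
Hypothesis ht2 : forall s, is_derive t2 s (K s * t1 s).
Hypothesis hK : forall s, is_derive K s (K1 s).
Hypothesis unit_t : forall s, t1 s ^ 2 + t2 s ^ 2 = 1.
Hypothesis rho0 : rho <> 0.

Definition psi (s : R) : R := 1 - rho * K s.
Hypothesis psi0 : forall s, psi s <> 0.

Definition parx (s : R) : R := gx s - rho * t2 s.
Definition pary (s : R) : R := gy s + rho * t1 s.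
(** [rho] is a signed radius and [phi] is measured from the direction of [rho] times the normal:
    [phi = 0] is the point of the parallel curve, and reflection in the normal line changes the sign
    of [phi]. *)
Definition circx (s phi : R) : R := gx s + rho * (- t2 s * cos phi + t1 s * sin phi).
Definition circy (s phi : R) : R := gy s + rho * (t1 s * cos phi + t2 s * sin phi).

Lemma is_derive_parx s : is_derive parx s (psi s * t1 s).
Proof.
rewrite /parx; have h1 := hgx s; have h2 := ht2 s.
auto_derive; first by split; [exists (t1 s)|split=> //; exists (K s * t1 s)].
by rewrite (is_derive_unique _ _ _ h1) (is_derive_unique _ _ _ h2) /psi; ring.
Qed.

Lemma is_derive_pary s : is_derive pary s (psi s * t2 s).
Proof.
rewrite /pary; have h1 := hgy s; have h2 := ht1 s.
auto_derive; first by split; [exists (t2 s)|split=> //; exists (- K s * t2 s)].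
by rewrite (is_derive_unique _ _ _ h1) (is_derive_unique _ _ _ h2) /psi; ring.
Qed.

Definition along (p : {poly {poly R}}) (s : R) : R := ev p (parx s) (pary s).

Lemma is_derive_along p s : is_derive (along p) s
  (psi s * (along (dX p) s * t1 s + along (dY p) s * t2 s)).
Proof.
have h := is_derive_ev p (is_derive_parx s) (is_derive_pary s).
have -> : psi s * (along (dX p) s * t1 s + along (dY p) s * t2 s) =
  ev (dX p) (parx s) (pary s) * (psi s * t1 s) + ev (dY p) (parx s) (pary s) * (psi s * t2 s).
  by rewrite /along; ring.
exact: h.
Qed.

Definition circ (p : {poly {poly R}}) (s phi : R) : R := ev p (circx s phi) (circy s phi).

Definition circ1 (p : {poly {poly R}}) (s phi : R) : R :=
  circ (dX p) s phi * (rho * (t2 s * sin phi + t1 s * cos phi))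
  + circ (dY p) s phi * (rho * (- t1 s * sin phi + t2 s * cos phi)).

Lemma is_derive_circ p s phi : is_derive (circ p s) phi (circ1 p s phi).
Proof.
apply: is_derive_ev; rewrite /circx /circy; auto_derive => //; ring.
Qed.

Definition circ2 (p : {poly {poly R}}) (s phi : R) : R :=
  circ1 (dX p) s phi * (rho * (t2 s * sin phi + t1 s * cos phi))
  + circ1 (dY p) s phi * (rho * (- t1 s * sin phi + t2 s * cos phi))
  + circ (dX p) s phi * (rho * (t2 s * cos phi - t1 s * sin phi))
  + circ (dY p) s phi * (rho * (- t1 s * cos phi - t2 s * sin phi)).

Lemma is_derive_circ1 p s phi : is_derive (circ1 p s) phi (circ2 p s phi).
Proof.
rewrite /circ1; have h1 := is_derive_circ (dX p) s phi; have h2 := is_derive_circ (dY p) s phi.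
auto_derive.
  by exd.
by rewrite (is_derive_unique _ _ _ h1) (is_derive_unique _ _ _ h2) /circ2; ring.
Qed.

Lemma is_derive_circ2_0 p s : is_derive (circ2 p s) 0
  (circ2 (dX p) s 0 * (rho * t1 s) + circ2 (dY p) s 0 * (rho * t2 s)
   + 2 * (circ1 (dX p) s 0 * (rho * t2 s)) - 2 * (circ1 (dY p) s 0 * (rho * t1 s))
   - rho * (circ (dX p) s 0 * t1 s + circ (dY p) s 0 * t2 s)).
Proof.
rewrite {1}/circ2; have h1 := is_derive_circ (dX p) s 0; have h2 := is_derive_circ (dY p) s 0.
have h3 := is_derive_circ1 (dX p) s 0; have h4 := is_derive_circ1 (dY p) s 0.
auto_derive.
  by exd.
rewrite (is_derive_unique _ _ _ h1) (is_derive_unique _ _ _ h2) (is_derive_unique _ _ _ h3)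
  (is_derive_unique _ _ _ h4) sin_0 cos_0; ring.
Qed.

Lemma circ_0 p s : circ p s 0 = along p s.
Proof.
by rewrite /circ /circx /circy cos_0 sin_0 /along /parx /pary; congr ev; ring.
Qed.

Lemma circ1_0 p s : circ1 p s 0 = rho * (along (dX p) s * t1 s + along (dY p) s * t2 s).
Proof. by rewrite /circ1 !circ_0 cos_0 sin_0; ring. Qed.

Definition even_on_circles (F : {poly {poly R}}) : Prop :=
  forall s phi, circ F s (- phi) = circ F s phi.

(** The circle around [gamma s] touches the parallel curve at [phi = 0], so the derivative of [F]
    along the curve is a multiple of its [phi]-derivative there, which evenness kills. *)
Lemma along_const F : even_on_circles F -> forall s, along F s = along F 0.
Proof.
move=> ev0 s; have d0 t : is_derive (along F) t 0.
  have h := is_derive_circ F t 0; have h0 := even_derive0 (ev0 t) h.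
  have -> : 0 = psi t * (along (dX F) t * t1 t + along (dY F) t * t2 t).
    by move: h0; rewrite circ1_0 => /Rmult_integral [//|->]; ring.
  exact: is_derive_along.
have [h|[->|h]] := Rtotal_order s 0 => //.
  by apply: eq_is_derive h => t _; exact: d0.
by symmetry; apply: eq_is_derive h => t _; exact: d0.
Qed.

Section Factor.
Variables (f g F : {poly {poly R}}) (k : nat) (c0 a b : R).
Hypothesis Fe : even_on_circles F.
Hypothesis FE : forall x y, ev F x y = c0 + ev f x y ^ k * ev g x y.
Hypothesis f0 : forall s, a < s < b -> along f s = 0.

Definition nder (s : R) : R := - along (dX f) s * t2 s + along (dY f) s * t1 s.

Lemma tangential0 s : a < s < b -> along (dX f) s * t1 s + along (dY f) s * t2 s = 0.
Proof.
move=> hs; have := zero_derive_on f0 hs (is_derive_along f s).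
by move=> /Rmult_integral [h|//]; case: (psi0 h).
Qed.

(** Derivatives of [f] in the moving frame: [T2] and [T3] are the second and third ones along the
    tangent, [N1] is the mixed tangential and normal one. *)
Let T2 s := along (dX (dX f)) s * t1 s ^ 2 + 2 * along (dX (dY f)) s * t1 s * t2 s
  + along (dY (dY f)) s * t2 s ^ 2.
Let N1 s := - along (dX (dX f)) s * t1 s * t2 s
  + along (dX (dY f)) s * (t1 s ^ 2 - t2 s ^ 2) + along (dY (dY f)) s * t1 s * t2 s.
Let T3 s := along (dX (dX (dX f))) s * t1 s ^ 3 + 3 * along (dX (dX (dY f))) s * t1 s ^ 2 * t2 s
  + 3 * along (dX (dY (dY f))) s * t1 s * t2 s ^ 2 + along (dY (dY (dY f))) s * t2 s ^ 3.

Lemma is_derive_nder s : is_derive nder s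
  (psi s * N1 s - K s * (along (dX f) s * t1 s + along (dY f) s * t2 s)).
Proof.
rewrite /nder; have h1 := is_derive_along (dX f) s; have h2 := is_derive_along (dY f) s.
have h3 := ht1 s; have h4 := ht2 s.
auto_derive.
  by exd.
rewrite (is_derive_unique _ _ _ h1) (is_derive_unique _ _ _ h2) (is_derive_unique _ _ _ h3)
  (is_derive_unique _ _ _ h4) /N1 (dXdY f); ring.
Qed.

(** One derivative of [tangential0] along the arc determines [T2], and another one determines [T3];
    the terms in [K] come from the rotation of the frame. *)
Lemma second_tangential s : a < s < b -> psi s * T2 s + K s * nder s = 0.
Proof.
move=> hs; apply: (zero_derive_on (h := fun s => along (dX f) s * t1 s + along (dY f) s * t2 s)
  _ hs); first exact: tangential0.
have h1 := is_derive_along (dX f) s; have h2 := is_derive_along (dY f) s.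
have h3 := ht1 s; have h4 := ht2 s.
auto_derive.
  by exd.
rewrite (is_derive_unique _ _ _ h1) (is_derive_unique _ _ _ h2) (is_derive_unique _ _ _ h3)
  (is_derive_unique _ _ _ h4) /T2 /nder (dXdY f); ring.
Qed.

Lemma is_derive_psi s : is_derive psi s (- rho * K1 s).
Proof.
rewrite /psi; have h := hK s; auto_derive; first by exd.
by rewrite (is_derive_unique _ _ _ h); ring.
Qed.

Lemma third_tangential s : a < s < b ->
  - rho * K1 s * T2 s + psi s * (psi s * T3 s + 2 * K s * N1 s) + K1 s * nder s
  + K s * (psi s * N1 s - K s * (along (dX f) s * t1 s + along (dY f) s * t2 s)) = 0.
Proof.
move=> hs; apply: (zero_derive_on second_tangential hs); rewrite /T2.
have h1 := is_derive_along (dX (dX f)) s; have h2 := is_derive_along (dX (dY f)) s.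
have h3 := ht1 s; have h4 := ht2 s; have h5 := is_derive_along (dY (dY f)) s.
have h6 := is_derive_nder s; have h7 := is_derive_psi s; have h8 := hK s.
auto_derive.
  by exd.
rewrite (is_derive_unique _ _ _ h1) (is_derive_unique _ _ _ h2) (is_derive_unique _ _ _ h3)
  (is_derive_unique _ _ _ h4) (is_derive_unique _ _ _ h5) (is_derive_unique _ _ _ h6)
  (is_derive_unique _ _ _ h7) (is_derive_unique _ _ _ h8) /T3 /N1 -!dXdY; ring.
Qed.

Lemma circ2_0 p s : circ2 p s 0 =
  rho ^ 2 * (along (dX (dX p)) s * t1 s ^ 2 + 2 * along (dX (dY p)) s * t1 s * t2 s
             + along (dY (dY p)) s * t2 s ^ 2)
  + rho * (along (dX p) s * t2 s - along (dY p) s * t1 s).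
Proof. by rewrite /circ2 !circ_0 !circ1_0 cos_0 sin_0 (dXdY p); ring. Qed.

(* The coefficient of [phi^(2k+1)] in the even function [F] on the circle around [gamma s]. *)
Lemma transport_equation s : a < s < b -> nder s <> 0 ->
  INR k * along g s * (3 * (psi s * N1 s) * psi s - nder s * (- rho * K1 s))
  + 3 * nder s * psi s * (psi s * (along (dX g) s * t1 s + along (dY g) s * t2 s)) = 0.
Proof.
move=> hs u0.
have p0 := @psi0 s.
set u := nder s in u0 *; set g1 := along (dX g) s * t1 s + along (dY g) s * t2 s.
have e1 := tangential0 hs; have e2 := second_tangential hs; have e3 := third_tangential hs.
rewrite -/u in e2 e3; rewrite e1 Rmult_0_r Rminus_0_r in e3.
have T2E : T2 s = - K s * u / psi s.
  apply: (Rmult_eq_reg_l (psi s)) => //.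
  have -> : psi s * (- K s * u / psi s) = - K s * u by field.
  by lra.
have T3E : psi s ^ 2 * T3 s = rho * K1 s * T2 s - 3 * K s * psi s * N1 s - K1 s * u by lra.
(* Once [K] is written through [psi], the identities below are rational in independent
   quantities. *)
have KE : K s = (1 - psi s) / rho by rewrite /psi; field.
(* On the circle [f = al phi^2 + be phi^3 + o(phi^3)]: the linear term is a tangential derivative
   and vanishes, and [al] is nonzero because [u] is. *)
pose al := - rho * u / (2 * psi s).
pose be := - rho ^ 2 * (3 * (psi s * N1 s) * psi s - u * (- rho * K1 s)) / (6 * psi s ^ 3).
have A0 : circ f s 0 = 0 by rewrite circ_0 f0.
have A10 : circ1 f s 0 = 0 by rewrite circ1_0 e1; ring.
have A20 : circ2 f s 0 = 2 * al.
  have -> : circ2 f s 0 = rho ^ 2 * T2 s - rho * u by rewrite circ2_0 /T2 /u /nder; ring.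
  by rewrite T2E /al KE; field.
have A30 : is_derive (circ2 f s) 0 (6 * be).
  have -> : 6 * be = rho ^ 3 * T3 s - 3 * rho ^ 2 * N1 s.
    have -> : T3 s = (rho * K1 s * T2 s - 3 * K s * psi s * N1 s - K1 s * u) / psi s ^ 2.
      by rewrite -T3E; field.
    by rewrite T2E /be KE; field.
  have h := is_derive_circ2_0 f s.
  have <- : circ2 (dX f) s 0 * (rho * t1 s) + circ2 (dY f) s 0 * (rho * t2 s)
   + 2 * (circ1 (dX f) s 0 * (rho * t2 s)) - 2 * (circ1 (dY f) s 0 * (rho * t1 s))
   - rho * (circ (dX f) s 0 * t1 s + circ (dY f) s 0 * t2 s)
     = rho ^ 3 * T3 s - 3 * rho ^ 2 * N1 s.
    rewrite !circ2_0 !circ1_0 !circ_0 e1 /T3 /N1 -!dXdY; ring.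
  exact: h.
have ev t : circ f s (- t) ^ k * circ g s (- t) = circ f s t ^ k * circ g s t.
  by have := Fe s t; rewrite /circ !FE; lra.
have al0 : al <> 0.
  rewrite /al /Rdiv; apply: Rmult_integral_contrapositive_currified.
    by apply: Rmult_integral_contrapositive_currified => //; lra.
  by apply: Rinv_neq_0_compat; lra.
have key := even_coefficient A0 A10 A20 (is_derive_circ f s) (is_derive_circ1 f s) A30
  (is_derive_circ g s 0) ev al0.
rewrite circ_0 circ1_0 -/g1 in key.
have -> : INR k * along g s * (3 * (psi s * N1 s) * psi s - u * (- rho * K1 s))
  + 3 * u * psi s * (psi s * g1)
  = - (6 * psi s ^ 3 / rho ^ 2) * (INR k * be * along g s + al * (rho * g1)).
  by rewrite /be /al; field.
by rewrite key Rmult_0_r.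
Qed.

Definition invariant (s : R) : R := along g s ^ 3 * (nder s ^ 3 / psi s) ^ k.

(** Divided by [g u psi], the transport equation is the logarithmic derivative of
    [g^3 (u^3 / psi)^k]. The proof multiplies it by [Q^k g^2 / (u psi)] instead, so zeros of [g] do
    no harm. *)
Lemma is_derive_invariant s : a < s < b -> nder s <> 0 -> is_derive invariant s 0.
Proof.
move=> hs u0; rewrite /invariant.
have p0 := @psi0 s.
have h1 := is_derive_along g s; have h2 := is_derive_nder s; have h3 := is_derive_psi s.
rewrite (tangential0 hs) Rmult_0_r Rminus_0_r in h2.
have hq : is_derive (fun s => nder s ^ 3 / psi s) s
  (nder s ^ 2 * (3 * (psi s * N1 s) * psi s - nder s * (- rho * K1 s)) / psi s ^ 2).
  auto_derive; first by exd.
  by rewrite (is_derive_unique _ _ _ h2) (is_derive_unique _ _ _ h3); field.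
set Q := nder s ^ 3 / psi s.
set g1 := along (dX g) s * t1 s + along (dY g) s * t2 s.
set Q1 := (X in is_derive _ _ X) in hq.
have h : is_derive (fun s => along g s ^ 3 * (nder s ^ 3 / psi s) ^ k) s
  (INR 3 * (psi s * g1) * along g s ^ 2 * Q ^ k + along g s ^ 3 * (INR k * Q1 * Q ^ k.-1)).
  exact: is_derive_mult (is_derive_pow _ 3 _ _ h1) (is_derive_pow _ k _ _ hq) Rmult_comm.
have Q0 : Q <> 0.
  by apply: Rmult_integral_contrapositive_currified; [exact: pow_nonzero|exact: Rinv_neq_0_compat].
have e : INR k * Q ^ k.-1 = INR k * Q ^ k / Q.
  by case: (k) => [|k'] /=; field.
suff -> : 0 = INR 3 * (psi s * g1) * along g s ^ 2 * Q ^ k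
  + along g s ^ 3 * (INR k * Q1 * Q ^ k.-1) by [].
have te := transport_equation hs u0; rewrite -/g1 in te.
have -> : along g s ^ 3 * (INR k * Q1 * Q ^ k.-1) = along g s ^ 3 * Q1 * (INR k * Q ^ k.-1) by ring.
rewrite e; have -> : INR 3 = 3 by rewrite /=; ring.
transitivity (Q ^ k * along g s ^ 2 / (nder s * psi s) * 0); first by ring.
by rewrite -[in LHS]te /Q1 /Q; field.
Qed.

Lemma gradsq_nder s : a < s < b -> nder s ^ 2 = ev (gradsq f) (parx s) (pary s).
Proof.
move=> hs; have := tangential0 hs; rewrite /gradsq !evE /nder -!/(along _ _) => e.
have := unit_t s; nra.
Qed.

(** On the arc [hess = u^2 T2 = - K u^3 / psi], and [psi + rho K = 1]. The boundary curvature thus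
    disappears and the invariant becomes a function of position and [u] alone. *)
Lemma hess_nder s : a < s < b ->
  / rho * nder s ^ 3 - ev (hess f) (parx s) (pary s) = / rho * (nder s ^ 3 / psi s).
Proof.
move=> hs; have e1 := tangential0 hs; have e2 := second_tangential hs.
have p0 := @psi0 s.
have u1 : along (dX f) s = - t2 s * nder s.
  have -> : - t2 s * nder s = along (dX f) s * (t1 s ^ 2 + t2 s ^ 2)
    - t1 s * (along (dX f) s * t1 s + along (dY f) s * t2 s) by rewrite /nder; ring.
  by rewrite e1 unit_t; ring.
have u2 : along (dY f) s = t1 s * nder s.
  have -> : t1 s * nder s = along (dY f) s * (t1 s ^ 2 + t2 s ^ 2)
    - t2 s * (along (dX f) s * t1 s + along (dY f) s * t2 s) by rewrite /nder; ring.
  by rewrite e1 unit_t; ring.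
have -> : ev (hess f) (parx s) (pary s) = nder s ^ 2 * T2 s.
  by rewrite /hess !evE -!/(along _ _) u1 u2 /T2; ring.
have T2E : T2 s = - K s * nder s / psi s.
  apply: (Rmult_eq_reg_l (psi s)) => //.
  have -> : psi s * (- K s * nder s / psi s) = - K s * nder s by field.
  by lra.
have KE : K s = (1 - psi s) / rho by rewrite /psi; field.
by rewrite T2E KE; field.
Qed.

End Factor.
End Frame.

(** * Closed curves as components of algebraic curves *)

Lemma periodic_mult (h : R -> R) (L : R) (n : Z) (s : R) :
  (forall s, h (s + L) = h s) -> h (s + IZR n * L) = h s.
Proof.
move=> hL.
have pos : forall (m : nat) s, h (s + INR m * L) = h s.
  elim=> [|m IH] x; first by rewrite /= Rmult_0_l Rplus_0_r.
  have -> : x + INR m.+1 * L = (x + INR m * L) + L by rewrite S_INR; ring.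
  by rewrite hL IH.
have [hn|hn] := Z.le_gt_cases Z0 n.
  by have [m ->] := IZN n hn; rewrite -INR_IZR_INZ pos.
have [m e] := IZN (Z.opp n) ltac:(lia).
have -> : IZR n = - INR m by rewrite INR_IZR_INZ -e opp_IZR; ring.
by rewrite -(pos m (s + - INR m * L)); congr h; ring.
Qed.

Lemma periodic_reduce (L s : R) : 0 < L -> exists s', 0 <= s' < L /\
  forall h : R -> R, (forall s, h (s + L) = h s) -> h s = h s'.
Proof.
move=> L0; have [h1 h2] := base_Int_part (s / L).
exists (s - IZR (Int_part (s / L)) * L); split.
  have e : s = (s / L) * L by field; lra.
  set q := s / L in e h1 h2 *; set z := IZR _ in h1 h2 *.
  by rewrite e -Rmult_minus_distr_r; split; nra.
move=> h hL; rewrite -(periodic_mult (Int_part (s / L)) (s - _) hL); congr h; ring.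
Qed.

Lemma continuity_2d_horner (p : {poly R}) x y :
  continuity_2d_pt (fun u v => p.[u]%Ring) x y.
Proof.
elim/poly_ind: p => [|p c IH].
  apply: (continuity_2d_pt_ext (fun _ _ => 0)); first by move=> *; rewrite horner0.
  exact: continuity_2d_pt_const.
apply: (continuity_2d_pt_ext (fun u v => p.[u]%Ring * u + c)).
  by move=> *; rewrite hornerMXaddC.
apply: continuity_2d_pt_plus; last exact: continuity_2d_pt_const.
by apply: continuity_2d_pt_mult => //; exact: continuity_2d_pt_id1.
Qed.

Lemma continuity_2d_ev p x y : continuity_2d_pt (ev p) x y.
Proof.
elim/poly_ind: p => [|p c IH].
  apply: (continuity_2d_pt_ext (fun _ _ => 0)); first by move=> *; rewrite ev0.
  exact: continuity_2d_pt_const.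
apply: (continuity_2d_pt_ext (fun u v => ev p u v * v + c.[u]%Ring)).
  by move=> *; rewrite !evE ev_C.
apply: continuity_2d_pt_plus; last exact: continuity_2d_horner.
by apply: continuity_2d_pt_mult => //; exact: continuity_2d_pt_id2.
Qed.

(* The indicator function of [P] has derivative zero. *)
Lemma locally_constant_const (P : R -> Prop) (s0 : R) :
  (forall s, exists e, 0 < e /\ forall t, Rabs (t - s) < e -> (P t <-> P s)) ->
  P s0 -> forall s, P s.
Proof.
move=> loc P0 s.
pose ind t := if excluded_middle_informative (P t) then 1 else 0.
have d0 t : is_derive ind t 0.
  have [e [e0 he]] := loc t.
  apply: (is_derive_ext_loc (fun _ => ind t)); last exact: is_derive_const.
  exists (mkposreal _ e0) => u /ball_R /= hu; have := he u hu; rewrite /ind.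
  by case: excluded_middle_informative => h1; case: excluded_middle_informative => h2 //=; tauto.
have e : ind s0 = ind s.
  have [h|[->|h]] := Rtotal_order s0 s => //.
    by apply: eq_is_derive h => t _.
  by symmetry; apply: eq_is_derive h => t _.
move: e; rewrite /ind; case: excluded_middle_informative => // h1.
by case: excluded_middle_informative => //= h2; lra.
Qed.

Lemma convex_Rabs_lt (r x y e : R) : 0 <= r <= 1 -> Rabs x < e -> Rabs y < e ->
  Rabs ((1 - r) * x + r * y) < e.
Proof.
move=> r01 hx hy; apply: Rle_lt_trans (Rabs_triang _ _) _.
rewrite !Rabs_mult [Rabs r]Rabs_pos_eq ?[Rabs (1 - r)]Rabs_pos_eq; try lra.
have hM := Rmax_lub_lt _ _ _ hx hy.
have h1 : (1 - r) * Rabs x <= (1 - r) * Rmax (Rabs x) (Rabs y).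
  by apply: Rmult_le_compat_l; [lra|exact: Rmax_l].
have h2 : r * Rabs y <= r * Rmax (Rabs x) (Rabs y).
  by apply: Rmult_le_compat_l; [lra|exact: Rmax_r].
lra.
Qed.

Section ClosedCurve.
Variables (X Y v1 v2 : R -> R) (L : R) (f : {poly {poly R}}).
Hypothesis L0 : 0 < L.
Hypothesis hX : forall s, is_derive X s (v1 s).
Hypothesis hY : forall s, is_derive Y s (v2 s).
Hypothesis XL : forall s, X (s + L) = X s.
Hypothesis YL : forall s, Y (s + L) = Y s.

Let G (p : pt) : Prop := exists s, p = (X s, Y s).

Lemma continuous_X s : continuous X s.
Proof. by apply: ex_derive_continuous; eexists; exact: hX. Qed.

Lemma continuous_Y s : continuous Y s.
Proof. by apply: ex_derive_continuous; eexists; exact: hY. Qed.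

Lemma curve_near s e : 0 < e -> exists d, 0 < d /\
  forall t, Rabs (t - s) < d -> Rabs (X t - X s) < e /\ Rabs (Y t - Y s) < e.
Proof.
move=> e0.
have [d1 h1] := proj1 (filterlim_locally _ _) (@continuous_X s) (mkposreal _ e0).
have [d2 h2] := proj1 (filterlim_locally _ _) (@continuous_Y s) (mkposreal _ e0).
have c1 := cond_pos d1; have c2 := cond_pos d2.
exists (Rmin d1 d2); split; first exact: Rmin_glb_lt.
move=> t ht; have m1 := Rmin_l d1 d2; have m2 := Rmin_r d1 d2; split.
  by apply: h1; apply: Rlt_le_trans ht m1.
by apply: h2; apply: Rlt_le_trans ht m2.
Qed.

Lemma connected_curve : connected2 G.
Proof.
move=> [U [V [oU [oV [cov [[p [[s1 ->] Up]] [[q [[s2 ->] Vq]] dis]]]]]]].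
have := @locally_constant_const (fun s => U (X s, Y s)) s1 _ Up s2.
move=> h; apply: (dis _ _ (h _) Vq); try by exists s2.
move=> s; have [Us|Vs] := cov (X s, Y s) (ex_intro _ s erefl).
  have [e [e0 he]] := oU _ Us; have [d [d0 hd]] := curve_near s e0.
  exists d; split=> // t /hd [h1 h2]; split=> // _; exact: he.
have [e [e0 he]] := oV _ Vs; have [d [d0 hd]] := curve_near s e0.
exists d; split=> // t /hd [h1 h2]; split=> Ut; exfalso.
  by apply: (dis (X t, Y t)) => //; [exists t|exact: he].
by apply: (dis (X s, Y s)) => //; exists s.
Qed.

Lemma curve_closed q : ~ G q -> exists e, 0 < e /\
  forall q', Rabs (fst q' - fst q) < e -> Rabs (snd q' - snd q) < e -> ~ G q'.
Proof.
case: q => x y nG.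
pose D s := (X s - x) ^ 2 + (Y s - y) ^ 2.
have cD s : continuity_pt D s.
  apply/continuity_pt_filterlim; apply: ex_derive_continuous; rewrite /D.
  have h1 := hX s; have h2 := hY s; auto_derive; exd.
have [m [hm _]] := continuity_ab_min D 0 L (Rlt_le _ _ L0) (fun c _ => cD c).
have Dm : 0 < D m.
  apply: Rnot_le_lt => h; apply: nG; exists m; rewrite /D in h.
  by have := pow2_ge_0 (X m - x); have := pow2_ge_0 (Y m - y) => h1 h2; congr pair; nra.
(* Offsets below both 1 and [D m / 2] have squares below [D m / 2], so two of them cannot add up to
   the minimal squared distance [D m]. *)
exists (Rmin 1 (D m / 2)); split; first by apply: Rmin_glb_lt; lra.
move=> [x' y'] /= hx hy [s [ex ey]].
have [s' [hs' per]] := periodic_reduce s L0.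
rewrite ex ey (per X XL) (per Y YL) in hx hy.
have := hm s' ltac:(lra); have l1 := Rmin_l 1 (D m / 2); have l2 := Rmin_r 1 (D m / 2).
have sq (a : R) : Rabs a < Rmin 1 (D m / 2) -> a ^ 2 < D m / 2.
  by move=> /Rabs_def2 [a1 a2]; nra.
by rewrite {2}/D; have := sq _ hx; have := sq _ hy; lra.
Qed.

Hypothesis fG : forall s, ev f (X s) (Y s) = 0.
Hypothesis grad_ne0 : forall s,
  - ev (dX f) (X s) (Y s) * v2 s + ev (dY f) (X s) (Y s) * v1 s <> 0.

(** An implicit function argument in the fixed frame of [s0]. The intermediate value theorem finds a
    curve point with the same tangential coordinate as [q]; on the normal segment from it to [q] the
    normal derivative of [f] has no zero, so by Rolle the zeros of [f] at its two ends coincide. *)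
Lemma zero_set_near s0 : exists e, 0 < e /\
  forall q, Rabs (fst q - X s0) < e -> Rabs (snd q - Y s0) < e ->
    ev f (fst q) (snd q) = 0 -> G q.
Proof.
pose a := v1 s0; pose b := v2 s0.
pose l := a ^ 2 + b ^ 2.
have l0 : 0 < l.
  have := @grad_ne0 s0; rewrite -/a -/b /l => h.
  have [a0|a0] := Req_dec a 0; last nra.
  by have [b0|b0] := Req_dec b 0; [case: h; rewrite a0 b0; ring|nra].
pose D x y := - ev (dX f) x y * b + ev (dY f) x y * a.
have cD : continuity_2d_pt D (X s0) (Y s0).
  apply: continuity_2d_pt_plus; apply: continuity_2d_pt_mult;
    try exact: continuity_2d_pt_const; try exact: continuity_2d_ev.
  by apply: continuity_2d_pt_opp; exact: continuity_2d_ev.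
have Dp : 0 < Rabs (D (X s0) (Y s0)) by apply: Rabs_pos_lt; exact: grad_ne0.
have [e1 he1] := cD (mkposreal _ Dp); have e1p := cond_pos e1.
have {}he1 x y : Rabs (x - X s0) < e1 -> Rabs (y - Y s0) < e1 -> D x y <> 0.
  move=> hx hy D0; have := he1 x y hx hy => /=.
  by rewrite D0 /Rminus Rplus_0_l Rabs_Ropp; lra.
have [d1 [d1p near]] := curve_near s0 e1p.
(* The tangential coordinate of the curve relative to [s0]. Its slope at [s0] is [l], so on a short
   interval it takes all values up to [d * (l / 2)] in absolute value. *)
pose h s := (X s - X s0) * a + (Y s - Y s0) * b.
have hd s : is_derive h s (v1 s * a + v2 s * b).
  rewrite /h; have h1 := hX s; have h2 := hY s; auto_derive; first by exd.
  by rewrite (is_derive_unique _ _ _ h1) (is_derive_unique _ _ _ h2); ring.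
have h0 : h s0 = 0 by rewrite /h; ring.
have hds0 : derivable_pt_lim h s0 l.
  by apply/is_derive_Reals; have := hd s0; rewrite -/a -/b; have -> : a * a + b * b = l by rewrite /l; ring.
have [d2 hd2] := hds0 (l / 2) ltac:(lra); have d2p := cond_pos d2.
pose d := Rmin d1 d2 / 2.
have m1 := Rmin_l d1 d2; have m2 := Rmin_r d1 d2.
have m0 : 0 < Rmin d1 d2 by exact: Rmin_glb_lt.
have dp : 0 < d by rewrite /d; lra.
have slope t : t <> 0 -> Rabs t < d2 -> l / 2 < h (s0 + t) / t < 3 * l / 2.
  by move=> t0 td; have := hd2 t t0 td; rewrite h0 Rminus_0_r => /Rabs_def2; lra.
have up : d * (l / 2) < h (s0 + d).
  have [s1 _] := slope d ltac:(lra) ltac:(rewrite Rabs_pos_eq /d; lra).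
  have -> : h (s0 + d) = d * (h (s0 + d) / d) by field; lra.
  by apply: Rmult_lt_compat_l.
have low : h (s0 + - d) < - (d * (l / 2)).
  have [s1 _] := slope (- d) ltac:(lra) ltac:(rewrite Rabs_left /d; lra).
  have -> : h (s0 + - d) = - (d * (h (s0 + - d) / - d)) by field; lra.
  by apply: Ropp_lt_contravar; apply: Rmult_lt_compat_l.
pose m := d * (l / 2).
have mp : 0 < m by rewrite /m; nra.
(* The summand 1 makes the bound on [c] below strict. *)
pose k := Rabs a + Rabs b + 1.
have kp : 0 < k by rewrite /k; have := Rabs_pos a; have := Rabs_pos b; lra.
exists (Rmin e1 (m / k)); split.
  by apply: Rmin_glb_lt => //; apply: Rdiv_lt_0_compat.
move=> [x y] /= hx hy fz.
have n1 := Rmin_l e1 (m / k); have n2 := Rmin_r e1 (m / k).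
pose c := (x - X s0) * a + (y - Y s0) * b.
have hc : Rabs c < m.
  apply: Rle_lt_trans (Rabs_triang _ _) _; rewrite !Rabs_mult.
  have e : m = (m / k) * k by field; lra.
  have p1 := Rabs_pos (x - X s0); have p2 := Rabs_pos (y - Y s0).
  have p3 := Rabs_pos a; have p4 := Rabs_pos b.
  have mk : 0 < m / k by apply: Rdiv_lt_0_compat.
  have q1 : Rabs (x - X s0) * Rabs a <= m / k * Rabs a by apply: Rmult_le_compat_r; lra.
  have q2 : Rabs (y - Y s0) * Rabs b <= m / k * Rabs b by apply: Rmult_le_compat_r; lra.
  have e2 : m / k * k = m / k * Rabs a + m / k * Rabs b + m / k by rewrite {2}/k; ring.
  by rewrite [X in _ < X]e e2; lra.
have [hc1 hc2] := Rabs_def2 _ _ hc; have mE : m = d * (l / 2) by [].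
have cont : continuity h.
  move=> s; apply/continuity_pt_filterlim; apply: ex_derive_continuous; eexists; exact: hd.
have [s [hs hsc]] := IVT_gen h (s0 + - d) (s0 + d) c cont
  ltac:(rewrite Rmin_left; [rewrite Rmax_right|]; lra).
rewrite Rmin_left in hs; last lra.
rewrite Rmax_right in hs; last lra.
have sd : Rabs (s - s0) < d1 by apply: Rabs_def1; rewrite /d in hs; lra.
have [near1 near2] := near s sd.
have orth : (x - X s) * a + (y - Y s) * b = 0 by move: hsc; rewrite /h /c; lra.
pose tau := (- (x - X s) * b + (y - Y s) * a) / l.
have xE : x = X s - tau * b.
  rewrite /tau; apply: (Rmult_eq_reg_r l); last lra.
  have -> : (X s - (- (x - X s) * b + (y - Y s) * a) / l * b) * l =
     x * l - a * ((x - X s) * a + (y - Y s) * b) by rewrite /l; field; rewrite -/(l); lra.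
  by rewrite orth; ring.
have yE : y = Y s + tau * a.
  rewrite /tau; apply: (Rmult_eq_reg_r l); last lra.
  have -> : (Y s + (- (x - X s) * b + (y - Y s) * a) / l * a) * l =
     y * l - b * ((x - X s) * a + (y - Y s) * b) by rewrite /l; field; rewrite -/(l); lra.
  by rewrite orth; ring.
pose w t := ev f (X s - t * b) (Y s + t * a).
have dw t : is_derive w t (D (X s - t * b) (Y s + t * a)).
  have -> : D (X s - t * b) (Y s + t * a) =
    ev (dX f) (X s - t * b) (Y s + t * a) * (- b) + ev (dY f) (X s - t * b) (Y s + t * a) * a.
    by rewrite /D; ring.
  by apply: is_derive_ev; auto_derive => //; ring.
have [t [ht we]] := MVT_gen w 0 tau _ (fun t _ => dw t)
  (fun t _ => proj2 (continuity_pt_filterlim _ _) (ex_derive_continuous _ _ (ex_intro _ _ (dw t)))).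
have w0 : w 0 = 0 by rewrite /w !Rmult_0_l Rminus_0_r Rplus_0_r fG.
have wt : w tau = 0 by rewrite /w -xE -yE.
have tau0 : tau = 0.
  move: we; rewrite w0 wt Rminus_0_r Rminus_0_r => e.
  have /Rmult_integral [Dz|//] : D (X s - t * b) (Y s + t * a) * tau = 0 by rewrite -e.
  (* [r] is the convex coordinate of the intermediate point between two points of the box on which
     [D] has no zero. *)
  have [r [hr tr]] : exists r, 0 <= r <= 1 /\ t = r * tau.
    have [t0|t0] := Req_dec tau 0.
      by exists 0; move: ht; rewrite t0 Rmin_left; [rewrite Rmax_left|]; lra.
    have e2 : t = t / tau * tau by field.
    exists (t / tau); split=> //.
    have [tp|tn] := Rle_lt_dec 0 tau.
      rewrite Rmin_left in ht; last lra.
      rewrite Rmax_right in ht; last lra.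
      by split; [apply: Rle_mult_inv_pos; lra|apply/Rle_div_l; lra].
    rewrite Rmin_right in ht; last lra.
    rewrite Rmax_left in ht; last lra.
    have -> : t / tau = (- t) / (- tau) by field.
    by split; [apply: Rle_mult_inv_pos; lra|apply/Rle_div_l; lra].
  exfalso; apply: he1 Dz.
    have -> : X s - t * b - X s0 = (1 - r) * (X s - X s0) + r * (x - X s0).
      by rewrite xE tr; ring.
    by apply: convex_Rabs_lt => //; lra.
  have -> : Y s + t * a - Y s0 = (1 - r) * (Y s - Y s0) + r * (y - Y s0).
    by rewrite yE tr; ring.
  by apply: convex_Rabs_lt => //; lra.
by exists s; rewrite xE yE tau0; congr pair; ring.
Qed.

(** A connected set of zeros that met both the curve and its complement would be separated by two
    open sets: the boxes in which every zero of [f] is on the curve, and the boxes disjoint from the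
    curve. *)
Lemma curve_component : connected_component_of (fun p => ev f (fst p) (snd p) = 0) G.
Proof.
split; first by exists (X 0, Y 0), 0.
split; first by move=> p [s ->] /=.
split; first exact: connected_curve.
move=> Cc conn CZ [p0 [Cp0 Gp0]] p Cp; apply: NNPP => nGp.
pose box (c : pt) e (q : pt) := Rabs (fst q - fst c) < e /\ Rabs (snd q - snd c) < e.
have shrink c e q : box c e q -> exists e', 0 < e' /\ forall q', box q e' q' -> box c e q'.
  move=> [h1 h2]; exists (Rmin (e - Rabs (fst q - fst c)) (e - Rabs (snd q - snd c))).
  split; first by apply: Rmin_glb_lt; lra.
  move=> q' [h3 h4].
  have l1 := Rmin_l (e - Rabs (fst q - fst c)) (e - Rabs (snd q - snd c)).
  have l2 := Rmin_r (e - Rabs (fst q - fst c)) (e - Rabs (snd q - snd c)).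
  split.
    have -> : fst q' - fst c = (fst q' - fst q) + (fst q - fst c) by ring.
    by apply: Rle_lt_trans (Rabs_triang _ _) _; lra.
  have -> : snd q' - snd c = (snd q' - snd q) + (snd q - snd c) by ring.
  by apply: Rle_lt_trans (Rabs_triang _ _) _; lra.
apply: conn; exists (fun q => exists c e, box c e q /\
    forall q', box c e q' -> ev f (fst q') (snd q') = 0 -> G q').
exists (fun q => exists c e, box c e q /\ forall q', box c e q' -> ~ G q').
split; [|split; [|split; [|split; [|split]]]].
- move=> q [c [e [bq h]]]; have [e' [e'p h']] := shrink _ _ _ bq.
  exists e'; split=> // q' h1 h2; exists c, e; split=> //; exact: h'.
- move=> q [c [e [bq h]]]; have [e' [e'p h']] := shrink _ _ _ bq.
  exists e'; split=> // q' h1 h2; exists c, e; split=> //; exact: h'.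
- move=> q Cq; case: (classic (G q)) => [[s ->]|nG]; [left|right].
    have [e [e0 he]] := zero_set_near s; exists (X s, Y s), e; split; last first.
      by move=> q' [h1 h2]; exact: he.
    by split; rewrite /= Rminus_diag Rabs_R0.
  have [e [e0 he]] := curve_closed nG; exists q, e; split; last first.
    by move=> q' [h1 h2]; exact: he.
  by split; rewrite Rminus_diag Rabs_R0.
- exists p0; split=> //; case: Gp0 => s ->.
  have [e [e0 he]] := zero_set_near s; exists (X s, Y s), e; split; last first.
    by move=> q' [h1 h2]; exact: he.
  by split; rewrite /= Rminus_diag Rabs_R0.
- exists p; split=> //.
  have [e [e0 he]] := curve_closed nGp; exists p, e; split; last first.
    by move=> q' [h1 h2]; exact: he.
  by split; rewrite Rminus_diag Rabs_R0.
- move=> q Cq [c [e [b1 h1]]] [c' [e' [b2 h2]]].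
  by apply: (h2 q b2); apply: h1 => //; exact: CZ.
Qed.

End ClosedCurve.

(** * Ovals from polynomials that are even on circles *)

Lemma dY_neq0 (f : {poly {poly R}}) : (1 < size f)%N -> dY f <> 0%Ring.
Proof.
move=> f1 d0; have f0 : f != 0%Ring by rewrite -size_poly_gt0 (ltn_trans _ f1).
have : ((dY f)`_(size f).-2 = 0)%Ring by rewrite d0 coef0.
rewrite coef_deriv.
have -> : (size f).-2.+1 = (size f).-1 by case: (size f) f1 => [|[|m]].
move/polyP => e; move: f0; rewrite -lead_coef_eq0 => /eqP; apply; apply/polyP => i.
have := e i; rewrite coefMn !coef0 => /eqP; rewrite Num.Theory.mulrn_eq0.
have -> : ((size f).-1 == 0%N) = false by case: (size f) f1 => [|[|m]].
by move=> /eqP.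
Qed.

Lemma evC_real p x y : evC p (RtoC x) (RtoC y) = RtoC (ev p x y).
Proof.
rewrite /evC -[RtoC (ev p x y)]/(ofRi (real_complex R (ev p x y))); congr ofRi.
rewrite /ev /ev2 -[toRi (RtoC x)]/(real_complex R x) -[toRi (RtoC y)]/(real_complex R y).
by rewrite -horner_map /= -horner_map /= map_polyC.
Qed.

Lemma continuous_const_at_end (h : R -> R) (a m c : R) :
  a < m -> continuous h m -> (forall s, a < s < m -> h s = c) -> h m = c.
Proof.
move=> am ch hc; apply: NNPP => hm.
have ch' : continuous (fun s => h s - c) m.
  by apply: (continuous_minus h (fun _ => c)) => //; exact: continuous_const.
have [e [e0 he]] := nonzero_near ch' ltac:(lra).
pose t := Rmax ((a + m) / 2) (m - e / 2).
have t1 := Rmax_l ((a + m) / 2) (m - e / 2); have t2 := Rmax_r ((a + m) / 2) (m - e / 2).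
have t3 : t < m by apply: Rmax_lub_lt; lra.
apply: (he t); first by apply: Rabs_def1; rewrite /t in t3 *; lra.
by rewrite hc; rewrite /t in t3 *; lra.
Qed.

Section Oval.
Variables (gx gy t1 t2 K K1 : R -> R) (rho L : R) (F : {poly {poly R}}).
Hypothesis hgx : forall s, is_derive gx s (t1 s).
Hypothesis hgy : forall s, is_derive gy s (t2 s).
Hypothesis ht1 : forall s, is_derive t1 s (- K s * t2 s).
Hypothesis ht2 : forall s, is_derive t2 s (K s * t1 s).
Hypothesis hK : forall s, is_derive K s (K1 s).
Hypothesis unit_t : forall s, t1 s ^ 2 + t2 s ^ 2 = 1.
Hypothesis rho0 : rho <> 0.
Hypothesis psi0 : forall s, psi K rho s <> 0.
Hypothesis L0 : 0 < L.
Local Notation X := (parx gx t2 rho).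
Local Notation Y := (pary gy t1 rho).
Hypothesis XL : forall s, X (s + L) = X s.
Hypothesis YL : forall s, Y (s + L) = Y s.
Hypothesis t1_ne0 : exists s, t1 s <> 0.
Hypothesis Fe : even_on_circles gx gy t1 t2 rho F.
Hypothesis Fnc : exists x y x' y', ev F x y <> ev F x' y'.

Theorem oval_of_even_polynomial :
  real_oval_of_nonsingular_affine_curve (fun p => exists s, p = (X s, Y s)).
Proof.
pose al p := along gx gy t1 t2 rho p.
pose u f := nder gx gy t1 t2 rho f.
pose c0 := al F 0.
have Fc s : al F s = c0 by exact: (along_const hgx hgy ht1 ht2 rho0 Fe).
have dX' s : is_derive X s (psi K rho s * t1 s) by exact: is_derive_parx.
have dY' s : is_derive Y s (psi K rho s * t2 s) by exact: is_derive_pary.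
have dal p s : is_derive (al p) s (psi K rho s * (al (dX p) s * t1 s + al (dY p) s * t2 s)).
  exact: is_derive_along.
have cal p s : continuous (al p) s by apply: ex_derive_continuous; eexists; exact: dal.
have [s0 ts0] := t1_ne0.
have ct1 : continuous t1 s0 by apply: ex_derive_continuous; eexists; exact: ht1.
(* On this interval the first coordinate has nonzero derivative along the parallel curve, as
   [minimal_vanishing] requires. *)
have [a0 [b0 [_ ab0 _ t1ab]]] := nonzero_subinterval (a := s0 - 1) (b := s0 + 1) ct1 ts0 ltac:(lra).
have X1ab s : a0 < s < b0 -> psi K rho s * t1 s <> 0.
  by move=> hs; apply: Rmult_integral_contrapositive_currified; [exact: psi0|exact: t1ab].
pose P := (F - cst c0)%Ring.
have P0 : P <> 0%Ring.
  move=> P0; have [x [y [x' [y' ne]]]] := Fnc; apply: ne.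
  have e z w : ev F z w = c0.
    by have := ev0 z w; rewrite -P0 /P !evE; lra.
  by rewrite !e.
have vP : van X Y a0 b0 P a0 b0.
  split; try lra; move=> s _; rewrite /P !evE.
  by have := Fc s; rewrite /al /along => ->; ring.
have [f [a [b [vf f1 fmin fdiv]]]] :=
  minimal_vanishing (fun s _ => dX' s) (fun s _ => dY' s) X1ab P0 vP.
have [a0a ab bb0 fz] := vf.
have [k [g [Pfg g0 ng]]] := power_factor f1 P0.
have FE x y : ev F x y = c0 + ev f x y ^ k * ev g x y.
  have : ev P x y = ev f x y ^ k * ev g x y by rewrite Pfg !evE.
  by rewrite /P !evE; lra.
(* If [k] were 0, then [g = P] would vanish on the arc and be divisible by [f]. *)
have [k' kk'] : exists k', k = k'.+1.
  case: (k) Pfg => [|k'] e; last by exists k'.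
  case: ng; have [q qe] := fdiv P a b (van_sub vP a0a ab bb0) (Rle_refl a) (Rle_refl b).
  by exists q; rewrite -qe e expr0 mul1r.
have nv p a' b' : a <= a' -> a' < b' -> b' <= b -> (forall s, a' < s < b' -> al p s = 0) ->
    van X Y a0 b0 p a' b'.
  by move=> h1 h2 h3 h4; split=> //; lra.
(* [dY f] has smaller degree in [y], so it does not vanish identically on the arc; this gives a
   subarc on which [u] has no zero. *)
have [s1 [hs1 fy1]] : exists s, a < s < b /\ al (dY f) s <> 0.
  apply: NNPP => h.
  have vd : van X Y a0 b0 (dY f) a b.
    apply: nv; try lra; move=> s hs; apply: NNPP => h'; apply: h; by exists s.
  have d0 : dY f <> 0%Ring.
    exact: dY_neq0.
  have := fmin (dY f) (conj d0 (ex_intro _ a (ex_intro _ b vd))).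
  by rewrite leqNgt lt_size_deriv // -size_poly_gt0; case: (size f) f1.
have [a1 [b1 [aa1 ab1 bb1 fyab]]] := nonzero_subinterval (cal (dY f) s1) fy1 hs1.
have f0ab s : a1 < s < b1 -> al f s = 0 by move=> hs; apply: fz; lra.
have u0ab s : a1 < s < b1 -> u f s <> 0.
  move=> hs uz; apply: (fyab s hs).
  have e := tangential0 hgx hgy ht1 ht2 psi0 f0ab hs.
  have -> : al (dY f) s = al (dY f) s * (t1 s ^ 2 + t2 s ^ 2) by rewrite unit_t; ring.
  have -> : al (dY f) s * (t1 s ^ 2 + t2 s ^ 2)
    = t1 s * u f s + t2 s * (al (dX f) s * t1 s + al (dY f) s * t2 s).
    by rewrite /u /nder -!/(al _ _); ring.
  by rewrite uz e; ring.
have [s2 [hs2 g2]] : exists s, a1 < s < b1 /\ al g s <> 0.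
  apply: NNPP => h.
  have vd : van X Y a0 b0 g a1 b1.
    apply: nv; try lra; move=> s hs; apply: NNPP => h'; apply: h; by exists s.
  by apply: ng; exact: fdiv vd aa1 bb1.
pose I := invariant gx gy t1 t2 K rho f g k.
have dI a' b' s : (forall s, a' < s < b' -> al f s = 0) -> a' < s < b' -> u f s <> 0 ->
    is_derive I s 0.
  by move=> h1 h2 h3; exact: (is_derive_invariant hgx hgy ht1 ht2 hK rho0 psi0 Fe FE h1 h2 h3).
have constI a' b' x y : (forall s, a' < s < b' -> al f s = 0) ->
    (forall s, a' < s < b' -> u f s <> 0) -> a' < x < b' -> a' < y < b' -> I x = I y.
  move=> h1 h2 hx hy; have [h|[->|h]] := Rtotal_order x y => //.
    by apply: eq_is_derive h => t ht; apply: (dI a' b') => //; [|apply: h2]; lra.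
  by symmetry; apply: eq_is_derive h => t ht; apply: (dI a' b') => //; [|apply: h2]; lra.
pose C1 := I s2.
have C10 : C1 <> 0.
  apply: Rmult_integral_contrapositive_currified; first exact: pow_nonzero.
  apply: pow_nonzero; apply: Rmult_integral_contrapositive_currified.
    by apply: pow_nonzero; exact: u0ab.
  by apply: Rinv_neq_0_compat; exact: psi0.
(* The power of [/ rho] is the factor by which [hess_nder] relates the two forms of the
   invariant. *)
pose cc := (/ rho) ^ k * C1.
have cc0 : cc <> 0.
  by apply: Rmult_integral_contrapositive_currified => //; apply: pow_nonzero; exact: Rinv_neq_0_compat.
have vcert : van X Y a0 b0 (certificate f g (/ rho) cc k) a1 b1.
  apply: nv; try lra; move=> s hs.
  apply: (ev_certificate (u := u f s)).
    exact: (gradsq_nder hgx hgy ht1 ht2 unit_t psi0 f0ab hs).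
  rewrite (hess_nder hgx hgy ht1 ht2 unit_t rho0 psi0 f0ab hs).
  rewrite /cc /C1 -(constI a1 b1 s s2) // /I /invariant -/(u f s) Rpow_mult_distr.
  by rewrite -/(along gx gy t1 t2 rho g s); ring.
have [q qE] := fdiv _ _ _ vcert aa1 bb1.
have nonsing z w : ~ [/\ evC f z w = RtoC 0, evC (dX f) z w = RtoC 0 & evC (dY f) z w = RtoC 0].
  by rewrite kk' in qE; exact: nonsingular_of_certificate cc0 qE.
(* Non-singularity makes [u] nonzero on every interval where [f] vanishes along the curve, beyond
   the arc that produced the certificate. *)
have real_nonsing a' b' s : (forall s, a' < s < b' -> al f s = 0) -> a' < s < b' -> u f s <> 0.
  move=> h1 h2 uz; apply: (nonsing (RtoC (X s)) (RtoC (Y s))).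
  have e := tangential0 hgx hgy ht1 ht2 psi0 h1 h2.
  rewrite !evC_real -!/(along gx gy t1 t2 rho _ s) -!/(al _ s) h1 //.
  have e1 : al (dX f) s = 0.
    have -> : al (dX f) s = al (dX f) s * (t1 s ^ 2 + t2 s ^ 2) by rewrite unit_t; ring.
    have -> : al (dX f) s * (t1 s ^ 2 + t2 s ^ 2)
      = - t2 s * u f s + t1 s * (al (dX f) s * t1 s + al (dY f) s * t2 s).
      by rewrite /u /nder -!/(al _ _); ring.
    by rewrite uz e; ring.
  have e2 : al (dY f) s = 0.
    have -> : al (dY f) s = al (dY f) s * (t1 s ^ 2 + t2 s ^ 2) by rewrite unit_t; ring.
    have -> : al (dY f) s * (t1 s ^ 2 + t2 s ^ 2)
      = t1 s * u f s + t2 s * (al (dX f) s * t1 s + al (dY f) s * t2 s).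
      by rewrite /u /nder -!/(al _ _); ring.
    by rewrite uz e; ring.
  by rewrite e1 e2.
have cI s : continuous I s.
  apply: ex_derive_continuous; rewrite /I /invariant.
  have h1 := dal g s; have h2 := is_derive_nder rho hgx hgy ht1 ht2 f s.
  have h3 := is_derive_psi rho hK s.
  have p0 := @psi0 s.
  by auto_derive; exd.
(* Continuation: [m] is the supremum of the parameters up to which [f] vanishes. The invariant is
   still [C1] at [m], so [g] is nonzero near [m], and [F = c0] forces [f = 0] beyond [m]. *)
have right s : a1 < s -> al f s = 0.
  move=> hs; apply: NNPP => fs.
  pose E t := a1 < t /\ forall x, a1 < x < t -> al f x = 0.
  have bE : bound E.
    exists s => t [_ h]; apply: Rnot_lt_le => st; apply: fs; apply: h; lra.
  have [m [ub lub]] := completeness E bE (ex_intro _ b1 (conj ab1 f0ab)).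
  have b1m : b1 <= m by apply: ub.
  have fm x : a1 < x < m -> al f x = 0.
    move=> [x1 x2]; apply: NNPP => fx.
    suff : m <= x by lra.
    apply: lub => t [_ h]; apply: Rnot_lt_le => xt; apply: fx; apply: h; lra.
  have Im : I m = C1.
    apply: (continuous_const_at_end (a := a1)) => //; first by lra.
    move=> x hx; apply: (constI a1 m) => //; try lra.
    by move=> y hy; exact: (real_nonsing a1 m).
  have gm : al g m <> 0.
    move=> gm; apply: C10; rewrite -Im /I /invariant -/(al g m) gm; ring.
  have [e [e0 ge]] := nonzero_near (cal g m) gm.
  have fk x : al g x <> 0 -> al f x = 0.
    move=> gx0; have := Fc x; rewrite /al /along FE => h.
    have /Rmult_integral [h'|//] : al f x ^ k * al g x = 0 by rewrite /al /along; lra.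
    by apply: NNPP => fx; exact: (pow_nonzero _ k fx).
  have : m + e / 2 <= m.
    apply: ub; split; first lra.
    move=> x hx; have [xm|xm] := Rlt_le_dec x m; first by apply: fm; lra.
    by apply: fk; apply: ge; apply: Rabs_def1; lra.
  lra.
(* Adding periods moves any parameter to the right of [a1]. *)
have fall s : al f s = 0.
  have [n hn] : exists n, a1 < s + INR n * L.
    have [n hn] := INR_unbounded ((a1 - s) / L).
    exists n; have := Rmult_lt_compat_r L _ _ L0 hn.
    have -> : (a1 - s) / L * L = a1 - s by field; lra.
    lra.
  have e := right _ hn; rewrite INR_IZR_INZ in e.
  by rewrite -e /al /along (periodic_mult _ _ XL) (periodic_mult _ _ YL).
have [d [c [c_ev c_C c_dx c_dy c_ne]]] := ev_polyR f.
exists d, c; split; [|split].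
- by apply: c_ne => fz0; move: f1; rewrite fz0 size_poly0.
- move=> z w; rewrite c_C c_dx c_dy => -[h1 [h2 h3]]; exact: (nonsing z w).
have -> : (fun p => polyR d c p = 0) = (fun p => ev f (fst p) (snd p) = 0).
  by apply: functional_extensionality => -[x y]; rewrite c_ev.
apply: (curve_component L0 dX' dY' XL YL) => s; first exact: fall.
have us : u f s <> 0 by apply: (real_nonsing (s - 1) (s + 1)) => //; lra.
have -> : - ev (dX f) (X s) (Y s) * (psi K rho s * t2 s) + ev (dY f) (X s) (Y s) * (psi K rho s * t1 s)
  = psi K rho s * u f s by rewrite /u /nder /along; ring.
by apply: Rmult_integral_contrapositive_currified.
Qed.

End Oval.

(** * Functions with vanishing derivatives of high order *)

Definition Dx (f : R -> R -> R) : R -> R -> R := fun x y => Derive (fun t => f t y) x.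
Definition Dy (f : R -> R -> R) : R -> R -> R := fun x y => Derive (fun t => f x t) y.

Definition diff1 (f : R -> R -> R) : Prop := forall x y,
  ex_derive (fun t => f t y) x /\ ex_derive (fun t => f x t) y /\ continuity_2d_pt f x y.

(** [partial_iter] has the outermost derivative at the head of its list; this recursion peels off
    the innermost one instead, which lets the product rule go by induction. *)
Fixpoint smn (n : nat) (f : R -> R -> R) : Prop :=
  diff1 f /\ match n with O => True | S m => smn m (Dx f) /\ smn m (Dy f) end.

Definition sm (f : R -> R -> R) : Prop := forall n, smn n f.

Lemma fun2_ext (f g : R -> R -> R) : (forall x y, f x y = g x y) -> f = g.
Proof.
by move=> h; apply: functional_extensionality => x; apply: functional_extensionality.
Qed.

Lemma smn_diff1 n f : smn n f -> diff1 f.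
Proof. by case: n => [|n] []. Qed.

Lemma smn_le n f : smn n.+1 f -> smn n f.
Proof.
elim: n f => [|n IH] f [d [hx hy]]; first by split.
by split=> //; split; apply: IH.
Qed.

Lemma sm_diff1 f : sm f -> diff1 f.
Proof. by move=> h; exact: smn_diff1 (h 0%N). Qed.

Lemma sm_Dx f : sm f -> sm (Dx f).
Proof. by move=> h n; have [_ []] := h n.+1. Qed.

Lemma sm_Dy f : sm f -> sm (Dy f).
Proof. by move=> h n; have [_ []] := h n.+1. Qed.

Lemma Dx_lin a b f g : diff1 f -> diff1 g ->
  Dx (fun x y => a * f x y + b * g x y) = fun x y => a * Dx f x y + b * Dx g x y.
Proof.
move=> hf hg; apply: fun2_ext => x y; rewrite /Dx Derive_plus ?Derive_scal //.
  by apply: ex_derive_scal; exact: (hf x y).1.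
by apply: ex_derive_scal; exact: (hg x y).1.
Qed.

Lemma Dy_lin a b f g : diff1 f -> diff1 g ->
  Dy (fun x y => a * f x y + b * g x y) = fun x y => a * Dy f x y + b * Dy g x y.
Proof.
move=> hf hg; apply: fun2_ext => x y; rewrite /Dy Derive_plus ?Derive_scal //.
  by apply: ex_derive_scal; exact: (hf x y).2.1.
by apply: ex_derive_scal; exact: (hg x y).2.1.
Qed.

Lemma diff1_lin a b f g : diff1 f -> diff1 g -> diff1 (fun x y => a * f x y + b * g x y).
Proof.
move=> df dg x y; have [f1 [f2 f3]] := df x y; have [g1 [g2 g3]] := dg x y.
split; [|split].
- apply: (@ex_derive_plus _ _ (fun t => a * f t y) (fun t => b * g t y)); exact: ex_derive_scal.
- apply: (@ex_derive_plus _ _ (fun t => a * f x t) (fun t => b * g x t)); exact: ex_derive_scal.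
- apply: continuity_2d_pt_plus; apply: continuity_2d_pt_mult => //; exact: continuity_2d_pt_const.
Qed.

Lemma smn_lin n a b f g : smn n f -> smn n g -> smn n (fun x y => a * f x y + b * g x y).
Proof.
elim: n f g => [|n IH] f g hf hg; have df := smn_diff1 hf; have dg := smn_diff1 hg.
  by split=> //; exact: diff1_lin.
split; first exact: diff1_lin.
case: hf => _ [fx fy]; case: hg => _ [gx gy].
by rewrite Dx_lin // Dy_lin //; split; apply: IH.
Qed.

Lemma sm_lin a b f g : sm f -> sm g -> sm (fun x y => a * f x y + b * g x y).
Proof. by move=> hf hg n; exact: smn_lin. Qed.

Lemma diff1_mul f g : diff1 f -> diff1 g -> diff1 (fun x y => f x y * g x y).
Proof.
move=> df dg x y; have [f1 [f2 f3]] := df x y; have [g1 [g2 g3]] := dg x y.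
split; [|split].
- exact: ex_derive_mult f1 g1.
- exact: ex_derive_mult f2 g2.
- exact: continuity_2d_pt_mult.
Qed.

Lemma Dx_mul f g : diff1 f -> diff1 g ->
  Dx (fun x y => f x y * g x y) = fun x y => 1 * (Dx f x y * g x y) + 1 * (f x y * Dx g x y).
Proof.
move=> df dg; apply: fun2_ext => x y; rewrite /Dx Derive_mult.
- ring.
- exact: (df x y).1.
- exact: (dg x y).1.
Qed.

Lemma Dy_mul f g : diff1 f -> diff1 g ->
  Dy (fun x y => f x y * g x y) = fun x y => 1 * (Dy f x y * g x y) + 1 * (f x y * Dy g x y).
Proof.
move=> df dg; apply: fun2_ext => x y; rewrite /Dy (Derive_mult (fun t => f x t) (fun t => g x t)).
- ring.
- exact: (df x y).2.1.
- exact: (dg x y).2.1.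
Qed.

Lemma smn_mul n f g : smn n f -> smn n g -> smn n (fun x y => f x y * g x y).
Proof.
elim: n f g => [|n IH] f g hf hg; have df := smn_diff1 hf; have dg := smn_diff1 hg.
  by split=> //; exact: diff1_mul.
split; first exact: diff1_mul.
have hf' := smn_le hf; have hg' := smn_le hg.
case: hf => _ [fx fy]; case: hg => _ [gx gy].
by rewrite Dx_mul // Dy_mul //; split; apply: smn_lin; apply: IH.
Qed.

Lemma sm_mul f g : sm f -> sm g -> sm (fun x y => f x y * g x y).
Proof. by move=> hf hg n; exact: smn_mul. Qed.

Lemma sm_const c : sm (fun _ _ => c).
Proof.
move=> n; elim: n c => [|n IH] c.
  split=> // x y; split; [exact: ex_derive_const|split; [exact: ex_derive_const|]].
  exact: continuity_2d_pt_const.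
split; first exact: smn_diff1 (IH c).
have -> : Dx (fun _ _ => c) = fun _ _ => 0 by apply: fun2_ext => x y; exact: Derive_const.
have -> : Dy (fun _ _ => c) = fun _ _ => 0 by apply: fun2_ext => x y; exact: Derive_const.
by split; exact: IH.
Qed.

Lemma Dx_fst : Dx (fun x _ => x) = fun _ _ => 1.
Proof. by apply: fun2_ext => x y; exact: Derive_id. Qed.

Lemma Dy_fst : Dy (fun x _ => x) = fun _ _ => 0.
Proof. by apply: fun2_ext => x y; exact: Derive_const. Qed.

Lemma Dx_snd : Dx (fun _ y => y) = fun _ _ => 0.
Proof. by apply: fun2_ext => x y; exact: Derive_const. Qed.

Lemma Dy_snd : Dy (fun _ y => y) = fun _ _ => 1.
Proof. by apply: fun2_ext => x y; exact: Derive_id. Qed.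

Lemma sm_fst : sm (fun x _ => x).
Proof.
have d : diff1 (fun x _ => x).
  move=> x y; split; [exact: ex_derive_id|split; [exact: ex_derive_const|]].
  exact: continuity_2d_pt_id1.
by case=> [|n]; split=> //; rewrite Dx_fst Dy_fst; split; exact: sm_const.
Qed.

Lemma sm_snd : sm (fun _ y => y).
Proof.
have d : diff1 (fun _ y => y).
  move=> x y; split; [exact: ex_derive_const|split; [exact: ex_derive_id|]].
  exact: continuity_2d_pt_id2.
by case=> [|n]; split=> //; rewrite Dx_snd Dy_snd; split; exact: sm_const.
Qed.

Lemma smooth2_sm f : smooth2 f -> sm f.
Proof.
have shift l b g : partial_iter (l ++ [:: b]) g = partial_iter l (partial_iter [:: b] g).
  by elim: l => //= c l ->.
move=> h n; elim: n f h => [|n IH] f h.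
  by split=> // x y; exact: (h nil).
split; first by move=> x y; exact: (h nil).
split; apply: IH => l x y.
  by have := h (l ++ [:: true]) x y; rewrite shift.
by have := h (l ++ [:: false]) x y; rewrite shift.
Qed.

Lemma DxDy f : sm f -> Dx (Dy f) = Dy (Dx f).
Proof.
move=> hf; apply: fun2_ext => x y; rewrite /Dx /Dy; apply: Schwarz.
- exists (mkposreal 1 Rlt_0_1) => u v _ _.
  have h0 := sm_diff1 hf u v; have h1 := sm_diff1 (sm_Dx hf) u v.
  have h2 := sm_diff1 (sm_Dy hf) u v.
  by split; [exact: h0.1|split; [exact: h0.2.1|split; [exact: h2.1|exact: h1.2.1]]].
- exact: (sm_diff1 (sm_Dx (sm_Dy hf)) x y).2.2.
- exact: (sm_diff1 (sm_Dy (sm_Dx hf)) x y).2.2.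
Qed.

Lemma chain_rule f (X Y : R -> R) t x' y' : sm f ->
  is_derive X t x' -> is_derive Y t y' ->
  is_derive (fun t => f (X t) (Y t)) t (Dx f (X t) (Y t) * x' + Dy f (X t) (Y t) * y').
Proof.
move=> hf hX hY; apply/is_derive_Reals.
apply: derivable_pt_lim_comp_2d; try exact/is_derive_Reals.
apply/filterdiff_differentiable_pt_lim; apply: is_derive_filterdiff.
- by apply: filter_forall => -[u v] /=; apply: Derive_correct; exact: (sm_diff1 hf u v).1.
- by apply: Derive_correct; exact: (sm_diff1 hf (X t) (Y t)).2.1.
- apply/continuity_2d_pt_filterlim; exact: (sm_diff1 (sm_Dx hf) (X t) (Y t)).2.2.
Qed.

Section PolynomialOn.
Variable U : R -> R -> Prop.
Hypothesis U_open : forall x y, U x y -> exists e, 0 < e /\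
  forall x' y', Rabs (x' - x) < e -> Rabs (y' - y) < e -> U x' y'.
Hypothesis U_connected : forall f, sm f ->
  (forall x y, U x y -> Dx f x y = 0 /\ Dy f x y = 0) ->
  exists c, forall x y, U x y -> f x y = c.

Definition zeroU (f : R -> R -> R) : Prop := forall x y, U x y -> f x y = 0.

Lemma zeroU_Dx f : zeroU f -> zeroU (Dx f).
Proof.
move=> f0 x y Uxy; have [e [e0 he]] := U_open Uxy.
rewrite /Dx -[RHS](Derive_const 0 x); apply: Derive_ext_loc.
exists (mkposreal _ e0) => t /ball_R /= ht; apply: f0; apply: he => //.
by rewrite Rminus_diag Rabs_R0.
Qed.

Lemma zeroU_Dy f : zeroU f -> zeroU (Dy f).
Proof.
move=> f0 x y Uxy; have [e [e0 he]] := U_open Uxy.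
rewrite /Dy -[RHS](Derive_const 0 y); apply: Derive_ext_loc.
exists (mkposreal _ e0) => t /ball_R /= ht; apply: f0; apply: he => //.
by rewrite Rminus_diag Rabs_R0.
Qed.

(* All partial derivatives of order [M + 1] vanish on [U]. *)
Fixpoint degU (M : nat) (f : R -> R -> R) : Prop :=
  match M with
  | O => zeroU (Dx f) /\ zeroU (Dy f)
  | S M' => degU M' (Dx f) /\ degU M' (Dy f)
  end.

Lemma zeroU_lin a b f g : zeroU f -> zeroU g -> zeroU (fun x y => a * f x y + b * g x y).
Proof. by move=> hf hg x y Uxy; rewrite hf // hg //; ring. Qed.

Lemma degU_lin M a b f g : sm f -> sm g -> degU M f -> degU M g ->
  degU M (fun x y => a * f x y + b * g x y).
Proof.
elim: M f g => [|M IH] f g hf hg [f1 f2] [g1 g2];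
  have df := sm_diff1 hf; have dg := sm_diff1 hg; rewrite /= Dx_lin // Dy_lin //.
  by split; apply: zeroU_lin.
by split; apply: IH => //; [exact: sm_Dx|exact: sm_Dx|exact: sm_Dy|exact: sm_Dy].
Qed.

(* Euler's identity: this annihilates the homogeneous part of degree [M]. *)
Definition euler (M : nat) (f : R -> R -> R) : R -> R -> R :=
  fun x y => 1 * (INR M * f x y + -1 * (x * Dx f x y)) + -1 * (y * Dy f x y).

Lemma sm_euler M f : sm f -> sm (euler M f).
Proof.
move=> hf; apply: (@sm_lin _ _ (fun x y => INR M * f x y + -1 * (x * Dx f x y)) _).
  apply: (@sm_lin _ _ _ (fun x y => x * Dx f x y)) => //.
  by apply: (@sm_mul (fun x _ => x) _); [exact: sm_fst|exact: sm_Dx].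
by apply: (@sm_mul (fun _ y => y) _); [exact: sm_snd|exact: sm_Dy].
Qed.

Lemma D_euler M f : sm f ->
  Dx (euler M.+1 f) = euler M (Dx f) /\ Dy (euler M.+1 f) = euler M (Dy f).
Proof.
move=> hf; have d := sm_diff1 hf.
have s1 : sm (fun x y => x * Dx f x y).
  by apply: (@sm_mul (fun x _ => x) _); [exact: sm_fst|exact: sm_Dx].
have s2 : sm (fun x y => y * Dy f x y).
  by apply: (@sm_mul (fun _ y => y) _); [exact: sm_snd|exact: sm_Dy].
have s3 : sm (fun x y => INR M.+1 * f x y + -1 * (x * Dx f x y)).
  by apply: (@sm_lin _ _ _ (fun x y => x * Dx f x y)).
have dx := sm_diff1 (sm_Dx hf); have dy := sm_diff1 (sm_Dy hf).
have d1 := sm_diff1 sm_fst; have d2 := sm_diff1 sm_snd.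
rewrite /euler (Dx_lin 1 (-1) (sm_diff1 s3) (sm_diff1 s2)) (Dy_lin 1 (-1) (sm_diff1 s3) (sm_diff1 s2)).
rewrite (Dx_lin (INR M.+1) (-1) d (sm_diff1 s1)) (Dy_lin (INR M.+1) (-1) d (sm_diff1 s1)).
rewrite (Dx_mul d1 dx) (Dy_mul d1 dx) (Dx_mul d2 dy) (Dy_mul d2 dy).
rewrite Dx_fst Dy_fst Dx_snd Dy_snd !S_INR (DxDy hf).
by split; apply: fun2_ext => x y; ring.
Qed.

Lemma degU_euler M f : sm f -> degU M.+1 f -> degU M (euler M.+1 f).
Proof.
elim: M f => [|M IH] f hf [h1 h2].
  have [e1 e2] := @D_euler 0%N f hf; rewrite /= e1 e2.
  move: h1 h2 => /= [a1 a2] [b1 b2]; split=> x y Uxy; rewrite /euler /=.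
    by rewrite a1 // a2 //; ring.
  by rewrite b1 // b2 //; ring.
have [e1 e2] := @D_euler M.+1 f hf.
by split; rewrite ?e1 ?e2; apply: IH => //; [exact: sm_Dx|exact: sm_Dy].
Qed.

Definition polyU (f : R -> R -> R) : Prop := exists p, forall x y, U x y -> f x y = ev p x y.

(** Euler's identity recovers [f] from [euler M.+1 f], [Dx f] and [Dy f], all polynomial by
    induction. This avoids a path integral, whose dependence on the path would be an issue on an
    annulus. *)
Lemma polyU_of_degU M f : sm f -> degU M f -> polyU f.
Proof.
elim: M f => [|M IH] f hf h.
  have [c hc] := U_connected hf (fun x y Uxy => conj (h.1 x y Uxy) (h.2 x y Uxy)).
  by exists (cst c) => x y Uxy; rewrite ev_cst hc.
have [p1 e1] := IH _ (sm_Dx hf) h.1; have [p2 e2] := IH _ (sm_Dy hf) h.2.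
have [p3 e3] := IH _ (sm_euler M.+1 hf) (degU_euler hf h).
exists (cst (/ INR M.+1) * (p3 + 'X%:P * p1 + 'X * p2))%Ring => x y Uxy.
rewrite !evE -e1 // -e2 // -e3 // /euler.
by field; apply: not_0_INR.
Qed.

(* Pairs of real functions stand for complex-valued functions [u + i v];
   [dz] and [dzb] are twice the Wirtinger derivatives. *)
Definition cfun := ((R -> R -> R) * (R -> R -> R))%type.

(** The coefficients 1, 0 and -1 are spelled out so that the operations have the form
    [a * f + b * g] of [Dx_lin], [sm_lin] and [degU_lin]. *)
Definition cadd (f g : cfun) : cfun :=
  ((fun x y => 1 * f.1 x y + 1 * g.1 x y), (fun x y => 1 * f.2 x y + 1 * g.2 x y)).

Definition cscal (a : R) (f : cfun) : cfun :=
  ((fun x y => a * f.1 x y + 0 * f.1 x y), (fun x y => a * f.2 x y + 0 * f.2 x y)).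

Definition cmuli (f : cfun) : cfun := ((fun x y => -1 * f.2 x y + 0 * f.2 x y), f.1).

Definition dz (f : cfun) : cfun :=
  ((fun x y => 1 * Dx f.1 x y + 1 * Dy f.2 x y), (fun x y => 1 * Dx f.2 x y + -1 * Dy f.1 x y)).

Definition dzb (f : cfun) : cfun :=
  ((fun x y => 1 * Dx f.1 x y + -1 * Dy f.2 x y), (fun x y => 1 * Dx f.2 x y + 1 * Dy f.1 x y)).

Definition csm (f : cfun) : Prop := sm f.1 /\ sm f.2.

Definition czero (f : cfun) : Prop := zeroU f.1 /\ zeroU f.2.

Lemma csm_add f g : csm f -> csm g -> csm (cadd f g).
Proof. by move=> [? ?] [? ?]; split; apply: sm_lin. Qed.

Lemma csm_scal a f : csm f -> csm (cscal a f).
Proof. by move=> [? ?]; split; apply: sm_lin. Qed.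

Lemma csm_muli f : csm f -> csm (cmuli f).
Proof. by move=> [? ?]; split=> //; apply: sm_lin. Qed.

Lemma csm_dz f : csm f -> csm (dz f).
Proof. by move=> [? ?]; split; apply: sm_lin; (exact: sm_Dx || exact: sm_Dy). Qed.

Lemma csm_dzb f : csm f -> csm (dzb f).
Proof. by move=> [? ?]; split; apply: sm_lin; (exact: sm_Dx || exact: sm_Dy). Qed.

Ltac dlin := repeat (rewrite Dx_lin || rewrite Dy_lin); try apply: sm_diff1;
  try by [|apply: sm_Dx|apply: sm_Dy].

Lemma dz_dzb f : csm f -> dz (dzb f) = dzb (dz f).
Proof.
move=> [h1 h2]; rewrite /dz /dzb /=; dlin.
by congr pair; apply: fun2_ext => x y; rewrite ?(DxDy h1) ?(DxDy h2); ring.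
Qed.

Lemma dz_add f g : csm f -> csm g -> dz (cadd f g) = cadd (dz f) (dz g).
Proof.
move=> [h1 h2] [h3 h4]; rewrite /dz /cadd /=; dlin.
by congr pair; apply: fun2_ext => x y; ring.
Qed.

Lemma dzb_add f g : csm f -> csm g -> dzb (cadd f g) = cadd (dzb f) (dzb g).
Proof.
move=> [h1 h2] [h3 h4]; rewrite /dzb /cadd /=; dlin.
by congr pair; apply: fun2_ext => x y; ring.
Qed.

Lemma dz_scal a f : csm f -> dz (cscal a f) = cscal a (dz f).
Proof.
move=> [h1 h2]; rewrite /dz /cscal /=; dlin.
by congr pair; apply: fun2_ext => x y; ring.
Qed.

Lemma dzb_scal a f : csm f -> dzb (cscal a f) = cscal a (dzb f).
Proof.
move=> [h1 h2]; rewrite /dzb /cscal /=; dlin.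
by congr pair; apply: fun2_ext => x y; ring.
Qed.

Lemma dz_muli f : csm f -> dz (cmuli f) = cmuli (dz f).
Proof.
move=> [h1 h2]; rewrite /dz /cmuli /=; dlin.
by congr pair; apply: fun2_ext => x y; ring.
Qed.

Lemma dzb_muli f : csm f -> dzb (cmuli f) = cmuli (dzb f).
Proof.
move=> [h1 h2]; rewrite /dzb /cmuli /=; dlin.
by congr pair; apply: fun2_ext => x y; ring.
Qed.

Fixpoint jetb0 (q : nat) (f : cfun) : Prop :=
  match q with O => czero f | S q' => jetb0 q' (dzb f) end.

Fixpoint jet0 (p q : nat) (f : cfun) : Prop :=
  match p with O => jetb0 q f | S p' => jet0 p' q (dz f) end.

Lemma jet0_dzb p q f : csm f -> jet0 p q.+1 f <-> jet0 p q (dzb f).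
Proof.
elim: p f => [|p IH] f hf //.
rewrite -[jet0 p.+1 q.+1 f]/(jet0 p q.+1 (dz f)) -[jet0 p.+1 q (dzb f)]/(jet0 p q (dz (dzb f))).
by rewrite dz_dzb //; apply: IH; exact: csm_dz.
Qed.

Lemma jet0_czero p q f : csm f -> czero f -> jet0 p q f.
Proof.
elim: p f => [|p IH] f hf f0; last first.
  apply: IH; first exact: csm_dz.
  by case: f0 => a b; split; apply: zeroU_lin; (exact: zeroU_Dx || exact: zeroU_Dy).
elim: q f hf f0 => [|q IH] f hf f0 //; apply: IH; first exact: csm_dzb.
by case: f0 => a b; split; apply: zeroU_lin; (exact: zeroU_Dx || exact: zeroU_Dy).
Qed.

Lemma jet0_add p q f g : csm f -> csm g -> jet0 p q f -> jet0 p q g -> jet0 p q (cadd f g).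
Proof.
elim: p f g => [|p IH] f g hf hg; last first.
  by move=> /= f0 g0; rewrite dz_add //; apply: IH => //; exact: csm_dz.
elim: q f g hf hg => [|q IH] f g hf hg.
  by move=> [a b] [c d]; split; apply: zeroU_lin.
by move=> /= f0 g0; rewrite dzb_add //; apply: IH => //; exact: csm_dzb.
Qed.

Lemma jet0_scal p q a f : csm f -> jet0 p q f -> jet0 p q (cscal a f).
Proof.
elim: p f => [|p IH] f hf; last first.
  by move=> /= f0; rewrite dz_scal //; apply: IH => //; exact: csm_dz.
elim: q f hf => [|q IH] f hf.
  by move=> [b c]; split; apply: zeroU_lin.
by move=> /= f0; rewrite dzb_scal //; apply: IH => //; exact: csm_dzb.
Qed.

Lemma jet0_muli p q f : csm f -> jet0 p q f -> jet0 p q (cmuli f).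
Proof.
elim: p f => [|p IH] f hf; last first.
  by move=> /= f0; rewrite dz_muli //; apply: IH => //; exact: csm_dz.
elim: q f hf => [|q IH] f hf.
  by move=> [b c]; split=> //; apply: zeroU_lin.
by move=> /= f0; rewrite dzb_muli //; apply: IH => //; exact: csm_dzb.
Qed.

(** [Dx] and [Dy] are combinations of [dz] and [dzb], so the mixed derivatives in [dz] and [dzb] of
    total order [M + 1] control all real partial derivatives of that order. *)
Lemma degU_of_jets M f : csm f -> (forall p q, (p + q)%N = M.+1 -> jet0 p q f) ->
  degU M f.1 /\ degU M f.2.
Proof.
elim: M f => [|M IH] f hf h.
  have [a1 a2] : czero (dz f) by exact: (h 1%N 0%N erefl).
  have [b1 b2] : czero (dzb f) by exact: (h 0%N 1%N erefl).
  split; split=> x y Uxy; have := a1 x y Uxy; have := a2 x y Uxy; have := b1 x y Uxy;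
    have := b2 x y Uxy; rewrite /dz /dzb /=; lra.
have hz := csm_dz hf; have hzb := csm_dzb hf.
have [a1 a2] := IH _ hz (fun p q e => h p.+1 q (f_equal S e)).
have hb p q : (p + q)%N = M.+1 -> jet0 p q (dzb f).
  by move=> e; apply/jet0_dzb => //; apply: h; rewrite addnS e.
have [b1 b2] := IH _ hzb hb.
have e1 : Dx f.1 = fun x y => / 2 * (dz f).1 x y + / 2 * (dzb f).1 x y.
  by apply: fun2_ext => x y; rewrite /dz /dzb /=; field.
have e2 : Dy f.1 = fun x y => (- / 2) * (dz f).2 x y + / 2 * (dzb f).2 x y.
  by apply: fun2_ext => x y; rewrite /dz /dzb /=; field.
have e3 : Dx f.2 = fun x y => / 2 * (dz f).2 x y + / 2 * (dzb f).2 x y.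
  by apply: fun2_ext => x y; rewrite /dz /dzb /=; field.
have e4 : Dy f.2 = fun x y => / 2 * (dz f).1 x y + (- / 2) * (dzb f).1 x y.
  by apply: fun2_ext => x y; rewrite /dz /dzb /=; field.
case: hz => z1 z2; case: hzb => z3 z4.
by rewrite /= e1 e2 e3 e4; split; split; apply: degU_lin.
Qed.

Section Recursion.
Variables (T : nat) (A : nat -> cfun) (w : nat -> R).
Hypothesis A_sm : forall j, csm (A j).
Hypothesis A0 : czero (A 0%N).
Hypothesis A1 : czero (A 1%N).
Hypothesis A_top : forall j, (T < j)%N -> czero (A j).
Hypothesis rec : forall j,
  czero (cadd (cadd (dz (A j)) (dzb (A j.+2))) (cscal (w j) (cmuli (A j.+1)))).

Let E j := cadd (cadd (dz (A j)) (dzb (A j.+2))) (cscal (w j) (cmuli (A j.+1))).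

Lemma csm_E j : csm (E j).
Proof.
apply: csm_add; last by apply: csm_scal; apply: csm_muli.
by apply: csm_add; [apply: csm_dz|apply: csm_dzb].
Qed.

(** By the recursion [dzb (A j.+2)] is a combination of [dz (A j)] and [A j.+1]: each [dzb] lowers
    the index by at least one, and the indices 0 and 1 carry nothing. *)
Lemma jet0_low j p q : (j <= q.+1)%N -> jet0 p q (A j).
Proof.
have [n] := ubnP j; elim: n j p q => // n IH [|[|j]] p q jn jq; try exact: jet0_czero.
case: q jq => [|q] // jq; apply/jet0_dzb => //.
(* The recursion holds on [U] only, so the identity between functions on the plane retains the term
   [E j], whose jets vanish on [U]. *)
have -> : dzb (A j.+2) = cadd (E j) (cscal (-1) (cadd (dz (A j)) (cscal (w j) (cmuli (A j.+1))))).
  by congr pair; apply: fun2_ext => x y; rewrite /E /cadd /cscal /=; ring.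
have c1 : csm (cscal (w j) (cmuli (A j.+1))) by apply: csm_scal; apply: csm_muli.
have c2 := csm_dz (A_sm j).
apply: jet0_add; [exact: csm_E|by apply: csm_scal; apply: csm_add|exact: (jet0_czero _ _ (csm_E j) (rec j))|].
apply: jet0_scal; first exact: csm_add.
apply: jet0_add => //.
  apply: (IH j p.+1 q); first exact: ltn_trans (ltnSn j) jn.
  by rewrite !ltnS in jq; exact: ltnW.
apply: jet0_scal; first exact: csm_muli.
by apply: jet0_muli => //; apply: IH.
Qed.

(** The recursion read upwards: each [dz] raises the index by at least one, until it exceeds [T]. *)
Lemma jet0_high j p q : (T < p + j)%N -> jet0 p q (A j).
Proof.
have [n] := ubnP (T.+1 - j)%N; elim: n j p q => // n IH j p q jn jp.
case: p jp => [|p] jp; first by apply: jet0_czero => //; exact: A_top.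
have [Tj|jT] := ltnP T j; first by apply: jet0_czero => //; exact: A_top.
rewrite -[jet0 _ _ _]/(jet0 p q (dz (A j))).
have -> : dz (A j) = cadd (E j) (cscal (-1) (cadd (dzb (A j.+2)) (cscal (w j) (cmuli (A j.+1))))).
  by congr pair; apply: fun2_ext => x y; rewrite /E /cadd /cscal /=; ring.
have c1 : csm (cscal (w j) (cmuli (A j.+1))) by apply: csm_scal; apply: csm_muli.
have c2 := csm_dzb (A_sm j.+2).
have s1 : (T.+1 - j.+1 < n)%N.
  by rewrite ltnS in jn; apply: leq_trans jn; rewrite ltn_sub2l.
have s2 : (T.+1 - j.+2 < n)%N.
  by apply: leq_ltn_trans s1; rewrite leq_sub2l.
apply: jet0_add; [exact: csm_E|by apply: csm_scal; apply: csm_add|exact: (jet0_czero _ _ (csm_E j) (rec j))|].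
apply: jet0_scal; first exact: csm_add.
apply: jet0_add => //.
  apply/jet0_dzb => //; apply: IH => //; rewrite !addnS; rewrite addSn in jp.
  by apply: ltn_trans jp _.
apply: jet0_scal; first exact: csm_muli.
by apply: jet0_muli => //; apply: IH => //; rewrite addnS -addSn.
Qed.

Lemma recursion_polyU j : polyU (A j).1 /\ polyU (A j).2.
Proof.
have [|d1 d2] := @degU_of_jets T (A j) (A_sm j).
  (* At total order [T + 1] one of the two lemmas always applies: [j > q + 1] implies
     [p + j > T]. *)
  move=> p q pq; have [h|h] := leqP j q.+1; first exact: jet0_low.
  have [h'|h'] := ltnP T (p + j)%N; first exact: jet0_high.
  exfalso; have : (p + q.+1 < p + j)%N by rewrite ltn_add2l.
  by rewrite addnS pq => h2; have := ltn_trans (leqnn _) (leq_trans h2 h'); rewrite ltnNge leqnSn.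
by split; [exact: polyU_of_degU (A_sm j).1 d1|exact: polyU_of_degU (A_sm j).2 d2].
Qed.

End Recursion.
End PolynomialOn.

(** * Tubular neighbourhoods and Larmor circles *)

Definition dist (x y x' y' : R) : R := Cmod (x - x', y - y').

Lemma dist_sq x y x' y' : dist x y x' y' ^ 2 = (x - x') ^ 2 + (y - y') ^ 2.
Proof.
rewrite -[dist _ _ _ _]/(sqrt ((x - x') ^ 2 + (y - y') ^ 2)) pow2_sqrt //.
by have := pow2_ge_0 (x - x'); have := pow2_ge_0 (y - y'); lra.
Qed.

Lemma dist_ge0 x y x' y' : 0 <= dist x y x' y'.
Proof. exact: Cmod_ge_0. Qed.

Lemma dist_tri x' y' x y x'' y'' : dist x y x'' y'' <= dist x y x' y' + dist x' y' x'' y''.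
Proof.
have -> : dist x y x'' y'' = Cmod (Cplus (x - x', y - y') (x' - x'', y' - y'')).
  by rewrite /dist /Cplus /=; congr Cmod; congr pair; ring.
exact: Cmod_triangle.
Qed.

Lemma dist_eq0 x y x' y' : dist x y x' y' = 0 -> x = x' /\ y = y'.
Proof. by move=> /Cmod_eq_0 [h1 h2]; lra. Qed.

Lemma dist_sym x y x' y' : dist x y x' y' = dist x' y' x y.
Proof.
rewrite /dist -Cmod_opp /Copp /=; congr Cmod; congr pair; ring.
Qed.

Lemma dist_small e x y x' y' : Rabs (x' - x) < e / 2 -> Rabs (y' - y) < e / 2 ->
  dist x' y' x y < e.
Proof.
move=> /Rabs_def2 [h1 h2] /Rabs_def2 [h3 h4].
have := dist_ge0 x' y' x y; have := dist_sq x' y' x y => h5 h6.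
apply: Rnot_le_lt => h; nra.
Qed.

Lemma dist_eq_abs x y x' y' a : (x - x') ^ 2 + (y - y') ^ 2 = a ^ 2 ->
  dist x y x' y' = Rabs a.
Proof.
by move=> h; rewrite -[dist _ _ _ _]/(sqrt ((x - x') ^ 2 + (y - y') ^ 2)) h -Rsqr_pow2 sqrt_Rsqr_abs.
Qed.

Lemma unit_angle u v : u ^ 2 + v ^ 2 = 1 -> exists th, cos th = u /\ sin th = v.
Proof.
move=> uv; have hu : -1 <= u <= 1 by nra.
have hs : sin (acos u) = Rabs v.
  by rewrite sin_acos // -sqrt_Rsqr_abs; congr sqrt; rewrite /Rsqr; lra.
have [v0|v0] := Rle_dec 0 v.
  by exists (acos u); rewrite cos_acos // hs Rabs_pos_eq.
exists (- acos u); rewrite cos_neg sin_neg cos_acos // hs Rabs_left; lra.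
Qed.

Lemma angle_shift th th1 : exists th', th' < th1 /\ cos th' = cos th /\ sin th' = sin th.
Proof.
have [n hn] := INR_unbounded ((th - th1) / (2 * PI)).
have pi := PI_RGT_0.
have h := Rmult_lt_compat_r (2 * PI) _ _ ltac:(lra) hn.
have e : (th - th1) / (2 * PI) * (2 * PI) = th - th1 by field; lra.
exists (th - 2 * INR n * PI); split; first by rewrite e in h; lra.
by rewrite -(cos_period (th - _) n) -(sin_period (th - _) n); split; f_equal; ring.
Qed.

Lemma eps_cases eps : eps ^ 2 = 1 -> eps = 1 \/ eps = -1.
Proof.
move=> e; have /Rmult_integral [h|h] : (eps - 1) * (eps + 1) = 0 by lra.
  by left; lra.
by right; lra.
Qed.

Lemma path_near (X Y v1 v2 : R -> R) : (forall s, is_derive X s (v1 s)) ->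
  (forall s, is_derive Y s (v2 s)) -> forall s e, 0 < e -> exists d, 0 < d /\
  forall t, Rabs (t - s) < d -> dist (X t) (Y t) (X s) (Y s) < e.
Proof.
move=> hX hY s e e0; have [d [d0 hd]] := curve_near hX hY s (e := e / 2) ltac:(lra).
by exists d; split=> // t /hd [h1 h2]; exact: dist_small.
Qed.

Section Tube.
Variables (gx gy t1 t2 K : R -> R) (L rho r : R).
Hypothesis hgx : forall s, is_derive gx s (t1 s).
Hypothesis hgy : forall s, is_derive gy s (t2 s).
Hypothesis ht1 : forall s, is_derive t1 s (- K s * t2 s).
Hypothesis ht2 : forall s, is_derive t2 s (K s * t1 s).
Hypothesis unit_t : forall s, t1 s ^ 2 + t2 s ^ 2 = 1.
Hypothesis L0 : 0 < L.
Hypothesis gxL : forall s, gx (s + L) = gx s.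
Hypothesis gyL : forall s, gy (s + L) = gy s.
Hypothesis t1L : forall s, t1 (s + L) = t1 s.
Hypothesis t2L : forall s, t2 (s + L) = t2 s.
Hypothesis r0 : 0 < r.
Hypothesis r_rho : 2 * r < rho.
Local Notation px := (parx gx t2).
Local Notation py := (pary gy t1).
Hypothesis inj : forall s1 s2 a b, 0 <= s1 < L -> 0 <= s2 < L -> Rabs a < rho -> Rabs b < rho ->
  px a s1 = px b s2 -> py a s1 = py b s2 -> s1 = s2 /\ a = b.

Lemma tube_inj s1 s2 a b : Rabs a < rho -> Rabs b < rho ->
  px a s1 = px b s2 -> py a s1 = py b s2 -> a = b.
Proof.
have [s1' [h1 per1]] := periodic_reduce s1 L0; have [s2' [h2 per2]] := periodic_reduce s2 L0.
rewrite /parx /pary (per1 _ gxL) (per1 _ gyL) (per1 _ t1L) (per1 _ t2L).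
rewrite (per2 _ gxL) (per2 _ gyL) (per2 _ t1L) (per2 _ t2L) => ha hb e1 e2.
by have [] := inj h1 h2 ha hb e1 e2.
Qed.

Lemma min_on_curve (X Y : R -> R) x y :
  (forall s, X (s + L) = X s) -> (forall s, Y (s + L) = Y s) ->
  (forall s, ex_derive X s) -> (forall s, ex_derive Y s) ->
  exists s, forall s', (x - X s) ^ 2 + (y - Y s) ^ 2 <= (x - X s') ^ 2 + (y - Y s') ^ 2.
Proof.
move=> XL YL hX hY; pose D s := (x - X s) ^ 2 + (y - Y s) ^ 2.
have cD s : continuity_pt D s.
  apply/continuity_pt_filterlim; apply: ex_derive_continuous; rewrite /D.
  by auto_derive; repeat split; [exact: hX|exact: hY].
have [m [hm _]] := continuity_ab_min D 0 L (Rlt_le _ _ L0) (fun c _ => cD c).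
exists m => s'; have [s [hs per]] := periodic_reduce s' L0.
by rewrite (per _ XL) (per _ YL); apply: (hm s); lra.
Qed.

Lemma dist_par a s : dist (px a s) (py a s) (gx s) (gy s) = Rabs a.
Proof.
apply: dist_eq_abs; rewrite /parx /pary.
have -> : a ^ 2 = a ^ 2 * (t1 s ^ 2 + t2 s ^ 2) by rewrite unit_t; ring.
ring.
Qed.

(** At a nearest point of the curve the squared distance is critical, which puts the given point on
    the normal line there. *)
Lemma foot x y : exists s a, [/\ x = px a s, y = py a s &
  forall s', Rabs a <= dist x y (gx s') (gy s')].
Proof.
have [s hs] := @min_on_curve gx gy x y gxL gyL (fun s => ex_intro _ _ (hgx s))
  (fun s => ex_intro _ _ (hgy s)).
have hD : is_derive (fun s => (x - gx s) ^ 2 + (y - gy s) ^ 2) s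
    (- 2 * ((x - gx s) * t1 s + (y - gy s) * t2 s)).
  have h1 := hgx s; have h2 := hgy s; auto_derive; first by exd.
  by rewrite (is_derive_unique _ _ _ h1) (is_derive_unique _ _ _ h2); ring.
have orth : (x - gx s) * t1 s + (y - gy s) * t2 s = 0.
  have hD' := proj1 (is_derive_Reals _ _ _) hD.
  have := deriv_minimum _ (s - 1) (s + 1) s (exist _ _ hD') ltac:(lra) ltac:(lra)
    (fun s' _ _ => hs s') => /=; lra.
pose a := - (x - gx s) * t2 s + (y - gy s) * t1 s.
have u := unit_t s.
have xE : x = px a s.
  have -> : px a s = gx s + (x - gx s) * (t1 s ^ 2 + t2 s ^ 2)
     - t1 s * ((x - gx s) * t1 s + (y - gy s) * t2 s) by rewrite /parx /a; ring.
  by rewrite orth u; ring.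
have yE : y = py a s.
  have -> : py a s = gy s + (y - gy s) * (t1 s ^ 2 + t2 s ^ 2)
     - t2 s * ((x - gx s) * t1 s + (y - gy s) * t2 s) by rewrite /pary /a; ring.
  by rewrite orth u; ring.
exists s, a; split=> // s'.
rewrite -(dist_par a s) -xE -yE.
have := hs s'; rewrite -!dist_sq => h.
have := dist_ge0 x y (gx s) (gy s); have := dist_ge0 x y (gx s') (gy s') => h1 h2.
by apply: Rnot_lt_le => h3; nra.
Qed.

(** A nearest point gives coordinates [(s1, b)] with [|b| <= |a|]. These lie in the tube as well, so
    injectivity forces [b = a]. *)
Lemma dist_tube a s s' : Rabs a < rho -> Rabs a <= dist (px a s) (py a s) (gx s') (gy s').
Proof.
move=> ha; have [s1 [b [e1 e2 h]]] := foot (px a s) (py a s).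
have hb : Rabs b <= Rabs a by rewrite -(dist_par a s); exact: h.
have ab : b = a by apply: (tube_inj (s1 := s1) (s2 := s)) => //; lra.
by have := h s'; rewrite ab.
Qed.

Definition side (eps x y : R) : Prop :=
  exists s a, [/\ 0 < a < rho, x = px (eps * a) s & y = py (eps * a) s].

Lemma dist_side_lip x y x' y' s a s' b : Rabs a < rho -> Rabs b < rho ->
  x = px a s -> y = py a s -> x' = px b s' -> y' = py b s' ->
  Rabs (Rabs b - Rabs a) <= dist x' y' x y.
Proof.
move=> ha hb ex ey ex' ey'.
have h1 := dist_tube s s' ha; have h2 := dist_tube s' s hb.
rewrite -ex -ey in h1; rewrite -ex' -ey' in h2.
have t1' := dist_tri x y x' y' (gx s) (gy s).
have t2' := dist_tri x' y' x y (gx s') (gy s').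
have e1 : dist x y (gx s) (gy s) = Rabs a by rewrite ex ey dist_par.
have e2 : dist x' y' (gx s') (gy s') = Rabs b by rewrite ex' ey' dist_par.
rewrite (dist_sym x y x' y') in t2'.
by apply: Rabs_le; lra.
Qed.

Lemma dist_par_par a b s : dist (px a s) (py a s) (px b s) (py b s) = Rabs (a - b).
Proof.
apply: dist_eq_abs; rewrite /parx /pary.
have -> : (a - b) ^ 2 = (a - b) ^ 2 * (t1 s ^ 2 + t2 s ^ 2) by rewrite unit_t; ring.
ring.
Qed.

Lemma abs_eps eps a : eps ^ 2 = 1 -> 0 < a -> Rabs (eps * a) = a.
Proof.
by move=> /eps_cases [->|->] a0; [rewrite Rabs_pos_eq|rewrite Rabs_left]; lra.
Qed.

(** A nearby point has an offset of absolute value near [a]. With the wrong sign it would be close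
    to the parallel curve at offset [- eps a], which stays at a positive distance [d] from the given
    point. *)
Lemma side_open eps x y : eps ^ 2 = 1 -> side eps x y -> exists e, 0 < e /\
  forall x' y', dist x' y' x y < e -> side eps x' y'.
Proof.
move=> e1 [s [a [[a0 ar] ex ey]]].
have aa : Rabs (eps * a) = a by exact: abs_eps.
have dpx s' : ex_derive (px (- (eps * a))) s' by eexists; exact: (is_derive_parx _ hgx ht2).
have dpy s' : ex_derive (py (- (eps * a))) s' by eexists; exact: (is_derive_pary _ hgy ht1).
have [m hm] := @min_on_curve (px (- (eps * a))) (py (- (eps * a))) x y
  ltac:(by move=> s'; rewrite /parx gxL t2L) ltac:(by move=> s'; rewrite /pary gyL t1L) dpx dpy.
set d := dist x y (px (- (eps * a)) m) (py (- (eps * a)) m).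
have ne : eps * a <> 0 by move=> z; rewrite z Rabs_R0 in aa; lra.
have d0 : 0 < d.
  have := dist_ge0 x y (px (- (eps * a)) m) (py (- (eps * a)) m); rewrite -/d => -[//|z].
  have [q1 q2] := dist_eq0 (esym z).
  have := @tube_inj s m (eps * a) (- (eps * a)); rewrite -ex -ey -q1 -q2 Rabs_Ropp aa.
  by move=> /(_ ar ar erefl erefl); lra.
have far s' : d <= dist x y (px (- (eps * a)) s') (py (- (eps * a)) s').
  apply: Rnot_lt_le => h; have := hm s'; rewrite -!dist_sq -/d.
  by have := dist_ge0 x y (px (- (eps * a)) s') (py (- (eps * a)) s'); nra.
(* [d / 2] excludes the opposite side; [a] and [rho - a] keep the offset nonzero and inside the
   tube. *)
exists (Rmin (d / 2) (Rmin a (rho - a))); split.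
  by apply: Rmin_glb_lt; [lra|apply: Rmin_glb_lt; lra].
move=> x' y' hd.
have m1 := Rmin_l (d / 2) (Rmin a (rho - a)); have m2 := Rmin_r (d / 2) (Rmin a (rho - a)).
have m3 := Rmin_l a (rho - a); have m4 := Rmin_r a (rho - a).
have [s' [b [ex' ey' hb]]] := foot x' y'.
have br : Rabs b < rho.
  have := hb s; have := dist_tri x y x' y' (gx s) (gy s).
  by rewrite [dist x y _ _](_ : _ = a); [lra|rewrite ex ey dist_par].
have lip := @dist_side_lip x y x' y' s (eps * a) s' b ltac:(lra) br ex ey ex' ey'.
rewrite aa in lip.
have [l1 l2] : - dist x' y' x y <= Rabs b - a <= dist x' y' x y.
  by split; [have := Rle_abs (- (Rabs b - a)); rewrite Rabs_Ropp|have := Rle_abs (Rabs b - a)]; lra.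
have b0 : 0 < Rabs b by lra.
have bE : b = eps * Rabs b \/ b = - (eps * Rabs b).
  have [bp|bn] := Rle_lt_dec 0 b.
    by rewrite Rabs_pos_eq //; case: (eps_cases e1) => ->; lra.
  by rewrite Rabs_left //; case: (eps_cases e1) => ->; lra.
case: bE => bE; first by exists s', (Rabs b); rewrite -bE; split=> //; lra.
exfalso; have := far s'.
have := dist_tri x' y' x y (px (- (eps * a)) s') (py (- (eps * a)) s').
have -> : dist x' y' (px (- (eps * a)) s') (py (- (eps * a)) s') = Rabs (Rabs b - a).
  rewrite ex' ey' dist_par_par.
  have -> : b - - (eps * a) = - eps * (Rabs b - a) by rewrite {1}bE; ring.
  rewrite Rabs_mult.
  by case: (eps_cases e1) => ->; rewrite ?Ropp_involutive ?Rabs_R1 ?Rabs_Ropp ?Rabs_R1; lra.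
rewrite (dist_sym x y x' y'); lra.
Qed.

Lemma side_disjoint x y : side 1 x y -> side (-1) x y -> False.
Proof.
move=> [s [a [ar ex ey]]] [s' [b [br ex' ey']]].
have : 1 * a = -1 * b.
  apply: (tube_inj (s1 := s) (s2 := s')); rewrite -?ex -?ey //.
    by rewrite Rabs_pos_eq; lra.
  by rewrite Rabs_left; lra.
lra.
Qed.

Lemma side_not_on_curve eps x y s : eps ^ 2 = 1 -> side eps x y -> x = gx s -> y = gy s -> False.
Proof.
move=> e1 [s' [a [[a0 ar] ex ey]]] xs ys.
have aa := abs_eps e1 a0.
have := @dist_tube (eps * a) s' s ltac:(lra).
rewrite -ex -ey xs ys /dist !Rminus_diag -[(0, 0)]/(RtoC 0) Cmod_0; lra.
Qed.

Lemma tube_cases x y s : dist x y (gx s) (gy s) < rho ->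
  [\/ side 1 x y, side (-1) x y | exists s, x = gx s /\ y = gy s].
Proof.
move=> h; have [s' [a [ex ey ha]]] := foot x y; have ha' := ha s.
have [a0|[a0|a0]] := Rtotal_order a 0.
- apply: Or32; exists s', (- a); rewrite Rabs_left // in ha'.
  have -> : -1 * - a = a by ring.
  by split=> //; lra.
- apply: Or33; exists s'; rewrite ex ey a0 /parx /pary; lra.
- apply: Or31; exists s', a; rewrite Rabs_pos_eq in ha'; last lra.
  by rewrite Rmult_1_l; split=> //; lra.
Qed.


Section Larmor.
Variables (cx cy : R).

(** The parameter is the direction angle of the velocity [(cos th, sin th)], so the center is the
    position plus [r] times the rotated velocity. *)
Definition larx (th : R) : R := cx + r * sin th.
Definition lary (th : R) : R := cy - r * cos th.

Lemma is_derive_larx th : is_derive larx th (r * cos th).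
Proof. by rewrite /larx; auto_derive => //; ring. Qed.

Lemma is_derive_lary th : is_derive lary th (r * sin th).
Proof. by rewrite /lary; auto_derive => //; ring. Qed.

Lemma dist_center th : dist (larx th) (lary th) cx cy = r.
Proof.
rewrite -[RHS]Rabs_pos_eq; last lra.
apply: dist_eq_abs; rewrite /larx /lary.
have := sin2_cos2 th; rewrite /Rsqr => h.
have -> : r ^ 2 = r ^ 2 * (sin th * sin th + cos th * cos th) by rewrite h; ring.
ring.
Qed.

(* The arc cannot enter the inside against the normal: the segment from [par (- r) s0] to a point of
   the arc would stay in a ball that misses the curve.  Tangency is excluded by [hc], since the
   center would lie on a parallel curve at distance [r]. *)
Lemma first_hit s1 th1 : dist cx cy (gx s1) (gy s1) < r -> side 1 (larx th1) (lary th1) ->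
  exists th0 s0, [/\ th0 < th1, larx th0 = gx s0, lary th0 = gy s0,
    0 < - t2 s0 * cos th0 + t1 s0 * sin th0 &
    forall th, th0 < th <= th1 -> side 1 (larx th) (lary th)].
Proof.
move=> hc in1.
have near := path_near is_derive_larx is_derive_lary.
have tube th : dist (larx th) (lary th) (gx s1) (gy s1) < 2 * r.
  by have := dist_tri cx cy (larx th) (lary th) (gx s1) (gy s1); rewrite dist_center; lra.
(* If the center has offset [a], moving by [r] against the normal reaches offset [a - r], between
   [- 2 r] and 0. Full turns place this angle before [th1]. *)
have [thm [thm1 outm]] : exists th, th < th1 /\ side (-1) (larx th) (lary th).
  have [s [a [ex ey ha]]] := foot cx cy.
  have ar : Rabs a < r by have := ha s1; lra.
  have [a1 a2] := Rabs_def2 _ _ ar.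
  have [th [e1 e2]] := unit_angle (unit_t s).
  have [th' [lt' [e3 e4]]] := angle_shift th th1.
  exists th'; split=> //; exists s, (r - a); split; first lra.
    by rewrite /larx e4 e2 ex /parx; ring.
  by rewrite /lary e3 e1 ey /pary; ring.
(* The supremum [th0] of this set is the last parameter at which the arc is not inside; openness of
   both sides puts it on the curve. *)
pose E th := thm <= th <= th1 /\ ~ side 1 (larx th) (lary th).
have Em : E thm by split; [lra|move=> h; exact: side_disjoint h outm].
have bE : bound E by exists th1 => th [[]].
have [th0 [ub lub]] := completeness E bE (ex_intro _ thm Em).
have m0 : thm <= th0 by apply: ub.
have h01 : th0 <= th1 by apply: lub => th [[]].
have on th : th0 < th <= th1 -> side 1 (larx th) (lary th).
  move=> h; apply: NNPP => no; have : th <= th0 by apply: ub; split=> //; lra.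
  lra.
have no0 : ~ side 1 (larx th0) (lary th0).
  move=> in0; have [e [e0 he]] := side_open (pow1 2) in0.
  have [d [d0 hd]] := near th0 e e0.
  suff : th0 <= th0 - d by lra.
  apply: lub => th [hth no]; apply: Rnot_lt_le => lt.
  have le : th <= th0 by apply: ub.
  by apply: no; apply: he; apply: hd; apply: Rabs_def1; lra.
have lt01 : th0 < th1 by case: h01 => // e; case: no0; rewrite e.
have after e : 0 < e -> exists th, th0 < th < th0 + e /\ th <= th1.
  move=> e0; exists (Rmin th1 (th0 + e / 2)).
  have := Rmin_l th1 (th0 + e / 2); have := Rmin_r th1 (th0 + e / 2).
  have : th0 < Rmin th1 (th0 + e / 2) by apply: Rmin_glb_lt; lra.
  lra.
have ne0 : ~ side (-1) (larx th0) (lary th0).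
  move=> out; have [e [e0 he]] := side_open (eps := -1) ltac:(ring) out.
  have [d [d0 hd]] := near th0 e e0; have [th [h1 h2]] := after d d0.
  apply: (side_disjoint (on th _)); first lra.
  by apply: he; apply: hd; apply: Rabs_def1; lra.
have [s0 [ex ey]] : exists s, larx th0 = gx s /\ lary th0 = gy s.
  by case: (@tube_cases (larx th0) (lary th0) s1 _) => //; have := tube th0; lra.
exists th0, s0; split=> //.
have sc := sin2_cos2 th0; rewrite /Rsqr in sc; have us := unit_t s0.
apply: Rnot_le_lt => -[neg|zero]; last first.
  pose sg := t1 s0 * cos th0 + t2 s0 * sin th0.
  have sg1 : sg ^ 2 = 1.
    have -> : sg ^ 2 = (t1 s0 ^ 2 + t2 s0 ^ 2) * (sin th0 * sin th0 + cos th0 * cos th0)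
       - (- t2 s0 * cos th0 + t1 s0 * sin th0) ^ 2 by rewrite /sg; ring.
    by rewrite zero us sc; ring.
  have cE : cos th0 = sg * t1 s0.
    have -> : sg * t1 s0 = cos th0 * (t1 s0 ^ 2 + t2 s0 ^ 2)
      + t2 s0 * (- t2 s0 * cos th0 + t1 s0 * sin th0) by rewrite /sg; ring.
    by rewrite zero us; ring.
  have sE : sin th0 = sg * t2 s0.
    have -> : sg * t2 s0 = sin th0 * (t1 s0 ^ 2 + t2 s0 ^ 2)
      - t1 s0 * (- t2 s0 * cos th0 + t1 s0 * sin th0) by rewrite /sg; ring.
    by rewrite zero us; ring.
  have cxE : cx = px (sg * r) s0 by move: ex; rewrite /larx /parx sE => <-; ring.
  have cyE : cy = py (sg * r) s0 by move: ey; rewrite /lary /pary cE => <-; ring.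
  have := @dist_tube (sg * r) s0 s1; rewrite (abs_eps sg1 r0) -cxE -cyE => h.
  by have := h ltac:(lra); lra.
(* This is the center of a ball of radius [r] that touches the curve at the hit point. The sign of
   the derivative of [h] puts the arc inside the ball just after [th0]. *)
pose zx := px (- r) s0; pose zy := py (- r) s0.
pose h th := (larx th - zx) ^ 2 + (lary th - zy) ^ 2.
have h0 : h th0 = r ^ 2.
  rewrite /h /zx /zy ex ey /parx /pary.
  have -> : r ^ 2 = r ^ 2 * (t1 s0 ^ 2 + t2 s0 ^ 2) by rewrite us; ring.
  ring.
have hd : is_derive h th0 (2 * r ^ 2 * (- t2 s0 * cos th0 + t1 s0 * sin th0)).
  have d1 := is_derive_larx th0; have d2 := is_derive_lary th0.
  rewrite /h; auto_derive; first by exd.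
  rewrite (is_derive_unique _ _ _ d1) (is_derive_unique _ _ _ d2) ex ey /zx /zy /parx /pary; ring.
set l := 2 * r ^ 2 * _ in hd.
have r2 : 0 < 2 * r ^ 2 by nra.
have lneg : l < 0 by have := Rmult_lt_compat_l _ _ _ r2 neg; rewrite Rmult_0_r.
have [d hd'] := (proj1 (is_derive_Reals _ _ _) hd) (- l / 2) ltac:(lra).
have [th [[ha hb] hc']] := after d (cond_pos d).
have hth : h th < r ^ 2.
  have := hd' (th - th0) ltac:(lra) ltac:(rewrite Rabs_pos_eq; lra).
  have -> : th0 + (th - th0) = th by ring.
  rewrite h0 => /Rabs_def2 [b1 b2].
  have -> : h th = r ^ 2 + (h th - r ^ 2) / (th - th0) * (th - th0) by field; lra.
  set q := (h th - r ^ 2) / (th - th0) in b1 *; nra.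
have dth : dist (larx th) (lary th) zx zy < r.
  by have := dist_sq (larx th) (lary th) zx zy; rewrite -/(h th) => e;
    have := dist_ge0 (larx th) (lary th) zx zy; nra.
(* [sin t ^ 2] covers the segment while [t] ranges over the whole line, as [locally_constant_const]
   requires; the ends are [t = 0] and [t = PI / 2]. *)
pose wx t := zx + sin t ^ 2 * (larx th - zx); pose wy t := zy + sin t ^ 2 * (lary th - zy).
have dwx t : is_derive wx t (2 * sin t * cos t * (larx th - zx)).
  by rewrite /wx; auto_derive => //; ring.
have dwy t : is_derive wy t (2 * sin t * cos t * (lary th - zy)).
  by rewrite /wy; auto_derive => //; ring.
have wz t : dist (wx t) (wy t) zx zy < r.
  apply: Rle_lt_trans dth.
  have := dist_ge0 (wx t) (wy t) zx zy; have := dist_ge0 (larx th) (lary th) zx zy.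
  have := dist_sq (wx t) (wy t) zx zy; have := dist_sq (larx th) (lary th) zx zy.
  set A := dist _ _ _ _; set B := dist _ _ _ _ => eA eB A0 B0.
  have eB' : B ^ 2 = (sin t ^ 2) ^ 2 * A ^ 2 by rewrite eB eA /wx /wy; ring.
  have s01 : 0 <= sin t ^ 2 <= 1 by have := sin2_cos2 t; rewrite /Rsqr; nra.
  have -> : B = sin t ^ 2 * A; last by nra.
  have e0 : (B - sin t ^ 2 * A) * (B + sin t ^ 2 * A) = 0 by lra.
  have q0 : 0 <= sin t ^ 2 * A by nra.
  by case/Rmult_integral: e0; lra.
have far s' : r <= dist zx zy (gx s') (gy s').
  by have := @dist_tube (- r) s0 s'; rewrite Rabs_Ropp Rabs_pos_eq => [h'|]; [apply: h'|]; lra.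
have wcases t : side 1 (wx t) (wy t) \/ side (-1) (wx t) (wy t).
  have w1 : dist (wx t) (wy t) (gx s0) (gy s0) < rho.
    have := dist_tri zx zy (wx t) (wy t) (gx s0) (gy s0).
    by rewrite dist_par Rabs_Ropp Rabs_pos_eq; have := wz t; lra.
  case: (tube_cases w1) => [|| [s [e1 e2]]]; [by left|by right|].
  have := far s; have := wz t; rewrite e1 e2 dist_sym; lra.
have wnear := path_near dwx dwy.
have key := @locally_constant_const (fun t => side (-1) (wx t) (wy t)) 0.
apply: (@side_disjoint (larx th) (lary th)); first by apply: on; lra.
have -> : larx th = wx (PI / 2) by rewrite /wx sin_PI2; ring.
have -> : lary th = wy (PI / 2) by rewrite /wy sin_PI2; ring.
apply: key; last first.
  exists s0, r; split; first lra.
    by rewrite /wx sin_0 /zx; rewrite -Ropp_mult_distr_l Rmult_1_l; ring.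
  by rewrite /wy sin_0 /zy; rewrite -Ropp_mult_distr_l Rmult_1_l; ring.
move=> t; case: (wcases t) => wt.
  have [e [e0 he]] := side_open (pow1 2) wt; have [d' [d0 hd0]] := wnear t e e0.
  exists d'; split=> // t' /hd0 /he h1; split=> h2; exfalso; first exact: side_disjoint h1 h2.
  exact: side_disjoint wt h2.
have [e [e0 he]] := side_open (eps := -1) ltac:(ring) wt; have [d' [d0 hd0]] := wnear t e e0.
by exists d'; split=> // t' /hd0 /he h1.
Qed.

End Larmor.

(** Open, unlike [Omega_plus], so that identities on it can be differentiated; the boundary is
    recovered by continuity in the main proof. *)
Definition annulus (x y : R) : Prop :=
  exists s a, [/\ 0 < a < 2 * r, x = px a s & y = py a s].

Lemma annulus_side x y : annulus x y -> side 1 x y.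
Proof.
by move=> [s [a [h ex ey]]]; exists s, a; rewrite Rmult_1_l; split=> //; lra.
Qed.

Lemma annulus_open x y : annulus x y -> exists e, 0 < e /\
  forall x' y', Rabs (x' - x) < e -> Rabs (y' - y) < e -> annulus x' y'.
Proof.
move=> Axy; have [s [a [ha ex ey]]] := Axy.
have [e [e0 he]] := side_open (pow1 2) (annulus_side Axy).
have m1 := Rmin_l e (2 * r - a); have m2 := Rmin_r e (2 * r - a).
have m0 : 0 < Rmin e (2 * r - a) by apply: Rmin_glb_lt; lra.
exists (Rmin e (2 * r - a) / 2); split; first lra.
move=> x' y' hx hy; have hd := dist_small hx hy.
have [s' [b [hb ex' ey']]] := he x' y' ltac:(lra); rewrite Rmult_1_l in ex' ey'.
exists s', b; split=> //; split; first lra.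
have := @dist_tube b s' s; rewrite -ex' -ey' Rabs_pos_eq; last lra.
move=> h; have {}h := h ltac:(lra).
have := dist_tri x y x' y' (gx s) (gy s).
by rewrite [dist x y _ _](_ : _ = a); [lra|rewrite ex ey dist_par Rabs_pos_eq; lra].
Qed.

(** Each point is joined to the middle curve along its normal, and then to the point of parameter 0
    along that curve. *)
Lemma annulus_connected f : sm f ->
  (forall x y, annulus x y -> Dx f x y = 0 /\ Dy f x y = 0) ->
  exists c, forall x y, annulus x y -> f x y = c.
Proof.
move=> hf h0; exists (f (px r 0) (py r 0)) => x y [s [a [ha -> ->]]].
have in_a b s' : 0 < b < 2 * r -> annulus (px b s') (py b s') by exists s', b.
have da b s' : 0 < b < 2 * r -> is_derive (fun b => f (px b s') (py b s')) b 0.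
  move=> hb; have [z1 z2] := h0 _ _ (in_a b s' hb).
  have d1 : is_derive (fun b => px b s') b (- t2 s') by rewrite /parx; auto_derive => //; ring.
  have d2 : is_derive (fun b => py b s') b (t1 s') by rewrite /pary; auto_derive => //; ring.
  have := chain_rule hf d1 d2; rewrite z1 z2.
  by have -> : 0 * - t2 s' + 0 * t1 s' = 0 by ring.
have ds s' : is_derive (fun s => f (px r s) (py r s)) s' 0.
  have [z1 z2] := h0 _ _ (in_a r s' ltac:(lra)).
  have := chain_rule hf (is_derive_parx r hgx ht2 s') (is_derive_pary r hgy ht1 s').
  rewrite z1 z2.
  by have -> : 0 * (psi K r s' * t1 s') + 0 * (psi K r s' * t2 s') = 0 by ring.
have e1 : f (px a s) (py a s) = f (px r s) (py r s).
  have [h|[->|h]] := Rtotal_order a r => //.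
    by apply: (@eq_is_derive _ (fun b => f (px b s) (py b s))) h => b hb; apply: da; lra.
  by symmetry; apply: (@eq_is_derive _ (fun b => f (px b s) (py b s))) h => b hb; apply: da; lra.
rewrite e1; have [h|[->|h]] := Rtotal_order s 0 => //.
  by apply: (@eq_is_derive _ (fun s => f (px r s) (py r s))) h => b hb; exact: ds.
by symmetry; apply: (@eq_is_derive _ (fun s => f (px r s) (py r s))) h => b hb; exact: ds.
Qed.

End Tube.

(** * Fourier expansion of the integral *)

Definition re (z : R[i]) : R := complex.Re z.
Definition im (z : R[i]) : R := complex.Im z.

Lemma ReM (x y : R[i]) : re (x * y)%Ring =
  re x * re y - im x * im y.
Proof. by case: x; case: y. Qed.

Lemma ImM (x y : R[i]) : im (x * y)%Ring =
  re x * im y + im x * re y.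
Proof. by case: x; case: y. Qed.

Lemma ReM' (x y : R[i]) : re (x * y)%Ring =
  re x * re y + -1 * (im x * im y).
Proof. rewrite ReM; ring. Qed.

Lemma ImM' (x y : R[i]) : im (x * y)%Ring =
  re x * im y + 1 * (im x * re y).
Proof. rewrite ImM; ring. Qed.

Lemma ReD (x y : R[i]) : re (x + y)%Ring = re x + re y.
Proof. by case: x; case: y. Qed.

Lemma ImD (x y : R[i]) : im (x + y)%Ring = im x + im y.
Proof. by case: x; case: y. Qed.

Lemma complex_ext (x y : R[i]) : re x = re y -> im x = im y -> x = y.
Proof. by case: x => a b; case: y => c d /= -> ->. Qed.

Definition Ci : R[i] := (0 +i* 1)%C.

Definition cderiv (h : R -> R[i]) (t : R) (d : R[i]) : Prop :=
  is_derive (fun t => re (h t)) t (re d) /\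
  is_derive (fun t => im (h t)) t (im d).

Lemma cderiv_ext h g t d : (forall s, h s = g s) -> cderiv h t d -> cderiv g t d.
Proof.
by move=> e [h1 h2]; split; [apply: is_derive_ext h1|apply: is_derive_ext h2] => s; rewrite e.
Qed.

Lemma cderiv_const (c : R[i]) t : cderiv (fun _ => c) t 0%Ring.
Proof. by split; exact: is_derive_const. Qed.

Lemma cderiv_add h g t d e : cderiv h t d -> cderiv g t e ->
  cderiv (fun s => h s + g s)%Ring t (d + e)%Ring.
Proof.
move=> [h1 h2] [g1 g2]; split.
  apply: (is_derive_ext (fun s => re (h s) + re (g s))).
    by move=> s; rewrite ReD.
  by rewrite ReD; exact: is_derive_plus.
apply: (is_derive_ext (fun s => im (h s) + im (g s))).
  by move=> s; rewrite ImD.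
by rewrite ImD; exact: is_derive_plus.
Qed.

Lemma is_derive_mul_add (u v p q : R -> R) t u' v' p' q' a :
  is_derive u t u' -> is_derive v t v' -> is_derive p t p' -> is_derive q t q' ->
  is_derive (fun s => u s * p s + a * (v s * q s)) t
    (u' * p t + u t * p' + a * (v' * q t + v t * q')).
Proof.
move=> h1 h2 h3 h4; auto_derive; first by exd.
rewrite (is_derive_unique _ _ _ h1) (is_derive_unique _ _ _ h2) (is_derive_unique _ _ _ h3)
  (is_derive_unique _ _ _ h4); ring.
Qed.

Lemma cderiv_mul h g t d e : cderiv h t d -> cderiv g t e ->
  cderiv (fun s => h s * g s)%Ring t (d * g t + h t * e)%Ring.
Proof.
move=> [h1 h2] [g1 g2]; split.
  apply: (is_derive_ext (fun s => re (h s) * re (g s)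
    + -1 * (im (h s) * im (g s)))); first by move=> s; rewrite ReM'.
  have := is_derive_mul_add (-1) h1 h2 g1 g2.
  set l := (X in is_derive _ _ X); set l' := re _.
  by have -> : l = l'; [rewrite /l /l' ReD !ReM; ring|].
apply: (is_derive_ext (fun s => re (h s) * im (g s)
  + 1 * (im (h s) * re (g s)))); first by move=> s; rewrite ImM'.
have := is_derive_mul_add 1 h1 h2 g2 g1.
set l := (X in is_derive _ _ X); set l' := im _.
by have -> : l = l'; [rewrite /l /l' ImD !ImM; ring|].
Qed.

Lemma cderiv_sum n (h : nat -> R -> R[i]) t (d : nat -> R[i]) :
  (forall j, cderiv (h j) t (d j)) ->
  cderiv (fun s => \sum_(j < n) h j s)%Ring t (\sum_(j < n) d j)%Ring.
Proof.
move=> hd; elim: n => [|n IH].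
  rewrite big_ord0; apply: (cderiv_ext (h := fun _ => 0%Ring)); last exact: cderiv_const.
  by move=> s; rewrite big_ord0.
rewrite big_ord_recr /=.
apply: (cderiv_ext (h := fun s => (\sum_(j < n) h j s + h n s)%Ring)).
  by move=> s; rewrite big_ord_recr.
exact: cderiv_add.
Qed.

Lemma cderiv_locally_const h t d c e : 0 < e ->
  (forall s, Rabs (s - t) < e -> h s = c) -> cderiv h t d -> d = 0%Ring.
Proof.
move=> e0 hc [h1 h2].
have loc (f : R[i] -> R) : locally t (fun s => f c = f (h s)).
  by exists (mkposreal _ e0) => s /ball_R /= hs; rewrite hc.
apply: complex_ext.
  rewrite -(is_derive_unique _ _ _ h1); apply: is_derive_unique.
  exact: is_derive_ext_loc (loc _) (is_derive_const _ _).
rewrite -(is_derive_unique _ _ _ h2); apply: is_derive_unique.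
exact: is_derive_ext_loc (loc _) (is_derive_const _ _).
Qed.

Lemma cderiv0_const h : (forall t, cderiv h t 0%Ring) -> forall s t, h s = h t.
Proof.
move=> hd.
have lt s t : s < t -> h s = h t.
  move=> st; apply: complex_ext.
    by apply: (@eq_is_derive _ (fun s => re (h s))) st => u _; exact: (hd u).1.
  by apply: (@eq_is_derive _ (fun s => im (h s))) st => u _; exact: (hd u).2.
by move=> s t; have [/lt|[->|/lt]] := Rtotal_order s t.
Qed.

Definition cis (t : R) : R[i] := (cos t +i* sin t)%C.

Lemma cderiv_cis t : cderiv cis t (Ci * cis t)%Ring.
Proof.
by split; rewrite /cis ?ReM ?ImM /=; auto_derive => //; ring.
Qed.

Lemma cderiv_exp h t d n : cderiv h t (d * h t)%Ring ->
  cderiv (fun s => h s ^+ n)%Ring t ((d *+ n) * h t ^+ n)%Ring.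
Proof.
move=> hh; elim: n => [|n IH].
  rewrite mulr0n mul0r; apply: (cderiv_ext (h := fun _ => 1%Ring)); last exact: cderiv_const.
  by move=> s; rewrite expr0.
apply: (cderiv_ext (h := fun s => (h s * h s ^+ n)%Ring)).
  by move=> s; rewrite exprS.
have -> : (d *+ n.+1 * h t ^+ n.+1 = d * h t * h t ^+ n + h t * (d *+ n * h t ^+ n))%Ring.
  by rewrite exprS mulrSr mulrDl addrC mulrA [(h t * (_ * _))%Ring]mulrCA.
exact: cderiv_mul.
Qed.

Lemma cderiv_horner (p : {poly R[i]}) h t d : cderiv h t d ->
  cderiv (fun s => p.[h s])%Ring t (p^`().[h t] * d)%Ring.
Proof.
move=> hh; elim/poly_ind: p => [|p c IH].
  rewrite deriv0 horner0 mul0r; apply: (cderiv_ext (h := fun _ => 0%Ring)); last exact: cderiv_const.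
  by move=> s; rewrite horner0.
apply: (cderiv_ext (h := fun s => (p.[h s] * h s + c)%Ring)).
  by move=> s; rewrite hornerMXaddC.
have -> : ((p * 'X + c%:P)^`().[h t] * d = (p^`().[h t] * d * h t + p.[h t] * d) + 0)%Ring.
  by rewrite derivMXaddC hornerD hornerM hornerX addr0 mulrDl addrC mulrAC.
by apply: cderiv_add; [exact: cderiv_mul|exact: cderiv_const].
Qed.

Lemma cis_neq0 t : (cis t != 0)%Ring.
Proof.
apply/eqP => h; have := sin2_cos2 t.
have -> : sin t = 0 by exact: (f_equal im h).
by have -> : cos t = 0; [exact: (f_equal re h)|rewrite /Rsqr; lra].
Qed.

(** Differentiating in [t] gives [p'(cis t) * Ci * cis t = 0], so the size drops as in [van_x]. *)
Lemma poly_zero_on_arc (p : {poly R[i]}) t0 e : 0 < e ->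
  (forall t, Rabs (t - t0) < e -> p.[cis t]%Ring = 0%Ring) -> p = 0%Ring.
Proof.
move=> e0; have [n] := ubnP (size p); elim: n p => // n IH p pn pz.
have [p1|p1] := leqP (size p) 1.
  have h := pz t0; rewrite Rminus_diag Rabs_R0 (size1_polyC p1) hornerC in h.
  by rewrite (size1_polyC p1) (h e0) polyC0.
have p0 : p != 0%Ring by rewrite -size_poly_gt0 (ltn_trans _ p1).
have d0 : (p^`() = 0)%Ring.
  apply: IH; first by apply: leq_trans (lt_size_deriv p0) _.
  move=> t ht.
  have e1 : 0 < e - Rabs (t - t0) by lra.
  have hz s : Rabs (s - t) < e - Rabs (t - t0) -> (p.[cis s] = 0)%Ring.
    move=> hs; apply: pz; have -> : s - t0 = (s - t) + (t - t0) by ring.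
    by apply: Rle_lt_trans (Rabs_triang _ _) _; lra.
  have /eqP := cderiv_locally_const e1 hz (cderiv_horner p (cderiv_cis t)).
  rewrite !mulf_eq0 (negbTE (cis_neq0 t)) orbF => /orP [/eqP //|/eqP h].
  by have := f_equal im h => /= h'; exfalso; exact: R1_neq_R0.
exfalso; have := f_equal (fun q : {poly R[i]} => (q`_(size p).-2)%Ring) d0.
rewrite coef_deriv coef0.
have -> : (size p).-2.+1 = (size p).-1 by case: (size p) p1 => [|[|m]].
move/eqP; rewrite Num.Theory.mulrn_eq0 -/(lead_coef p) lead_coef_eq0 (negbTE p0) orbF.
by case: (size p) p1 => [|[|m]].
Qed.

Lemma ev_on_line (p : {poly {poly R}}) x0 y0 a b :
  exists g : {poly R}, forall t, (g.[t])%Ring = ev p (x0 + t * a) (y0 + t * b).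
Proof.
elim/poly_ind: p => [|p c [g hg]].
  by exists 0%Ring => t; rewrite ev0 horner0.
exists (g * (y0%:P + b%:P * 'X) + (c \Po (x0%:P + a%:P * 'X)))%Ring => t.
rewrite !evE ev_C -hg !hornerE horner_comp !hornerE.
by rewrite -!RmultE -!RplusE (Rmult_comm b) (Rmult_comm a).
Qed.

(** On the line through [(x0, y0)] and [(x, y)] the polynomial has one variable and vanishes on an
    interval. *)
Lemma ev_zero_of_box p x0 y0 e : 0 < e ->
  (forall x y, Rabs (x - x0) < e -> Rabs (y - y0) < e -> ev p x y = 0) ->
  forall x y, ev p x y = 0.
Proof.
move=> e0 hz x y.
have [g hg] := ev_on_line p x0 y0 (x - x0) (y - y0).
pose k := Rabs (x - x0) + Rabs (y - y0) + 1.
have kp : 0 < k by rewrite /k; have := Rabs_pos (x - x0); have := Rabs_pos (y - y0); lra.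
have ek : 0 < e / k by apply: Rdiv_lt_0_compat.
have small t u : Rabs t < e / k -> Rabs u <= k -> Rabs (t * u) < e.
  move=> ht hu; rewrite Rabs_mult.
  have -> : e = e / k * k by field; lra.
  have := Rabs_pos t; have := Rabs_pos u => h1 h2.
  apply: Rle_lt_trans (Rmult_lt_compat_r k _ _ kp ht).
  exact: Rmult_le_compat_l.
have g0 : g = 0%Ring.
  apply: (@van_x id (fun _ => 1) (- (e / k)) (e / k) _ _ _ (- (e / k)) (e / k)); try lra.
  - move=> s _; exact: is_derive_id.
  - move=> s _; lra.
  - move=> s hs; rewrite hg; have hs' : Rabs s < e / k by apply: Rabs_def1; lra.
    have p1 := Rabs_pos (x - x0); have p2 := Rabs_pos (y - y0).
    apply: hz.
      have -> : x0 + s * (x - x0) - x0 = s * (x - x0) by ring.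
      by apply: small; rewrite // /k; lra.
    have -> : y0 + s * (y - y0) - y0 = s * (y - y0) by ring.
    by apply: small; rewrite // /k; lra.
have := hg 1; rewrite g0 horner0 => h; rewrite [RHS]h; congr ev; ring.
Qed.

Lemma diff1_ev p : diff1 (ev p).
Proof.
move=> x y; split; [|split; [|exact: continuity_2d_ev]].
  by eexists; apply: is_derive_ev; [exact: is_derive_id|exact: is_derive_const].
by eexists; apply: is_derive_ev; [exact: is_derive_const|exact: is_derive_id].
Qed.

Lemma Dx_ev p : Dx (ev p) = ev (dX p).
Proof.
apply: fun2_ext => x y; apply: is_derive_unique.
have h := @is_derive_ev p id (fun _ => y) x 1 0 (is_derive_id x) (is_derive_const y x).
have -> : ev (dX p) x y = ev (dX p) x y * 1 + ev (dY p) x y * 0 by ring.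
exact: h.
Qed.

Lemma Dy_ev p : Dy (ev p) = ev (dY p).
Proof.
apply: fun2_ext => x y; apply: is_derive_unique.
have h := @is_derive_ev p (fun _ => x) id y 0 1 (is_derive_const x y) (is_derive_id y).
have -> : ev (dY p) x y = ev (dX p) x y * 0 + ev (dY p) x y * 1 by ring.
exact: h.
Qed.

Lemma sm_ev p : sm (ev p).
Proof.
move=> n; elim: n p => [|n IH] p; split=> //; try exact: diff1_ev.
by rewrite Dx_ev Dy_ev.
Qed.

Section Fourier.
Local Open Scope ring_scope.

Definition cisN (t : R) : R[i] := (cos t +i* (- sin t)%Re)%C.

Definition rc (a : R) : R[i] := real_complex R a.

Lemma reN (x : R[i]) : re (- x) = (- re x)%Re. Proof. by case: x. Qed.
Lemma imN (x : R[i]) : im (- x) = (- im x)%Re. Proof. by case: x. Qed.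
Lemma re1 : re 1 = 1%Re. Proof. by []. Qed.
Lemma im1 : im 1 = 0%Re. Proof. by []. Qed.
Lemma re_rc a : re (rc a) = a. Proof. by []. Qed.
Lemma im_rc a : im (rc a) = 0%Re. Proof. by []. Qed.
Lemma re_Ci : re Ci = 0%Re. Proof. by []. Qed.
Lemma im_Ci : im Ci = 1%Re. Proof. by []. Qed.
Lemma re_cis t : re (cis t) = cos t. Proof. by []. Qed.
Lemma im_cis t : im (cis t) = sin t. Proof. by []. Qed.
Lemma re_cisN t : re (cisN t) = cos t. Proof. by []. Qed.
Lemma im_cisN t : im (cisN t) = (- sin t)%Re. Proof. by []. Qed.

Definition reimE := (ReM, ImM, ReD, ImD, reN, imN, re1, im1, re_rc, im_rc, re_Ci, im_Ci,
  re_cis, im_cis, re_cisN, im_cisN).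

Lemma cisK t : cis t * cisN t = 1.
Proof.
have h := sin2_cos2 t; rewrite /Rsqr in h.
by apply: complex_ext; rewrite !reimE; lra.
Qed.

Lemma cderiv_cisN t : cderiv cisN t (- Ci * cisN t).
Proof.
split; rewrite !reimE; [apply: (is_derive_ext cos) => //|
  apply: (is_derive_ext (fun s => (- sin s)%Re)) => //]; auto_derive => //; ring.
Qed.

Lemma cis_cisN_exp t n : cis t ^+ n * cisN t ^+ n = 1.
Proof. by rewrite -exprMn cisK expr1n. Qed.

(* [cos^k sin^l], multiplied by [cis^N], as a polynomial in [cis]. *)
Definition trig_poly (N k l : nat) : {poly R[i]} :=
  ((rc (/ 2)%Re)%:P * ('X^2 + 1)) ^+ k * ((- Ci * rc (/ 2)%Re)%:P * ('X^2 - 1)) ^+ l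
  * 'X^(N - (k + l)).

Lemma size_trig_poly N k l : (k + l <= N)%N -> (size (trig_poly N k l) <= N.*2.+1)%N.
Proof.
move=> klN.
have q3 (p : {poly R[i]}) (c : R[i]) : (size p <= 3)%N -> (size (c%:P * p)%Ring <= 3)%N.
  by move=> p3; rewrite mul_polyC; apply: leq_trans (size_scale_leq _ _) p3.
have s1 : (size ('X^2 + 1 : {poly R[i]})%Ring <= 3)%N.
  by apply: leq_trans (size_polyD _ _) _; rewrite size_polyXn size_poly1.
have s2 : (size ('X^2 - 1 : {poly R[i]})%Ring <= 3)%N.
  by apply: leq_trans (size_polyD _ _) _; rewrite size_polyXn size_polyN size_poly1.
have ex (p : {poly R[i]}) n : (size p <= 3)%N -> (size (p ^+ n)%Ring <= (2 * n).+1)%N.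
  move=> p3; apply: leq_trans (size_poly_exp_leq _ _) _.
  by rewrite ltnS leq_mul2r; apply/orP; right; case: (size p) p3.
rewrite /trig_poly; set p1 := _ ^+ k; set p2 := _ ^+ l.
have e1 : (size p1 <= (2 * k).+1)%N by apply: ex; apply: q3.
have e2 : (size p2 <= (2 * l).+1)%N by apply: ex; apply: q3.
apply: leq_trans (size_polyMleq _ _) _; rewrite size_polyXn addnS -pred_Sn.
have e3 : (size (p1 * p2)%Ring <= (2 * (k + l)).+1)%N.
  apply: leq_trans (size_polyMleq _ _) _.
  apply: (@leq_trans ((2 * k).+1 + (2 * l).+1).-1); last by rewrite addnS mulnDr.
  by rewrite -!subn1 leq_sub2r // leq_add.
apply: (@leq_trans ((2 * (k + l)).+1 + (N - (k + l)))); first by rewrite leq_add2r.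
move: (k + l)%N klN => m mN.
by rewrite addSn ltnS mul2n -!addnn -addnA subnKC // leq_add2r.
Qed.

Lemma trig_poly_cis N k l t : (k + l <= N)%N ->
  (trig_poly N k l).[cis t] = rc (cos t ^ k * sin t ^ l)%Re * cis t ^+ N.
Proof.
move=> klN.
have sc := sin2_cos2 t; rewrite /Rsqr in sc.
have e1 : rc (/ 2)%Re * (cis t ^+ 2 + 1) = rc (cos t) * cis t.
  by rewrite expr2; apply: complex_ext; rewrite !reimE; lra.
have e2 : - Ci * rc (/ 2)%Re * (cis t ^+ 2 - 1) = rc (sin t) * cis t.
  by rewrite expr2; apply: complex_ext; rewrite !reimE; lra.
have rcX a n : rc (a ^ n)%Re = rc a ^+ n by rewrite RpowE /rc rmorphXn.
have rcM a b : rc (a * b)%Re = rc a * rc b by rewrite RmultE /rc rmorphM.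
rewrite /trig_poly !hornerM !horner_exp !hornerM !hornerC hornerD hornerD hornerN hornerC !(hornerXn, hornerX).
rewrite e1 e2 rcM !rcX; move: (rc (cos t)) (rc (sin t)) (cis t) => c s w.
have -> : w ^+ N = w ^+ k * w ^+ l * w ^+ (N - (k + l)) by rewrite -!exprD subnKC.
by rewrite (exprMn k c) (exprMn l s) mulrACA -!mulrA.
Qed.

Lemma rc_sum n (f : nat -> R) : rc (sum_f_R0 f n) = \sum_(i < n.+1) rc (f i).
Proof. by rewrite sum_f_R0_big /rc rmorph_sum. Qed.

Lemma re_sum n (f : nat -> R[i]) : re (\sum_(i < n.+1) f i) = sum_f_R0 (fun i => re (f i)) n.
Proof. by elim: n => [|n IH]; [rewrite big_ord1|rewrite big_ord_recr ReD IH]. Qed.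

Lemma im_sum n (f : nat -> R[i]) : im (\sum_(i < n.+1) f i) = sum_f_R0 (fun i => im (f i)) n.
Proof. by elim: n => [|n IH]; [rewrite big_ord1|rewrite big_ord_recr ImD IH]. Qed.

End Fourier.

Lemma sm_sum (f : nat -> R -> R -> R) n : (forall i, sm (f i)) ->
  sm (fun x y => sum_f_R0 (fun i => f i x y) n).
Proof.
move=> hf; elim: n => [|n IH] //=.
have -> : (fun x y => sum_f_R0 (fun i => f i x y) n + f n.+1 x y) =
  (fun x y => 1 * sum_f_R0 (fun i => f i x y) n + 1 * f n.+1 x y).
  by apply: fun2_ext => x y; ring.
exact: sm_lin.
Qed.

Section Coefficients.
Variables (N : nat) (a : nat -> nat -> R -> R -> R).
Hypothesis a_sm : forall k l, sm (a k l).

(* The Fourier coefficient of index [j - N] of [Phi (x, y)] on the unit circle. *)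
Definition coeff (j : nat) : cfun :=
  ((fun x y => sum_f_R0 (fun k => sum_f_R0 (fun l =>
      re (((trig_poly N k l)`_j)%Ring) * a k l x y) (N - k)%coq_nat) N),
   (fun x y => sum_f_R0 (fun k => sum_f_R0 (fun l =>
      im (((trig_poly N k l)`_j)%Ring) * a k l x y) (N - k)%coq_nat) N)).

Lemma sm_scale c f : sm f -> sm (fun x y => c * f x y).
Proof. by move=> hf; apply: (@sm_mul (fun _ _ => c)) => //; exact: sm_const. Qed.

Lemma csm_coeff j : csm (coeff j).
Proof. by split; apply: sm_sum => k; apply: sm_sum => l; exact: sm_scale. Qed.

Definition cval (f : cfun) (x y : R) : R[i] := (f.1 x y +i* f.2 x y)%C.

Lemma cval_coeff j x y : cval (coeff j) x y =
  (\sum_(k < N.+1) \sum_(l < (N - k).+1) rc (a k l x y) * (trig_poly N k l)`_j)%Ring.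
Proof.
apply: complex_ext.
  rewrite -[LHS]/((coeff j).1 x y) (re_sum _ (fun k => \sum_(l < (N - k).+1) rc (a k l x y) * (trig_poly N k l)`_j)%Ring).
  apply: PartSum.sum_eq => k _; rewrite (re_sum _ (fun l => rc (a k l x y) * (trig_poly N k l)`_j)%Ring); apply: PartSum.sum_eq => l _.
  by rewrite !reimE; ring.
rewrite -[LHS]/((coeff j).2 x y) (im_sum _ (fun k => \sum_(l < (N - k).+1) rc (a k l x y) * (trig_poly N k l)`_j)%Ring).
apply: PartSum.sum_eq => k _; rewrite (im_sum _ (fun l => rc (a k l x y) * (trig_poly N k l)`_j)%Ring); apply: PartSum.sum_eq => l _.
by rewrite !reimE; ring.
Qed.

Lemma coeff_high j : (N.*2 < j)%N -> coeff j = ((fun _ _ => 0), (fun _ _ => 0)).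
Proof.
move=> jN; have z k l : (k <= N)%coq_nat -> (l <= (N - k)%coq_nat)%coq_nat ->
    ((trig_poly N k l)`_j = 0)%Ring.
  move=> /leP kN /leP lN; apply: nth_default; apply: leq_trans jN.
  by apply: size_trig_poly; rewrite -leq_subRL.
congr pair; apply: fun2_ext => x y.
  rewrite -(sum_eq_R0 (fun _ => 0) N) //; apply: PartSum.sum_eq => k kN.
  rewrite -[RHS](sum_eq_R0 (fun _ => 0) (N - k)%coq_nat) //; apply: PartSum.sum_eq => l lN.
  by rewrite z // (_ : re 0%Ring = 0) //; ring.
rewrite -(sum_eq_R0 (fun _ => 0) N) //; apply: PartSum.sum_eq => k kN.
rewrite -[RHS](sum_eq_R0 (fun _ => 0) (N - k)%coq_nat) //; apply: PartSum.sum_eq => l lN.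
by rewrite z // (_ : im 0%Ring = 0) //; ring.
Qed.

Lemma Phi_coeff x y t :
  (\sum_(j < N.*2.+1) cval (coeff j) x y * cis t ^+ j
   = rc (Phi N a (x, y) (cos t, sin t)) * cis t ^+ N)%Ring.
Proof.
rewrite /Phi /= rc_sum big_distrl /=.
under eq_bigr => j _ do rewrite cval_coeff big_distrl /=.
rewrite exchange_big /=; apply: eq_bigr => k _.
rewrite rc_sum big_distrl /=.
under eq_bigr => j _ do rewrite big_distrl /=.
rewrite exchange_big /=; apply: eq_bigr => l _.
have klN : (k + l <= N)%N by rewrite -leq_subRL -ltnS.
rewrite Rmult_assoc [rc (_ * _)]rmorphM -mulrA -trig_poly_cis //.
rewrite (horner_coef_wide _ (size_trig_poly klN)) big_distrr /=.
by apply: eq_bigr => j _; rewrite mulrA.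
Qed.

End Coefficients.

Module CommutativeAlgebra.
Import mathcomp.algebra_tactics.ring.

(** The derivative of one Fourier mode along a Larmor circle: [w = cis t], [z] is its inverse, [I]
    the imaginary unit, [h = r / 2], [P = w^j], [Z = z^N], [V] the value of the coefficient, [al]
    and [be] those of its [dz] and [dzb], and [n], [m] stand for [j], [N]. *)
Lemma term_identity (K : comNzRingType) (al be V w z I h c n m P Z : K) :
  (w * z = 1 -> h * c = n - m ->
   (h * (al * w + be * z) * P + V * (I * n * P)) * Z + V * P * (- (I * m) * Z)
   = h * (z * Z) * (al * (w * (w * P)) + be * P + c * (I * V) * (w * P)))%Ring.
Proof.
move=> wz hc.
transitivity (Z * P * (h * (al * w * (w * z) + be * z) + I * V * (h * c) * (w * z)))%Ring.
  by rewrite wz hc; ring.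
ring.
Qed.

End CommutativeAlgebra.

Lemma cderiv_cval f (X Y : R -> R) t x' y' : csm f -> is_derive X t x' -> is_derive Y t y' ->
  cderiv (fun t => cval f (X t) (Y t)) t
    ((Dx f.1 (X t) (Y t) * x' + Dy f.1 (X t) (Y t) * y')
     +i* (Dx f.2 (X t) (Y t) * x' + Dy f.2 (X t) (Y t) * y'))%C.
Proof. by move=> [h1 h2] hX hY; split; exact: chain_rule. Qed.

Section OnCircle.
Variables (r cx cy : R).
Hypothesis r0 : 0 < r.
Local Notation X := (larx r cx).
Local Notation Y := (lary r cy).

Lemma cderiv_cval_circle f t : csm f -> cderiv (fun t => cval f (X t) (Y t)) t
  (rc (r / 2) * (cval (dz f) (X t) (Y t) * cis t + cval (dzb f) (X t) (Y t) * cisN t))%Ring.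
Proof.
move=> hf.
have := cderiv_cval hf (is_derive_larx r cx t) (is_derive_lary r cy t).
set d := (X in cderiv _ _ X); set d' := (X in _ -> cderiv _ _ X).
have -> : d = d' by apply: complex_ext; rewrite /d /d' !reimE /re /im /= -?RplusE -?RmultE; field.
by [].
Qed.

Definition circle_term (f : cfun) (j N : nat) (t : R) : R[i] :=
  (cval f (X t) (Y t) * cis t ^+ j * cisN t ^+ N)%Ring.


Lemma cderiv_circle_term f j N t : csm f -> cderiv (circle_term f j N) t
  (rc (r / 2) * (cisN t * cisN t ^+ N)
   * (cval (dz f) (X t) (Y t) * (cis t * (cis t * cis t ^+ j))
      + cval (dzb f) (X t) (Y t) * cis t ^+ j
      + rc (2 / r * (INR j - INR N)) * (Ci * cval f (X t) (Y t)) * (cis t * cis t ^+ j)))%Ring.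
Proof.
move=> hf.
have h1 := cderiv_cval_circle t hf.
have h2 := cderiv_exp j (cderiv_cis t); have h3 := cderiv_exp N (cderiv_cisN t).
have := cderiv_mul (cderiv_mul h1 h2) h3.
have rcn n : rc (INR n) = (n%:R)%Ring by rewrite INRE /rc rmorph_nat.
have hc : (rc (r / 2) * rc (2 / r * (INR j - INR N)) = rc (INR j) - rc (INR N))%Ring.
  by apply: complex_ext; rewrite !reimE; field; lra.
rewrite -(CommutativeAlgebra.term_identity _ _ _ _ _ _ (cisK t) hc) !rcn !mulr_natr mulNrn.
by [].
Qed.

Definition zfun : cfun := ((fun _ _ => 0), (fun _ _ => 0)).

Lemma cval_zfun x y : cval zfun x y = 0%Ring. Proof. by []. Qed.

Lemma D_zero : Dx (fun _ _ => 0) = (fun _ _ => 0) /\ Dy (fun _ _ => 0) = (fun _ _ => 0).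
Proof. by split; apply: fun2_ext => x y; exact: Derive_const. Qed.

Lemma dz_zfun : dz zfun = zfun.
Proof.
have [h1 h2] := D_zero.
by rewrite /dz /zfun /= h1 h2; congr pair; apply: fun2_ext => x y; ring.
Qed.

Lemma dzb_zfun : dzb zfun = zfun.
Proof.
have [h1 h2] := D_zero.
by rewrite /dzb /zfun /= h1 h2; congr pair; apply: fun2_ext => x y; ring.
Qed.

Section Transport.
Variables (A : nat -> cfun) (M N : nat).
Hypothesis A_sm : forall j, csm (A j).
Hypothesis A0 : A 0%N = zfun.
Hypothesis A1 : A 1%N = zfun.
Hypothesis A_top : forall j, (M.+1 < j)%N -> A j = zfun.

(** [A] is the coefficient sequence shifted by two places, so [A i.+1] has frequency [i - 1 - N]. *)
Definition weight (i : nat) : R := 2 / r * (INR i - 1 - INR N).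

Definition transport (i : nat) : cfun :=
  cadd (cadd (dz (A i)) (dzb (A i.+2))) (cscal (weight i) (cmuli (A i.+1))).

Lemma cval_transport i x y : cval (transport i) x y =
  (cval (dz (A i)) x y + cval (dzb (A i.+2)) x y + rc (weight i) * (Ci * cval (A i.+1) x y))%Ring.
Proof. by apply: complex_ext; rewrite !reimE /re /im /=; ring. Qed.

(** The three sums are reindexed to a common range; the boundary terms vanish because [A] is zero at
    0, at 1 and above [M + 1]. The two zeros at the bottom spare negative indices. *)
Lemma transport_sum x y (w : R[i]) :
  (\sum_(i < M.+2) cval (transport i) x y * w ^+ i =
   \sum_(j < M) (cval (dz (A j.+2)) x y * (w * (w * w ^+ j)) + cval (dzb (A j.+2)) x y * w ^+ j
     + rc (2 / r * (INR j - INR N)) * (Ci * cval (A j.+2) x y) * (w * w ^+ j)))%Ring.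
Proof.
under eq_bigr => i _ do rewrite cval_transport !mulrDl.
rewrite !big_split /=.
congr (_ + _ + _)%Ring.
- rewrite !big_ord_recl A0 A1 dz_zfun cval_zfun !mul0r !add0r.
  by apply: eq_bigr => i _; rewrite /bump /= ?add1n !exprS.
- rewrite !big_ord_recr /= !A_top ?ltnS ?leqnn ?leqnSn // dzb_zfun cval_zfun.
  by rewrite !mul0r !addr0.
- rewrite big_ord_recl big_ord_recr /= A1 A_top //.
  rewrite cval_zfun !mulr0 !mul0r add0r addr0.
  apply: eq_bigr => i _; rewrite /bump /= ?add1n !exprS.
  by congr (rc _ * _ * _)%Ring; rewrite /weight S_INR; ring.
Qed.

Lemma cderiv_circle_sum t : cderiv (fun t => \sum_(j < M) circle_term (A j.+2) j N t)%Ring t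
  (rc (r / 2) * (cisN t * cisN t ^+ N)
   * \sum_(i < M.+2) cval (transport i) (X t) (Y t) * cis t ^+ i)%Ring.
Proof.
rewrite transport_sum big_distrr /=.
have h := @cderiv_sum M (fun j => circle_term (A j.+2) j N) t _
  (fun j => cderiv_circle_term j N t (A_sm j.+2)).
exact: h.
Qed.

End Transport.
End OnCircle.

(** * The integral as a polynomial in the Larmor center *)

(** At angle 0 the point of a Larmor circle is [(cx, cy - r)]; this makes the circle sum there a
    polynomial in the center. *)
Lemma ev_shift_sum (P : nat -> {poly {poly R}}) (r : R) n :
  exists F, forall x y, ev F x y = sum_f_R0 (fun j => ev (P j) x (y - r)) n.
Proof.
have shift p : exists F, forall x y, ev F x y = ev p x (y - r).
  exists (p \Po ('X - (r%:P)%:P))%Ring => x y.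
  by rewrite /ev /ev2 horner_comp !hornerE -polyCB.
elim: n => [|n [F hF]]; first exact: shift.
have [G hG] := shift (P n.+1).
by exists (F + G)%Ring => x y; rewrite evD hF hG.
Qed.

Section Center.
Variables (U : R -> R -> Prop) (r : R) (N : nat) (a : nat -> nat -> R -> R -> R).
Hypothesis U_open : forall x y, U x y -> exists e, 0 < e /\
  forall x' y', Rabs (x' - x) < e -> Rabs (y' - y) < e -> U x' y'.
Hypothesis U_connected : forall f, sm f ->
  (forall x y, U x y -> Dx f x y = 0 /\ Dy f x y = 0) ->
  exists c, forall x y, U x y -> f x y = c.
Hypothesis U_ne : exists x y, U x y.
Hypothesis r0 : 0 < r.
Hypothesis a_sm : forall k l, sm (a k l).
Hypothesis flow : forall x y, U x y -> exists t0 e, 0 < e /\ forall t, Rabs (t - t0) < e ->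
  exists kappa d, 0 < d /\ forall s, Rabs (s - t) < d ->
    Phi N a (larx r (x - r * sin t) s, lary r (y + r * cos t) s) (cos s, sin s) = kappa.

Let M := (N.*2.+1)%N.

Definition shifted_coeff (j : nat) : cfun :=
  match j with S (S j') => coeff N a j' | _ => zfun end.

Lemma csm_zfun : csm zfun. Proof. by split; exact: sm_const. Qed.

Lemma csm_shifted_coeff j : csm (shifted_coeff j).
Proof. by case: j => [|[|j]]; [exact: csm_zfun|exact: csm_zfun|exact: csm_coeff]. Qed.

Lemma shifted_coeff_top j : (M.+1 < j)%N -> shifted_coeff j = zfun.
Proof. by case: j => [|[|j]] //; rewrite !ltnS => h; exact: coeff_high. Qed.

Lemma czero_cval f : (forall x y, U x y -> cval f x y = 0%Ring) -> czero U f.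
Proof.
by move=> h; split=> x y /h e; [have := f_equal re e|have := f_equal im e].
Qed.

Lemma circle_sum_Phi cx cy s :
  (\sum_(j < M) circle_term r cx cy (shifted_coeff j.+2) j N s)%Ring
  = rc (Phi N a (larx r cx s, lary r cy s) (cos s, sin s)).
Proof.
rewrite /circle_term -big_distrl /=.
have h := Phi_coeff N a (larx r cx s) (lary r cy s) s.
by rewrite [X in (X * _)%Ring]h -mulrA cis_cisN_exp mulr1.
Qed.

Lemma larx_at x y t : larx r (x - r * sin t) t = x /\ lary r (y + r * cos t) t = y.
Proof. by rewrite /larx /lary; split; ring. Qed.

(** At a fixed point of [U] the sum of [transport i] times [cis t ^ i] is, up to nonzero factors,
    the derivative of [Phi] along the circle with direction [t]. It vanishes on an interval of [t],
    hence coefficient by coefficient. *)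
Lemma transport_zero i : czero U (transport r shifted_coeff N i).
Proof.
apply: czero_cval => x y Uxy.
have [iM|iM] := ltnP i M.+2; last first.
  rewrite cval_transport !shifted_coeff_top ?dz_zfun ?dzb_zfun ?cval_zfun //.
  - by rewrite !mulr0 !addr0.
  - exact: leq_trans iM (leqnSn i).
  - exact: leq_trans iM (leq_trans (leqnSn i) (leqnSn _)).
have [t0 [e [e0 he]]] := flow Uxy.
have pz : (\poly_(i < M.+2) cval (transport r shifted_coeff N i) x y)%Ring = 0%Ring.
  apply: (poly_zero_on_arc e0) => t /he [kappa [d [d0 hk]]].
  have hc := cderiv_circle_sum (x - r * sin t) (y + r * cos t) r0 N csm_shifted_coeff
    erefl erefl shifted_coeff_top t.
  have hz s : Rabs (s - t) < d -> (\sum_(j < M) circle_term r (x - r * sin t) (y + r * cos t)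
      (shifted_coeff j.+2) j N s)%Ring = rc kappa.
    by move=> hs; rewrite circle_sum_Phi hk.
  move: (cderiv_locally_const d0 hz hc) => /eqP.
  have [-> ->] := larx_at x y t.
  have rne : (rc (r / 2) != 0)%Ring.
    by apply/eqP => h; have := f_equal re h; rewrite re_rc => h'; have : r / 2 = 0 := h'; lra.
  have cne : (cisN t != 0)%Ring.
    by apply/eqP => h; have /eqP := cisK t; rewrite h mulr0 eq_sym oner_eq0.
  rewrite !mulf_eq0 expf_eq0 (negbTE rne) (negbTE cne) andbF /= => h.
  by rewrite horner_poly; apply/eqP.
by have := f_equal (fun p : {poly R[i]} => (p`_i)%Ring) pz; rewrite coef_poly iM coef0.
Qed.

Lemma eqU_D f g : (forall x y, U x y -> f x y = g x y) ->
  forall x y, U x y -> Dx f x y = Dx g x y /\ Dy f x y = Dy g x y.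
Proof.
move=> fg x y Uxy; have [e [e0 he]] := U_open Uxy.
split; apply: Derive_ext_loc; exists (mkposreal _ e0) => t /ball_R /= ht;
  apply: fg; apply: he => //; by rewrite Rminus_diag Rabs_R0.
Qed.

(** With polynomial coefficients the recursion is a polynomial identity and holds in the whole
    plane. The circle sum is then constant on the full circle, including its part outside [U], and
    can be read off at angle 0. *)
Lemma center_polynomial : exists F, forall x y, U x y -> forall t,
  Phi N a (x, y) (cos t, sin t) = ev F (x - r * sin t) (y + r * cos t).
Proof.
have cz : czero U zfun by [].
have top0 j : (M.+1 < j)%N -> czero U (shifted_coeff j).
  by move=> /shifted_coeff_top ->.
have pol := recursion_polyU U_open U_connected csm_shifted_coeff (T := M.+1) (w := weight r N)
  cz cz top0 transport_zero.
pose P0 j := proj1_sig (constructive_indefinite_description _ (pol j).1).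
pose Q0 j := proj1_sig (constructive_indefinite_description _ (pol j).2).
have hP0 j x y : U x y -> (shifted_coeff j).1 x y = ev (P0 j) x y.
  by rewrite /P0; case: constructive_indefinite_description => p hp; exact: hp.
have hQ0 j x y : U x y -> (shifted_coeff j).2 x y = ev (Q0 j) x y.
  by rewrite /Q0; case: constructive_indefinite_description => p hp; exact: hp.
(* Outside this range the polynomials are set to zero, so that [A j = zfun] holds on the whole plane
   and not only on [U]. *)
pose inr j := (1 < j)%N && (j <= M.+1)%N.
pose P j := if inr j then P0 j else 0%Ring.
pose Q j := if inr j then Q0 j else 0%Ring.
pose A j : cfun := (ev (P j), ev (Q j)).
have Az j : inr j = false -> A j = zfun.
  by move=> h; rewrite /A /P /Q h; congr pair; apply: fun2_ext => x y; exact: ev0.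
have sz j : inr j = false -> shifted_coeff j = zfun.
  rewrite /inr; case: j => [|[|j]] //= /negbT; rewrite -ltnNge; exact: shifted_coeff_top.
have AU j x y : U x y -> (shifted_coeff j).1 x y = (A j).1 x y /\ (shifted_coeff j).2 x y = (A j).2 x y.
  move=> Uxy; case h: (inr j); last by rewrite Az // sz.
  by rewrite /A /P /Q h hP0 // hQ0.
have A_sm j : csm (A j) by split; exact: sm_ev.
have A_top j : (M.+1 < j)%N -> A j = zfun.
  by move=> h; apply: Az; rewrite /inr [(j <= _)%N]leqNgt h andbF.
have tU i x y : U x y -> cval (transport r A N i) x y = 0%Ring.
  move=> Uxy; have [z1 z2] := transport_zero i.
  have := z1 x y Uxy; have := z2 x y Uxy; rewrite /transport /cadd /cscal /cmuli /dz /dzb /=.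
  have D1 j := eqU_D (fun x y h => (AU j x y h).1) Uxy.
  have D2 j := eqU_D (fun x y h => (AU j x y h).2) Uxy.
  have [-> ->] := AU i.+1 x y Uxy.
  have [-> ->] := D1 i; have [-> ->] := D2 i; have [-> ->] := D1 i.+2; have [-> ->] := D2 i.+2.
  by move=> e2 e1; apply: complex_ext; [exact: e1|exact: e2].
have tE i : exists E1 E2, forall x y, cval (transport r A N i) x y = (ev E1 x y +i* ev E2 x y)%C.
  exists (dX (P i) + dY (Q i) + (dX (P i.+2) - dY (Q i.+2)) - cst (weight r N i) * Q i.+1)%Ring.
  exists (dX (Q i) - dY (P i) + (dX (Q i.+2) + dY (P i.+2)) + cst (weight r N i) * P i.+1)%Ring.
  move=> x y; rewrite /cval /transport /cadd /cscal /cmuli /dz /dzb /= !Dx_ev !Dy_ev.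
  by apply: complex_ext; rewrite /re /im /= !evE; ring.
have [ux [uy Uu]] := U_ne.
have [e [e0 he]] := U_open Uu.
have t0 i x y : cval (transport r A N i) x y = 0%Ring.
  have [E1 [E2 hE]] := tE i; rewrite hE.
  have z1 : forall x y, ev E1 x y = 0.
    apply: (ev_zero_of_box e0) => x' y' hx hy.
    by have := tU i x' y' (he x' y' hx hy); rewrite hE => h; exact: (f_equal re h).
  have z2 : forall x y, ev E2 x y = 0.
    apply: (ev_zero_of_box e0) => x' y' hx hy.
    by have := tU i x' y' (he x' y' hx hy); rewrite hE => h; exact: (f_equal im h).
  by rewrite z1 z2.
have [F hF] := ev_shift_sum (fun j => P j.+2) r N.*2.
exists F => x y Uxy t.
set cx := x - r * sin t; set cy := y + r * cos t.
pose h s := (\sum_(j < M) circle_term r cx cy (A j.+2) j N s)%Ring.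
have hd s : cderiv h s 0%Ring.
  have := cderiv_circle_sum cx cy r0 N A_sm (Az 0%N erefl) (Az 1%N erefl) A_top s.
  by rewrite big1 ?mulr0 // => i _; rewrite t0 mul0r.
have e1 : h t = rc (Phi N a (x, y) (cos t, sin t)).
  have := circle_sum_Phi cx cy t; have [l1 l2] := larx_at x y t; rewrite -/cx -/cy in l1 l2.
  rewrite l1 l2 => <-; apply: eq_bigr => j _; rewrite /circle_term l1 l2; congr (_ * _ * _)%Ring.
  by have [h1 h2] := AU j.+2 x y Uxy; rewrite /cval -h1 -h2.
have e2 : re (h 0) = ev F cx cy.
  rewrite hF /h (re_sum _ (fun j => circle_term r cx cy (A j.+2) j N 0)).
  apply: PartSum.sum_eq => j _; rewrite /circle_term.
  have -> : cis 0 = 1%Ring by rewrite /cis cos_0 sin_0.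
  have -> : cisN 0 = 1%Ring by rewrite /cisN cos_0 sin_0 Ropp_0.
  rewrite !expr1n !mulr1 /cval /re /= /larx /lary sin_0 cos_0.
  by rewrite Rmult_0_r Rplus_0_r Rmult_1_r.
by rewrite -e2 -(cderiv0_const hd t 0) e1.
Qed.

End Center.

(** * The billiard hypotheses in the moving frame of the boundary *)

Lemma ex_derive_sum_f_R0 (f : nat -> R -> R) n x : (forall i, ex_derive (f i) x) ->
  ex_derive (fun x => sum_f_R0 (fun i => f i x) n) x.
Proof.
move=> hf; elim: n => [|n IH] //=.
exact: (@ex_derive_plus _ _ (fun x => sum_f_R0 (fun i => f i x) n) (f n.+1)).
Qed.

Lemma ex_derive_Phi N a (X Y : R -> R) v t : (forall k l, sm (a k l)) ->
  ex_derive X t -> ex_derive Y t -> ex_derive (fun t => Phi N a (X t, Y t) v) t.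
Proof.
move=> ha [x' hX] [y' hY]; apply: ex_derive_sum_f_R0 => k; apply: ex_derive_sum_f_R0 => l /=.
have h := chain_rule (ha k l) hX hY.
have e := ex_intro (fun d => is_derive (fun t => a k l (X t) (Y t)) t d) _ h.
apply: (ex_derive_mult (fun t => a k l (X t) (Y t) * fst v ^ k)); last exact: ex_derive_const.
by apply: (ex_derive_mult (fun t => a k l (X t) (Y t))); last exact: ex_derive_const.
Qed.

Lemma larmor_circle beta cx cy th0 th : beta <> 0 ->
  larmor_pos beta (larx (/ beta) cx th0, lary (/ beta) cy th0) (cos th0, sin th0)
    ((th - th0) / beta) = (larx (/ beta) cx th, lary (/ beta) cy th) /\
  larmor_vel beta (cos th0, sin th0) ((th - th0) / beta) = (cos th, sin th).
Proof.
move=> b0; rewrite /larmor_pos /larmor_vel /rot /Jrot /larx /lary /=.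
have -> : beta * ((th - th0) / beta) = th - th0 by field.
have ec : cos th = cos th0 * cos (th - th0) - sin th0 * sin (th - th0).
  by rewrite -cos_plus; congr cos; ring.
have es : sin th = cos th0 * sin (th - th0) + sin th0 * cos (th - th0).
  rewrite [RHS]Rplus_comm -sin_plus; congr sin; ring.
by split; congr pair; rewrite ?ec ?es /=; ring.
Qed.

(** [r0] is a supremum that may not be attained, so the main proof works with some admissible radius
    above [2 r]. *)
Lemma tubular_exceeds gx gy L r0 c : is_r0 gx gy L r0 -> c < r0 ->
  exists rho, tubular_ok gx gy L rho /\ c < rho.
Proof.
move=> [_ lub] cr; apply: NNPP => h.
have : r0 <= c by apply: lub => rho ok; apply: Rnot_lt_le => lt; apply: h; exists rho.
lra.
Qed.

Lemma Derive_periodic f L : (forall s, f (s + L) = f s) -> (forall s, ex_derive f s) ->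
  forall s, Derive f (s + L) = Derive f s.
Proof.
move=> fL df s; symmetry; apply: is_derive_unique.
apply: (is_derive_ext (fun s => f (s + L))) => //.
have h := Derive_correct _ _ (df (s + L)).
have := is_derive_comp f (fun s => s + L) s _ 1 h.
rewrite /scal /= /mult /= Rmult_1_l; apply; auto_derive => //; ring.
Qed.

Lemma frame_derive t1 t2 d1 d2 : t1 ^ 2 + t2 ^ 2 = 1 -> t1 * d1 + t2 * d2 = 0 ->
  d1 = - (t1 * d2 - t2 * d1) * t2 /\ d2 = (t1 * d2 - t2 * d1) * t1.
Proof.
move=> u o; split.
  have -> : - (t1 * d2 - t2 * d1) * t2 = (t1 ^ 2 + t2 ^ 2) * d1 - t1 * (t1 * d1 + t2 * d2) by ring.
  by rewrite u o; ring.
have -> : (t1 * d2 - t2 * d1) * t1 = (t1 ^ 2 + t2 ^ 2) * d2 - t2 * (t1 * d1 + t2 * d2) by ring.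
by rewrite u o; ring.
Qed.

Lemma is_derive_sum_sq (u v : R -> R) s u' v' : is_derive u s u' -> is_derive v s v' ->
  is_derive (fun s => u s ^ 2 + v s ^ 2) s (2 * (u s * u' + v s * v')).
Proof.
move=> h1 h2; auto_derive; first by exd.
by rewrite (is_derive_unique _ _ _ h1) (is_derive_unique _ _ _ h2); ring.
Qed.

Lemma frenet gx gy : smooth1 gx -> smooth1 gy ->
  (forall s, Derive gx s ^ 2 + Derive gy s ^ 2 = 1) ->
  (forall s, is_derive (Derive gx) s (- curv gx gy s * Derive gy s)) /\
  (forall s, is_derive (Derive gy) s (curv gx gy s * Derive gx s)) /\
  (forall s, is_derive (curv gx gy) s (Derive (curv gx gy) s)).
Proof.
move=> sx sy unit.
have x1 s : is_derive (Derive gx) s (Derive (Derive gx) s) := Derive_correct _ _ (sx 2%N s).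
have y1 s : is_derive (Derive gy) s (Derive (Derive gy) s) := Derive_correct _ _ (sy 2%N s).
have x2 s : is_derive (Derive (Derive gx)) s (Derive (Derive (Derive gx)) s) :=
  Derive_correct _ _ (sx 3%N s).
have y2 s : is_derive (Derive (Derive gy)) s (Derive (Derive (Derive gy)) s) :=
  Derive_correct _ _ (sy 3%N s).
have orth s : Derive gx s * Derive (Derive gx) s + Derive gy s * Derive (Derive gy) s = 0.
  have d : is_derive (fun s => Derive gx s ^ 2 + Derive gy s ^ 2) s
      (2 * (Derive gx s * Derive (Derive gx) s + Derive gy s * Derive (Derive gy) s)).
    exact: is_derive_sum_sq.
  have := is_derive_unique _ _ _ d.
  by rewrite (Derive_ext _ (fun _ => 1)) // Derive_const; lra.
split; [|split] => s.
- by have [e _] := frame_derive (unit s) (orth s); rewrite /curv -e; exact: x1.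
- by have [_ e] := frame_derive (unit s) (orth s); rewrite /curv -e; exact: y1.
- apply: Derive_correct; rewrite /curv.
  have h1 := x1 s; have h2 := y1 s; have h3 := x2 s; have h4 := y2 s.
  apply: (@ex_derive_minus _ _ (fun s => Derive gx s * Derive (Derive gy) s)
    (fun s => Derive gy s * Derive (Derive gx) s));
    by apply: ex_derive_mult; eexists; eassumption.
Qed.

(** The velocity is [eps] times the tangent turned by [- phi], where [c] and [s] are the cosine and
    sine of [phi]; the reflection changes the sign of [phi]. *)
Lemma reflect_normal t1 t2 eps c s : t1 ^ 2 + t2 ^ 2 = 1 ->
  Defs.reflect (- t2, t1) (eps * (t1 * c + t2 * s), eps * (t2 * c - t1 * s))
  = (eps * (t1 * c - t2 * s), eps * (t2 * c + t1 * s)).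
Proof.
move=> u; rewrite /Defs.reflect /dot /=; congr pair.
  transitivity (eps * (t1 * c + t2 * s - 2 * t2 * (t1 ^ 2 + t2 ^ 2) * s)); first by ring.
  by rewrite u; ring.
transitivity (eps * (t2 * c - t1 * s + 2 * t1 * (t1 ^ 2 + t2 ^ 2) * s)); first by ring.
by rewrite u; ring.
Qed.

Unset Implicit Arguments.

Theorem theorem1p1 (gx gy : R -> R) (L r0 beta : R) (N : nat)
    (a : nat -> nat -> R -> R -> R) :
  simple_closed_arclength_ccw gx gy L ->
  is_r0 gx gy L r0 ->
  0 < beta ->
  / beta < r0 / 2 ->
  polynomial_integral gx gy beta N a ->
  nonconstant_on_Omega_plus gx gy beta N a ->
  real_oval_of_nonsingular_affine_curve (parallel_image gx gy (/ beta)) /\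
  real_oval_of_nonsingular_affine_curve (parallel_image gx gy (- / beta)).
Proof.
move=> [L0 [sx [sy [per [_ [unit_t _]]]]]] hr0 b0 br [a_smooth [flow mirror]] nonconst.
set r := / beta in br *.
have rp : 0 < r by apply: Rinv_0_lt_compat.
have [rho [[rho0 [inj jac]] r_rho]] := tubular_exceeds (c := 2 * r) hr0 ltac:(lra).
have a_sm k l : sm (a k l) := smooth2_sm (a_smooth k l).
have hgx s : is_derive gx s (Derive gx s) := Derive_correct _ _ (sx 1%N s).
have hgy s : is_derive gy s (Derive gy s) := Derive_correct _ _ (sy 1%N s).
have [ht1 [ht2 hK]] := frenet sx sy unit_t.
set t1 := Derive gx in hgx ht1 ht2 unit_t; set t2 := Derive gy in hgy ht1 ht2 unit_t.
set K := curv gx gy in ht1 ht2 hK jac.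
have gxL s : gx (s + L) = gx s := (per s).1.
have gyL s : gy (s + L) = gy s := (per s).2.
have t1L : forall s, t1 (s + L) = t1 s by apply: Derive_periodic => // s; exists (t1 s).
have t2L : forall s, t2 (s + L) = t2 s by apply: Derive_periodic => // s; exists (t2 s).
have parE c s : par gx gy c s = (parx gx t2 c s, pary gy t1 c s).
  by rewrite /par /nrm /parx /pary /= -/t1 -/t2; congr pair; ring.
have inj' s1 s2 c d : 0 <= s1 < L -> 0 <= s2 < L -> Rabs c < rho -> Rabs d < rho ->
    parx gx t2 c s1 = parx gx t2 d s2 -> pary gy t1 c s1 = pary gy t1 d s2 -> s1 = s2 /\ c = d.
  by move=> h1 h2 h3 h4 h5 h6; apply: inj => //; rewrite !parE h5 h6.
pose U := annulus gx gy t1 t2 r.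
have U_open x y : U x y -> exists e, 0 < e /\
    forall x' y', Rabs (x' - x) < e -> Rabs (y' - y) < e -> U x' y'.
  exact: (annulus_open hgx hgy ht1 ht2 unit_t L0 gxL gyL t1L t2L r_rho inj').
have U_conn f : sm f -> (forall x y, U x y -> Dx f x y = 0 /\ Dy f x y = 0) ->
    exists c, forall x y, U x y -> f x y = c.
  exact: (annulus_connected hgx hgy ht1 ht2 rp).
have U_ne : exists x y, U x y.
  by exists (parx gx t2 r 0), (pary gy t1 r 0), 0, r; split=> //; lra.
have window x y : U x y -> exists t0 e, 0 < e /\ forall t, Rabs (t - t0) < e ->
    exists kappa d, 0 < d /\ forall s, Rabs (s - t) < d ->
    Phi N a (larx r (x - r * sin t) s, lary r (y + r * cos t) s) (cos s, sin s) = kappa.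
  move=> Uxy; have [s [c [hc ex ey]]] := Uxy.
  (* For this direction the center has offset [c - r] over [s], hence lies closer than [r] to the
     curve, as [first_hit] requires. Nearby directions keep this property. *)
  have [t0 [e1 e2]] : exists t0, cos t0 = - t1 s /\ sin t0 = - t2 s.
    by apply: unit_angle; have := unit_t s; lra.
  have dX t : is_derive (fun t => x - r * sin t) t (- (r * cos t)) by auto_derive => //; ring.
  have dY t : is_derive (fun t => y + r * cos t) t (- (r * sin t)) by auto_derive => //; ring.
  have cr : 0 < r - Rabs (c - r).
    have : Rabs (c - r) < r by apply: Rabs_def1; lra.
    lra.
  have [e [e0 he]] := path_near dX dY t0 cr.
  exists t0, e; split=> // t /he hd.
  set cx := x - r * sin t in hd *; set cy := y + r * cos t in hd *.
  have dc : dist cx cy (gx s) (gy s) < r.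
    have := dist_tri (parx gx t2 (c - r) s) (pary gy t1 (c - r) s) cx cy (gx s) (gy s).
    rewrite (dist_par gx gy unit_t).
    have <- : x - r * sin t0 = parx gx t2 (c - r) s by rewrite e2 ex /parx; ring.
    have <- : y + r * cos t0 = pary gy t1 (c - r) s by rewrite e1 ey /pary; ring.
    lra.
  have [lx ly] := larx_at r x y t; rewrite -/cx -/cy in lx ly.
  have in1 : side gx gy t1 t2 rho 1 (larx r cx t) (lary r cy t).
    by rewrite lx ly; exact: (annulus_side r_rho Uxy).
  have [th0 [s0 [th0t hx hy hn hside]]] :=
    first_hit hgx hgy ht1 ht2 unit_t L0 gxL gyL t1L t2L rp r_rho inj' dc in1.
  have [e' [e'0 he']] := side_open hgx hgy ht1 ht2 unit_t L0 gxL gyL t1L t2L inj' (pow1 2) in1.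
  have [d [d0 hd']] := path_near (is_derive_larx r cx) (is_derive_lary r cy) t e'0.
  exists (Phi N a (gam gx gy s0) (cos th0, sin th0)), (Rmin d (t - th0)).
  split; first by apply: Rmin_glb_lt; lra.
  have m1 := Rmin_l d (t - th0); have m2 := Rmin_r d (t - th0).
  move=> u hu; have [u1 u2] := Rabs_def2 _ _ hu.
  (* Past [t] the openness of the inside takes over from [hside], so the integral is constant on
     both sides of [t]. *)
  have all_in v : th0 < v <= u -> side gx gy t1 t2 rho 1 (larx r cx v) (lary r cy v).
    move=> hv; have [vt|tv] := Rle_lt_dec v t; first by apply: hside; lra.
    by apply: he'; apply: hd'; apply: Rabs_def1; lra.
  have bne : beta <> 0 by lra.
  have [pe ve] := larmor_circle cx cy th0 u bne.
  have gE : gam gx gy s0 = (larx (/ beta) cx th0, lary (/ beta) cy th0).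
    by rewrite -/r hx hy.
  have := flow s0 (cos th0, sin th0) ((u - th0) / beta).
  rewrite gE pe ve; apply.
  - by rewrite /unit_vec /dot /=; have := sin2_cos2 th0; rewrite /Rsqr; lra.
  - by rewrite /dot /nrm /= -/t1 -/t2; lra.
  - by apply: Rdiv_lt_0_compat; lra.
  - move=> tau htau [s' hs'].
    have tE : tau = ((th0 + beta * tau) - th0) / beta by field.
    have [pe' _] := larmor_circle cx cy th0 (th0 + beta * tau) bne.
    rewrite -tE -/r in pe'; rewrite -/r pe' in hs'; case: hs' => hx' hy'.
    apply: (side_not_on_curve hgx hgy unit_t L0 gxL gyL t1L t2L inj' (pow1 2) (all_in _ _) hx' hy').
    have bt : 0 < beta * tau by apply: Rmult_lt_0_compat; lra.
    have : beta * tau <= beta * ((u - th0) / beta) by apply: Rmult_le_compat_l; lra.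
    have -> : beta * ((u - th0) / beta) = u - th0 by field.
    lra.
have [F hF] := center_polynomial U_open U_conn U_ne rp a_sm window.
(* Continuity in [c] extends the formula to both boundary curves: [c = 0] is where reflections act,
   and points with either end value may occur in the non-constancy hypothesis. *)
have on_closure c s v1 v2 : 0 <= c <= 2 * r -> v1 ^ 2 + v2 ^ 2 = 1 ->
    Phi N a (parx gx t2 c s, pary gy t1 c s) (v1, v2)
    = ev F (parx gx t2 c s - r * v2) (pary gy t1 c s + r * v1).
  move=> hc /unit_angle [t [<- <-]].
  pose h c := Phi N a (parx gx t2 c s, pary gy t1 c s) (cos t, sin t)
    - ev F (parx gx t2 c s - r * sin t) (pary gy t1 c s + r * cos t).
  have h0 d : 0 < d < 2 * r -> h d = 0.
    by move=> hd; rewrite /h hF; [ring|exists s, d].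
  have ch d : ex_derive h d.
    have x1 : is_derive (fun c => parx gx t2 c s) d (- t2 s) by rewrite /parx; auto_derive => //; ring.
    have y1 : is_derive (fun c => pary gy t1 c s) d (t1 s) by rewrite /pary; auto_derive => //; ring.
    have x2 : is_derive (fun c => parx gx t2 c s - r * sin t) d (- t2 s).
      by rewrite /parx; auto_derive => //; ring.
    have y2 : is_derive (fun c => pary gy t1 c s + r * cos t) d (t1 s).
      by rewrite /pary; auto_derive => //; ring.
    apply: (@ex_derive_minus _ _ (fun c => Phi N a (parx gx t2 c s, pary gy t1 c s) (cos t, sin t))
      (fun c => ev F (parx gx t2 c s - r * sin t) (pary gy t1 c s + r * cos t))).
      by apply: ex_derive_Phi => //; eexists; eassumption.
    by eexists; exact: is_derive_ev x2 y2.
  suff : h c = 0 by rewrite /h; lra.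
  have [c0|[c0|c0]] : 0 < c < 2 * r \/ c = 2 * r \/ c = 0 by lra.
  - exact: h0.
  - rewrite c0; apply: (continuous_const_at_end (a := 0)) => //; first lra.
    exact: ex_derive_continuous.
  (* [continuous_const_at_end] approaches from the left, so the end [c = 0] is reached after a
     change of sign. *)
  - have -> : h c = h (- 0) by rewrite c0 Ropp_0.
    apply: (continuous_const_at_end (h := fun c => h (- c)) (a := - (2 * r))).
    + lra.
    + apply: ex_derive_continuous; apply: ex_derive_comp; first exact: ch.
      by auto_derive.
    + by move=> d hd; apply: h0; lra.
have on_gamma s v1 v2 : v1 ^ 2 + v2 ^ 2 = 1 ->
    Phi N a (gam gx gy s) (v1, v2) = ev F (gx s - r * v2) (gy s + r * v1).
  move=> hv; have := @on_closure 0 s v1 v2 ltac:(lra) hv.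
  by rewrite /parx /pary !Rmult_0_l Rminus_0_r Rplus_0_r.
have Fnc : exists x y x' y', ev F x y <> ev F x' y'.
  apply: NNPP => h.
  have Fc x y x' y' : ev F x y = ev F x' y'.
    by apply: NNPP => h'; apply: h; exists x, y, x', y'.
  have [x1 [[v1 w1] [x2 [[v2 w2] [[s [c [hc ->]]] [u1 [[s' [c' [hc' ->]]] [u2 ne]]]]]]]] := nonconst.
  rewrite /unit_vec /dot /= in u1 u2.
  apply: ne; rewrite !parE !on_closure //; rewrite /r /=; lra.
(* By periodicity [gy] has a critical point, where the unit tangent is horizontal. *)
have t1_ne0 : exists s, t1 s <> 0.
  have [s [_ e]] := MVT_gen gy 0 L t2 (fun x _ => hgy x)
    (fun x _ => proj2 (continuity_pt_filterlim _ _) (ex_derive_continuous _ _ (ex_intro _ _ (hgy x)))).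
  have e0 : gy L = gy 0 by rewrite -(gyL 0) Rplus_0_l.
  exists s => z; have := unit_t s; rewrite z.
  have -> : t2 s = 0; last by lra.
  by move: e; rewrite e0; nra.
have oval eps : eps ^ 2 = 1 ->
    real_oval_of_nonsingular_affine_curve (parallel_image gx gy (eps * r)).
  move=> e1.
  have er : Rabs (eps * r) < rho by rewrite (abs_eps e1 rp); lra.
  have -> : parallel_image gx gy (eps * r) =
      (fun p => exists s, p = (parx gx t2 (eps * r) s, pary gy t1 (eps * r) s)).
    apply: functional_extensionality => p; rewrite /parallel_image.
    by congr ex; apply: functional_extensionality => s; rewrite parE.
  apply: (oval_of_even_polynomial hgx hgy ht1 ht2 hK unit_t _ _ L0 _ _ t1_ne0 _ Fnc).
  - by case: (eps_cases e1) => ->; lra.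
  - by move=> s; exact: jac.
  - by move=> s; rewrite /parx gxL t2L.
  - by move=> s; rewrite /pary gyL t1L.
  (* The velocity is the one for which [gamma s] plus [r] times the rotated velocity is the point of
     angle [phi] on the circle. *)
  have key s phi : circ gx gy t1 t2 (eps * r) F s phi
      = Phi N a (gam gx gy s) (eps * (t1 s * cos phi + t2 s * sin phi),
                               eps * (t2 s * cos phi - t1 s * sin phi)).
    rewrite on_gamma.
      by rewrite /circ /circx /circy; congr ev; ring.
    have sc := sin2_cos2 phi; rewrite /Rsqr in sc.
    transitivity (eps ^ 2 * ((t1 s ^ 2 + t2 s ^ 2) * (sin phi * sin phi + cos phi * cos phi))).
      ring.
    by rewrite e1 unit_t sc; ring.
  move=> s phi; rewrite !key mirror.
    rewrite /nrm -/t1 -/t2 reflect_normal // cos_neg sin_neg; congr Phi; congr pair; ring.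
  rewrite /unit_vec /dot /=.
  have sc := sin2_cos2 (- phi); rewrite /Rsqr in sc.
  transitivity (eps ^ 2 * ((t1 s ^ 2 + t2 s ^ 2) * (sin (- phi) * sin (- phi) + cos (- phi) * cos (- phi)))).
    ring.
  by rewrite e1 unit_t sc; ring.
split.
  by have := oval 1 (pow1 2); rewrite Rmult_1_l.
have := oval (-1) ltac:(ring).
by have -> : -1 * r = - r by ring.
Qed.
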